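(* Let $n\ge2$ and let $\Phi$ be the root system of type $B_n$ with coroot lattice $\check Q=\{x\in\mathbb Z^n:\sum_ix_i\in2\mathbb Z\}$ and uniform zeta map $\zeta:\check Q/(2n+1)\check Q\to\operatorname{Park}(\Phi)$. Then $\zeta\circ\psi=\varphi\circ\zeta_B$ as maps $\operatorname{Vert}(B_n)\to\operatorname{Park}(\Phi)$, where $\psi(\pi,v)=u\cdot\lambda+(2n+1)\check Q$, $\varphi(\beta,w)=[w,A_\beta]$, and $\zeta_B(\pi,v)=(\zeta_B(\pi),d_B(\pi,v))$.
   Context: Uniform setting: $\Phi$ irreducible crystallographic root system in Euclidean $V$, positive roots $\Phi^+$, simple roots $\Delta$, highest root $\tilde\alpha$, Weyl group $W$, Coxeter number $h$, coroot lattice $\check Q$ (span of $2\alpha/\langle\alpha,\alpha\rangle$). $H_{\alpha,k}=\{x:\langle x,\alpha\rangle=k\}$; the affine Weyl group $\widetilde W$ (generated by reflections in all $H_{\alpha,k}$) acts simply transitively on alcoves; $A_\circ=\{x:\langle x,\alpha\rangle>0\ \forall\alpha\in\Delta,\langle x,\tilde\alpha\rangle<1\}$; $C=\{x:\langle x,\alpha\rangle>0\ \forall\alpha\in\Delta\}$, chambers are $wC$. Shi arrangement: $H_{\alpha,k}$, $\alpha\in\Phi^+$, $k\in\{0,1\}$; each region $R$ contains a unique alcove closest to the origin, $\widetilde w_RA_\circ$. $\widetilde w_f\in\widetilde W$ with $\widetilde w_fA_\circ=\{x:\langle x,\alpha\rangle>1\ \forall\alpha\in\Delta,\langle x,\tilde\alpha\rangle<h\}$.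 Anderson map $\mathcal A(\widetilde w_R)=-\widetilde w_R\widetilde w_f^{-1}(0)+(h+1)\check Q$ (a bijection). Floors of an alcove: hyperplanes $H_{\alpha,k}$ supporting a facet, not through the origin, separating it from the origin. Root poset: $\alpha\le\beta$ iff $\beta-\alpha$ is a sum of positive roots. $\operatorname{Park}(\Phi)$: classes $[w,A]$, $w\in W$, $A$ an antichain, $(w,A)\sim(w',A')$ iff $A=A'$ and $wH=w'H$, $H=\langle s_\alpha:\alpha\in A\rangle$. $\Theta^{-1}(\widetilde w_R)=[w,A]$ with $\widetilde w_RA_\circ\subseteq wC$, $A=\{\alpha\in\Phi^+:H_{\alpha,1}$ a floor of $w^{-1}\widetilde w_RA_\circ\}$ (a bijection); $\zeta=\Theta^{-1}\circ\mathcal A^{-1}$. Type $B_n$: $\Phi^+=\{\pm e_i+e_j:i<j\}\cup\{e_i\}$, $\Delta=\{e_1\}\cup\{e_{i+1}-e_i:1\le i<n\}$, $\tilde\alpha=e_{n-1}+e_n$, $h=2n$, $W=\mathfrak S_n^B$ (bijections $w$ of $\{\pm1,\dots,\pm n\}$ with $w(-i)=-w(i)$; set $w(0)=0$) acting by $w\cdot e_i=e_{w(i)}$, $e_{-i}=-e_i$. Combinatorics: $\mathcal L_{n,n}$, words with $n$ $E$'s and $n$ $N$'s; $\mathcal B_{2n}$, length-$2n$ words whose prefixes have at least as many $N$'s as $E$'s; rise $i$: $i$-th $N$ followed by $N$; valley $(i,j)$: $i$-th $E$ followed by $j$-th $N$, plus $(i,j+1)$ if a ballot path with $i$ $E$'s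 and $j$ $N$'s ends with $E$. $\operatorname{Vert}(B_n)$: $(\pi,v)$, $v\in\mathfrak S_n^B$, $v(i)<v(i+1)$ for rises $i$, $v(1)>0$ if $\pi$ starts with $N$. $\pi_i$ = number of $E$'s before the $i$-th $N$; $\lambda_i=\pi_i$ ($i<n$), $\lambda_n=2\pi_n-\pi_{n-1}$ if $\pi_1+\dots+\pi_{n-2}$ even, $2n+1-2\pi_n+\pi_{n-1}$ if odd; $u\in\mathfrak S_n^B$: $u(i)=v(i)$ ($i<n$), $u(n)=(-1)^{\lambda_{n-1}+\lambda_n}v(n)$. Area vector: $\mu_i=\lambda_i-i$ ($i<n$), $\mu_n=\lambda_n-n$ if $n\equiv0,3\pmod4$, $n+1-\lambda_n$ if $n\equiv1,2\pmod4$. $\overrightarrow{S}^\pm_j,\overleftarrow{S}^\pm_j$ ($j\ge0$): read $a\in\mathbb Z^n$ left to right resp. right to left, writing $N$ for entries $j$ (resp. $-j$) and $E$ for entries $j+1$ (resp. $-j-1$). $\zeta_B(\pi)=\overleftarrow{S}^-_{2n}(\mu)\overrightarrow{S}^+_{2n}(\mu)\cdots\overleftarrow{S}^-_1(\mu)\overrightarrow{S}^+_1(\mu)\overleftarrow{S}^-_0(\mu)(N\overrightarrow{S}^+_0(\mu))^\circ$, $(\cdot)^\circ$ deleting the last letter. $d_B(\pi,v)$: for $i=0,1,\dots$ write $v(j)$ for $j$ with $\mu_j=-i$ (increasing $j$), then $-v(j)$ for $j$ with $\mu_j=i+1$ (decreasing $j$); if $\mu_{n-1}+\mu_n$ is even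 change the sign of the entry from row $n$. For a valley $(i,j)$ of $\beta\in\mathcal B_{2n}$: $\alpha_{i,j}=e_{n+1-i}-e_{n+1-j}$ ($j<n+1$), $e_{n+1-i}$ ($j=n+1$), $e_{n+1-i}+e_{j-n-1}$ ($j>n+1$); $A_\beta$ the set of these. $\operatorname{Diag}(B_n)$: $(\beta,w)$, $w\in\mathfrak S_n^B$, with $w(n+1-i)>w(n+1-j)$ for every valley $(i,j)$. *)

(* Defs.v *)
From HB Require Import structures.
From mathcomp Require Import all_boot all_order all_algebra.
From mathcomp Require Import all_classical all_reals all_analysis.

Set Implicit Arguments.
Unset Strict Implicit.
Unset Printing Implicit Defensive.

Import Order.TTheory GRing.Theory Num.Theory numFieldNormedType.Exports.
Local Open Scope classical_set_scope.
Local Open Scope ring_scope.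

(** * The uniform zeta map *)

(* Monoid of maps generated by S. It is only used for sets S of reflections;
   these are involutions, so it is the group generated by S. *)
Inductive generated (T : Type) (S : set (T -> T)) : set (T -> T) :=
| generated_id : generated S idfun
| generated_comp s f : S s -> generated S f -> generated S (s \o f).

(* The data of a based root system in the Euclidean space R^n. No root system
   axiom is imposed: the definitions below are only instantiated at type B. *)
Record root_data (R : realType) (n : nat) := RootData {
  posroot : set 'rV[R]_n;
  simpleroot : set 'rV[R]_n;
  highestroot : 'rV[R]_n;
  coxeter : nat }.

Section Uniform.
Variables (R : realType) (n : nat) (Phi : root_data R n).
Local Notation V := 'rV[R]_n.

Definition dot (x y : V) : R := \sum_i x 0 i * y 0 i.

Definition hyperplane (a : V) (k : int) : set V := [set x | dot x a = k%:~R].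

Definition coroot (a : V) : V := (2 / dot a a) *: a.

Definition reflection (a : V) (k : int) (x : V) : V :=
  x - (dot x a - k%:~R) *: coroot a.

Definition weyl : set (V -> V) :=
  generated [set s | exists2 a, posroot Phi a & s = reflection a 0].

Definition affine_weyl : set (V -> V) :=
  generated [set s | exists a k, posroot Phi a /\ s = reflection a k].

Definition coroot_lattice : set V :=
  [set x | exists2 s : seq (int * V),
      (forall p, p \in s -> posroot Phi p.2)
    & x = \sum_(p <- s) coroot p.2 *~ p.1].

(* The coset x + (h+1) Q, and the quotient Q / (h+1) Q as a set of cosets. *)
Definition coset_mod (x : V) : set V :=
  [set x + y *+ (coxeter Phi).+1 | y in coroot_lattice].

Definition lattice_quotient : set (set V) := coset_mod @` coroot_lattice.

Definition chamber : set V :=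
  [set x | forall a, simpleroot Phi a -> 0 < dot x a].

Definition alcove : set V := chamber `&` [set x | dot x (highestroot Phi) < 1].

(* H_{a,k} separates X from Y. The half-spaces are open, so H_{a,k} meets
   neither X nor Y. *)
Definition separates (a : V) (k : int) (X Y : set V) : Prop :=
  (X `<=` [set x | dot x a < k%:~R] /\ Y `<=` [set x | k%:~R < dot x a]) \/
  (X `<=` [set x | k%:~R < dot x a] /\ Y `<=` [set x | dot x a < k%:~R]).

(* closure A `&` H has nonempty interior relative to H, that is, it is a face
   of codimension one. *)
Definition supports_facet (H A : set V) : Prop :=
  exists2 x, H x & \forall y \near x, H y -> closure A y.

(* By the remark at separates, a floor does not contain the origin. *)
Definition is_floor (a : V) (k : int) (A : set V) : Prop :=
  [/\ posroot Phi a, supports_facet (hyperplane a k) A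
    & separates a k [set 0] A].

Definition shi_complement : set V :=
  [set x | forall a k, posroot Phi a -> k = 0 \/ k = 1 -> ~ hyperplane a k x].

Definition shi_region (S : set V) : Prop :=
  exists2 x, shi_complement x & S = connected_component shi_complement x.

(* The hyperplanes between the origin and A, indexed by (a, k). *)
Definition separating (A : set V) : set (V * int) :=
  [set p | posroot Phi p.1 /\ separates p.1 p.2 [set 0] A].

(* The elements w such that w(alcove) is the alcove of some Shi region that is
   closest to the origin: separated from it by the fewest hyperplanes. *)
Definition shi_minimal : set (V -> V) :=
  [set w | affine_weyl w /\
    exists S, [/\ shi_region S, w @` alcove `<=` S &
      forall w', affine_weyl w' -> w' @` alcove `<=` S ->
        (separating (w @` alcove) #<= separating (w' @` alcove))%card]].

Definition w_f : V -> V :=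
  xget (idfun : V -> V) [set w | affine_weyl w /\ w @` alcove =
    [set x | (forall a, simpleroot Phi a -> 1 < dot x a) /\
             dot x (highestroot Phi) < (coxeter Phi)%:R]].

Definition w_f_inv0 : V := xget (0 : V) [set x | w_f x = 0].

Definition anderson (w : V -> V) : set V := coset_mod (- w w_f_inv0).

Definition root_le (a b : V) : Prop :=
  exists2 s : seq V, (forall g, g \in s -> posroot Phi g)
                   & b - a = \sum_(g <- s) g.

Definition antichain (A : set V) : Prop :=
  A `<=` posroot Phi /\ forall a b, A a -> A b -> root_le a b -> a = b.

Definition left_coset (w : V -> V) (A : set V) : set (V -> V) :=
  [set w \o g | g in
     generated [set s | exists2 a, A a & s = reflection a 0]].

Definition park_pair : set ((V -> V) * set V) :=
  [set p | weyl p.1 /\ antichain p.2].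

Definition park_equiv (p q : (V -> V) * set V) : Prop :=
  p.2 = q.2 /\ left_coset p.1 p.2 = left_coset q.1 q.2.

(* The class [w, A], and Park(Phi) as the set of all classes. *)
Definition park_class (w : V -> V) (A : set V) : set ((V -> V) * set V) :=
  [set p | park_pair p /\ park_equiv p (w, A)].

Definition park : set (set ((V -> V) * set V)) :=
  [set c | exists2 p, park_pair p & c = park_class p.1 p.2].

(* The w in W such that A is contained in the chamber w C. *)
Definition chamber_of (A : set V) : V -> V :=
  xget (idfun : V -> V) [set w | weyl w /\ A `<=` w @` chamber].

(* Theta^{-1}; the preimage by the bijection w is the image by w^{-1}. *)
Definition theta_inv (wt : V -> V) : set ((V -> V) * set V) :=
  let w := chamber_of (wt @` alcove) in
  park_class w [set a | is_floor a 1 (w @^-1` (wt @` alcove))].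

Definition zeta (q : set V) : set ((V -> V) * set V) :=
  theta_inv (pinv_ (fun=> idfun) shi_minimal anderson q).

End Uniform.

(** * Type B *)

Section TypeB.
Variables (R : realType) (n : nat).
Local Notation V := 'rV[R]_n.

(* e_k for k > 0, with e_{-k} = - e_k and e_0 = 0. *)
Definition evec (k : int) : V :=
  \row_(j < n) ((k == j.+1%:Z)%:R - (k == - j.+1%:Z)%:R).

Definition typeB : root_data R n := {|
  posroot := [set x |
    (exists i j : nat, (0 < i < j)%N /\ (j <= n)%N /\
       (x = evec i + evec j \/ x = - evec i + evec j)) \/
    (exists2 i : nat, (0 < i <= n)%N & x = evec i)];
  simpleroot := [set x | x = evec 1 \/
    exists2 i : nat, (0 < i < n)%N & x = evec i.+1 - evec i];
  highestroot := evec n.-1 + evec n;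
  coxeter := 2 * n |}.

(* The linear action determined by w . e_i = e_{w(i)}. *)
Definition sperm_act (w : int -> int) (x : V) : V :=
  \sum_(i < n) x 0 i *: evec (w i.+1%:Z).

End TypeB.

(* Signed permutations; oddness gives w(0) = 0. Only the values on
   {-n, ..., n} matter. *)
Definition signed_perm (n : nat) (w : int -> int) : Prop :=
  (forall i, w (- i) = - w i) /\
  set_bij [set i : int | (0 < `|i| <= n)%N] [set i : int | (0 < `|i| <= n)%N] w.

(** * Lattice paths: words in N = true and E = false *)

Notation stepN := true (only parsing).
Notation stepE := false (only parsing).

Definition nN (p : seq bool) : nat := count_mem stepN p.
Definition nE (p : seq bool) : nat := count_mem stepE p.

Definition square_path (n : nat) : set (seq bool) :=
  [set p | nE p = n /\ nN p = n].

Definition ballot_path (m : nat) : set (seq bool) :=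
  [set p | size p = m /\ forall k, (nE (take k p) <= nN (take k p))%N].

(* Steps of each kind are numbered from 1. *)
Definition rise (p : seq bool) (i : nat) : Prop :=
  exists p1 p2, p = p1 ++ [:: stepN, stepN & p2] /\ i = (nN p1).+1.

Definition valley (p : seq bool) (i j : nat) : Prop :=
  (exists p1 p2, p = p1 ++ [:: stepE, stepN & p2] /\
     i = (nE p1).+1 /\ j = (nN p1).+1) \/
  (exists p1, p = rcons p1 stepE /\ i = nE p /\ j = (nN p).+1).

Definition Vert (n : nat) : set (seq bool * (int -> int)) :=
  [set pv | [/\ square_path n pv.1, signed_perm n pv.2,
    forall i : nat, rise pv.1 i -> pv.2 i < pv.2 i.+1
  & forall p, pv.1 = stepN :: p -> 0 < pv.2 1]].

Definition Diag (n : nat) : set (seq bool * (int -> int)) :=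
  [set bw | [/\ ballot_path (2 * n) bw.1, signed_perm n bw.2
  & forall i j : nat, valley bw.1 i j ->
      bw.2 (n%:Z + 1 - j%:Z) < bw.2 (n%:Z + 1 - i%:Z)]].

Section Combinatorics.
Variables (R : realType) (n : nat).
Local Notation V := 'rV[R]_n.

(* pi_i, the number of E's before the i-th N (i >= 1). *)
Definition easts (p : seq bool) (i : nat) : nat :=
  nth 0%N [seq nE (take k p) | k <- iota 0 (size p) & nth stepE p k == stepN] i.-1.

(* lambda_i and mu_i, for 1 <= i <= n. *)
Definition lambda (p : seq bool) (i : nat) : int :=
  if (i < n)%N then (easts p i)%:Z
  else if ~~ odd (\sum_(1 <= k < n.-1) easts p k)
  then 2 * (easts p n)%:Z - (easts p n.-1)%:Z
  else 2 * n%:Z + 1 - 2 * (easts p n)%:Z + (easts p n.-1)%:Z.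

Definition area (p : seq bool) (i : nat) : int :=
  if (i < n)%N then lambda p i - i%:Z
  else if (n %% 4 == 0)%N || (n %% 4 == 3)%N then lambda p n - n%:Z
  else n%:Z + 1 - lambda p n.

Definition area_vector (p : seq bool) : seq int :=
  [seq area p i | i <- iota 1 n].

(* u differs from v only in the sign at +-n. *)
Definition u_label (p : seq bool) (v : int -> int) (k : int) : int :=
  if `|k|%N == n then (-1) ^ (lambda p n.-1 + lambda p n) * v k else v k.

(* N for the entries a, E for the entries b, in the order of s. *)
Definition read_word (a b : int) (s : seq int) : seq bool :=
  [seq x == a | x <- s & (x == a) || (x == b)].

Definition Splus_right (j : nat) (a : seq int) : seq bool :=
  read_word j%:Z (j%:Z + 1) a.

Definition Sminus_left (j : nat) (a : seq int) : seq bool :=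
  read_word (- j%:Z) (- j%:Z - 1) (rev a).

(* belast x s is x :: s without its last letter. *)
Definition zetaB_path (p : seq bool) : seq bool :=
  let m := area_vector p in
  flatten [seq Sminus_left j m ++ Splus_right j m | j <- rev (iota 1 (2 * n))]
  ++ Sminus_left 0 m ++ belast stepN (Splus_right 0 m).

(* The word of d_B; a label v(j) is written together with its row j so that
   the entry from row n can be recognised. All |mu_j| are at most 2n, hence
   the range of i. *)
Definition d_word (p : seq bool) (v : int -> int) : seq int :=
  let rows := flatten [seq
      [seq (j, v j%:Z) | j <- iota 1 n & area p j == - i%:Z] ++
      [seq (j, - v j%:Z) | j <- rev (iota 1 n) & area p j == i%:Z + 1]
    | i <- iota 0 (2 * n).+1] in
  [seq if (r.1 == n) && (2 %| area p n.-1 + area p n)%Z then - r.2 else r.2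
    | r <- rows].

(* The odd function with values s on 1, 2, ..., size s. *)
Definition sperm_of_word (s : seq int) (k : int) : int :=
  sgz k * nth 0 s `|k|.-1.

Definition d_B (p : seq bool) (v : int -> int) : int -> int :=
  sperm_of_word (d_word p v).

Definition zetaB (pv : seq bool * (int -> int)) : seq bool * (int -> int) :=
  (zetaB_path pv.1, d_B pv.1 pv.2).

Definition valley_root (i j : nat) : V :=
  if (j < n.+1)%N then evec R n (n.+1 - i)%N - evec R n (n.+1 - j)%N
  else if j == n.+1 then evec R n (n.+1 - i)%N
  else evec R n (n.+1 - i)%N + evec R n (j - n.+1)%N.

Definition valley_roots (b : seq bool) : set V :=
  [set x | exists i j, valley b i j /\ x = valley_root i j].

Definition lambda_vec (p : seq bool) : V := \row_(i < n) (lambda p i.+1)%:~R.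

Definition psi (pv : seq bool * (int -> int)) : set V :=
  coset_mod (typeB R n) (sperm_act (u_label pv.1 pv.2) (lambda_vec pv.1)).

Definition phi (bw : seq bool * (int -> int)) : set ((V -> V) * set V) :=
  park_class (typeB R n) (sperm_act bw.2) (valley_roots bw.1).

End Combinatorics.

Arguments psi R n pv : clear implicits.
Arguments phi R n bw : clear implicits.

(* Main.v *)
(** An element f of the affine Weyl group is given by a signed permutation g and an
odd integer function m with f(x)_{g(k)} = x_k - m(k) for |k| <= n, signed
coordinates being x_{-k} = - x_k. Assign to the row r in {-n, ..., n} the position
Y(r) = r - 2n m(r). Then the alcove of f is the minimal alcove of a Shi region iff
Y(r') <= Y(r) + 2n + 1 whenever r' = r + 1 or r' = r + 1 - 2n, with g(r) < g(r') in
case of equality. A vertically labelled path (pi, v) yields such an f: m is its area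
vector and g is v up to the sign at n. Moreover - f(w_f^{-1}(0)) is the vector
u . lambda itself, so f is the preimage of psi(pi, v) under the Anderson map.

Sorting the rows by position gives the chamber of f, which is what d_B does, and the
floors of f of height 1 are the pairs of rows at distance exactly 2n + 1. Let every
row r contribute a step N at 2 Y(r) if m(r) <= 0 and a step E at 2 (Y(r) - 2n) - 1
if m(r) < 0. Read from the highest step downwards, these form zeta_B(pi) followed
by one more step. The bound on Y forces the distance 2n + 1 whenever an E is
immediately followed by an N, so the valleys are the floors of height 1. *)
Require Import Defs.
From mathcomp Require Import all_boot all_order all_algebra.
From mathcomp Require Import all_classical all_reals all_analysis.
From mathcomp Require Import zify ring lra.

Set Implicit Arguments.
Unset Strict Implicit.
Unset Printing Implicit Defensive.

Import Order.TTheory GRing.Theory Num.Theory numFieldNormedType.Exports.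
Local Open Scope classical_set_scope.
Local Open Scope ring_scope.

(** * Signed coordinates and the roots of type B *)

(** Row 0 is kept because the short root e_k is e_k - e_0: every positive root is then a difference
    e_k - e_l, and every hyperplane is a condition on the distance of two rows. The price is that 2n
    + 1 rows share 2n residues modulo 2n, n and -n having the same one, and that the pair r, -r
    belongs to no root. Most of the special cases below stem from this. Adjacent rows are the walls
    of the alcove. If a wall of positive height is not a Shi hyperplane, the reflection in it stays
    in the Shi region and removes one separating hyperplane, so the alcove is not minimal.
    Conversely, for another point of the region only the heights 0 and 1 are known; larger heights
    are recovered by climbing from row to row. Since [zeta] takes a preimage under the Anderson map,
    the preimage is identified by injectivity on minimal elements: two of them in one class give an
    affine Weyl group element between two points of the fundamental alcove, hence the identity. *)

Definition co (R : realType) (n : nat) (x : 'rV[R]_n) (k : int) : R :=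
  dot x (evec R n k).

Definition vec (R : realType) (n : nat) (F : int -> R) : 'rV[R]_n :=
  \row_i F i.+1%:Z.

Lemma neq_opp_sym (k l : int) : k != - l -> l != - k.
Proof. by rewrite eq_sym eqr_oppLR. Qed.

Section Coordinates.
Variables (R : realType) (n : nat).
Implicit Types (x y : 'rV[R]_n) (k l : int).
Local Notation e := (evec R n).

Lemma dotC x y : dot x y = dot y x.
Proof. by apply: eq_bigr => i _; rewrite mulrC. Qed.

Lemma dotDl x y z : dot (x + y) z = dot x z + dot y z.
Proof. by rewrite -big_split; apply: eq_bigr => i _; rewrite mxE mulrDl. Qed.

Lemma dotZl c x z : dot (c *: x) z = c * dot x z.
Proof. by rewrite mulr_sumr; apply: eq_bigr => i _; rewrite mxE mulrA. Qed.

Lemma dotNl x z : dot (- x) z = - dot x z.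
Proof. by rewrite -scaleN1r dotZl mulN1r. Qed.

Lemma dotBr z x y : dot z (x - y) = dot z x - dot z y.
Proof. by rewrite dotC dotDl dotNl ![dot _ z]dotC. Qed.

Lemma dot0l x : dot 0 x = 0.
Proof. by rewrite -(scale0r 0) dotZl mul0r. Qed.

Lemma evecN k : e (- k) = - e k.
Proof.
apply/rowP => i; rewrite !mxE opprB.
have -> : (- k == i.+1%:Z) = (k == - i.+1%:Z) by apply/eqP/eqP; lia.
by have -> : (- k == - i.+1%:Z) = (k == i.+1%:Z) by apply/eqP/eqP; lia.
Qed.

Lemma evec0 : e 0 = 0.
Proof.
apply/rowP => i; rewrite !mxE.
have -> : (0 == i.+1%:Z) = false by apply/eqP; lia.
have -> : (0 == - i.+1%:Z) = false by apply/eqP; lia.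
by rewrite subrr.
Qed.

Lemma coD x y k : co (x + y) k = co x k + co y k.
Proof. exact: dotDl. Qed.

Lemma coN x k : co (- x) k = - co x k.
Proof. exact: dotNl. Qed.

Lemma coB x y k : co (x - y) k = co x k - co y k.
Proof. by rewrite coD coN. Qed.

Lemma coZ c x k : co (c *: x) k = c * co x k.
Proof. exact: dotZl. Qed.

Lemma coMn x k i : co (x *+ i) k = co x k *+ i.
Proof. by rewrite -scaler_nat coZ mulr_natl. Qed.

Lemma coMz x k i : co (x *~ i) k = co x k *~ i.
Proof. by case: i => i; rewrite -?pmulrn ?coMn // !NegzE !mulrNz coN -!pmulrn coMn. Qed.

Lemma co_sum I (s : seq I) (P : pred I) (F : I -> 'rV[R]_n) k :
  co (\sum_(i <- s | P i) F i) k = \sum_(i <- s | P i) co (F i) k.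
Proof.
elim: s => [|i s IH]; first by rewrite !big_nil /co dot0l.
by rewrite !big_cons; case: ifP => _; rewrite ?coD IH.
Qed.

Lemma co_opp x k : co x (- k) = - co x k.
Proof. by rewrite /co evecN dotC dotNl dotC. Qed.

Lemma co0 x : co x 0 = 0.
Proof. by rewrite /co evec0 dotC dot0l. Qed.

Lemma co_ord x (i : 'I_n) : co x i.+1%:Z = x 0 i.
Proof.
rewrite /co /dot (bigD1 i) //= big1 ?addr0 => [|j ne].
  by rewrite mxE eqxx subr0 mulr1.
rewrite mxE; case: eqP => [/eqP|_]; first by rewrite eqz_nat eqSS; case/eqP=> /val_inj ij; rewrite ij eqxx in ne.
by rewrite subr0 mulr0.
Qed.

Lemma ord_of k : 0 < k -> (`|k| <= n)%N -> exists i : 'I_n, k = i.+1%:Z.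
Proof.
move=> k0 kn; have h : (`|k|.-1 < n)%N by lia.
by exists (Ordinal h) => /=; lia.
Qed.

Lemma co_inj x y :
  (forall k, 0 < k -> (`|k| <= n)%N -> co x k = co y k) -> x = y.
Proof.
move=> h; apply/rowP => i; rewrite -!co_ord; apply: h => //.
exact: (ltn_ord i).
Qed.

Lemma co_vec (F : int -> R) k :
  (forall l, F (- l) = - F l) -> (`|k| <= n)%N -> co (vec n F) k = F k.
Proof.
move=> Fo; have pos l : 0 < l -> (`|l| <= n)%N -> co (vec n F) l = F l.
  by move=> l0 ln; have [i ->] := ord_of l0 ln; rewrite co_ord mxE.
move=> kn; have [k0|k0|->] := ltgtP k 0.
- by rewrite -[k]opprK co_opp Fo pos //; lia.
- exact: pos.
- by rewrite co0; move: (Fo 0); rewrite oppr0 => /eqP; rewrite -addr_eq0 -mulr2n mulrn_eq0 /= => /eqP.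
Qed.

Lemma co_out x k : (n < `|k|)%N -> co x k = 0.
Proof.
move=> nk; rewrite /co /dot big1 // => i _; rewrite mxE.
have := ltn_ord i; case: eqP => [|_]; first by lia.
by case: eqP => [|_]; [lia|rewrite subr0 mulr0].
Qed.

Lemma co_evec k l : (`|k| <= n)%N -> (`|l| <= n)%N -> k != 0 ->
  co (e k) l = (k == l)%:R - (k == - l)%:R.
Proof.
move=> kn ln k0; have E : e k = vec n (fun l => (k == l)%:R - (k == - l)%:R).
  by apply/rowP => i; rewrite !mxE.
by rewrite E co_vec // => l'; rewrite opprK opprB.
Qed.

Lemma dot_root x k l : dot x (e k - e l) = co x k - co x l.
Proof. by rewrite dotBr. Qed.

(** Index 0 covers the short roots, and [k != - l] excludes the vectors 2 e_k. Each root occurs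
    twice, for (k, l) and for (-l, -k); later symmetry arguments choose between the two. *)
Lemma posrootP a : posroot (typeB R n) a <-> exists k l,
  [/\ (`|k| <= n)%N, (`|l| <= n)%N, l < k, k != - l & a = e k - e l].
Proof.
split=> [[[i [j [ij [jn H]]]]|[i ij ->]]|[k [l [kn ln lk nkl ->]]]].
- case: H => ->; [exists j%:Z, (- i%:Z)|exists j%:Z, i%:Z]; rewrite ?evecN ?opprK.
    by split; [lia|lia|lia|lia|rewrite addrC].
  by split; [lia|lia|lia|lia|rewrite addrC].
- by exists i%:Z, 0; rewrite evec0 subr0; split => //; lia.
(* Of the pairs (k, l) and (-l, -k), one has its larger index dominating in absolute value. *)
wlog kl : k l kn ln lk nkl / `|l| < k => [W|].
  have [h|h] : `|l| < k \/ `|- k| < - l by lia.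
    exact: W.
  have -> : e k - e l = e (- l) - e (- k) by rewrite !evecN opprK addrC.
  by apply: W; lia.
have [l0|l0|->] := ltgtP l 0.
- left; exists `|l|%N, `|k|%N; split; first lia; split; first lia; left.
  have -> : `|l|%N%:Z = - l by lia.
  have -> : `|k|%N%:Z = k by lia.
  by rewrite evecN addrC.
- left; exists `|l|%N, `|k|%N; split; first lia; split; first lia; right.
  have -> : `|l|%N%:Z = l by lia.
  have -> : `|k|%N%:Z = k by lia.
  by rewrite addrC.
- right; exists `|k|%N; first lia.
  have -> : `|k|%N%:Z = k by lia.
  by rewrite evec0 subr0.
Qed.

Hypothesis n2 : (2 <= n)%N.

(** The simple roots make the coordinates increase from x_0 = 0 on; oddness carries this over to the
    negative indices. *)
Lemma chamberP x : chamber (typeB R n) x <->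
  forall k l, (`|k| <= n)%N -> (`|l| <= n)%N -> l < k -> co x l < co x k.
Proof.
split=> [C k l kn ln lk|H a [->|[i iP ->]]]; last first.
- by rewrite dot_root subr_gt0; apply: H; lia.
- by rewrite -[e 1]subr0 -evec0 dot_root subr_gt0; apply: H; lia.
have C1 : 0 < co x 1 by apply: C; left.
have step (i : nat) : (0 < i < n)%N -> co x i < co x i.+1.
  by move=> iP; rewrite -subr_gt0 -dot_root; apply: C; right; exists i.
have steps (j d : nat) : (0 < j)%N -> (j + d.+1 <= n)%N -> co x j < co x (j + d.+1)%N.
  move=> j0; elim: d => [|d IH] h; first by rewrite addn1; apply: step; lia.
  apply: lt_trans (IH _) _; first lia.
  by rewrite [(j + d.+2)%N]addnS; apply: step; lia.
have mono (i j : nat) : (0 < i < j)%N -> (j <= n)%N -> co x i < co x j.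
  move=> ij jn; have -> : j = (i + (j - i).-1.+1)%N by lia.
  by apply: steps; lia.
have pos (i : nat) : (0 < i <= n)%N -> 0 < co x i.
  case: i => [|[|i]] // iP; apply: lt_trans C1 _.
  by apply: (mono 1%N); lia.
have posz (i : int) : 0 < i -> (`|i| <= n)%N -> 0 < co x i.
  move=> i0 iN; have -> : i = `|i|%N by lia.
  by apply: pos; lia.
have monoz i j : 0 < i < j -> (`|j| <= n)%N -> co x i < co x j.
  move=> ij jn; have -> : i = `|i|%N by lia.
  have -> : j = `|j|%N by lia.
  by apply: mono; lia.
have [l0|l0] : 0 < l \/ l <= 0 by lia.
  by apply: monoz; lia.
have [k0|k0] : k < 0 \/ 0 <= k by lia.
  rewrite -[l]opprK -[k]opprK !(co_opp _ (- _)) ltrN2; apply: monoz; lia.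
have [kz|kn0] := eqVneq k 0.
  rewrite kz co0 -[l]opprK co_opp oppr_lt0; apply: posz; lia.
apply: (@le_lt_trans _ _ 0); last by apply: posz; lia.
have [lz|ln0] := eqVneq l 0; first by rewrite lz co0.
rewrite -[l]opprK co_opp oppr_le0; apply/ltW/posz; lia.
Qed.

Lemma alcove_chamber x : alcove (typeB R n) x -> chamber (typeB R n) x.
Proof. by case. Qed.

Lemma alcoveP x : alcove (typeB R n) x <->
  (forall k, 0 <= k < n%:Z -> co x k < co x (k + 1)) /\
  co x (n%:Z - 1) + co x n%:Z < 1.
Proof.
have hE : dot x (highestroot (typeB R n)) = co x (n%:Z - 1) + co x n%:Z.
  have -> : n%:Z - 1 = n.-1 by lia.
  by rewrite /= dotC dotDl !(dotC _ x).
split=> [[/chamberP C]|[C hi]].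
  by rewrite /= hE => hi; split=> // k kP; apply: C; lia.
split; last by rewrite /= hE.
move=> a [->|[i iP ->]].
  by rewrite -[e 1]subr0 -evec0 dot_root subr_gt0 (C 0) //; lia.
rewrite dot_root subr_gt0 -addn1 PoszD; apply: C; lia.
Qed.

(** As k = -l is excluded, the largest difference is x_n + x_{n-1}, the value of the highest
    root. *)
Lemma alcove_bounds x k l : alcove (typeB R n) x ->
  (`|k| <= n)%N -> (`|l| <= n)%N -> l < k -> k != - l ->
  0 < co x k - co x l < 1.
Proof.
move=> A kn ln lk nkl; have /chamberP C := alcove_chamber A.
have [_ hi] := (alcoveP x).1 A.
rewrite subr_gt0 C //=.
have Cw a b : (`|a| <= n)%N -> (`|b| <= n)%N -> a <= b -> co x a <= co x b.
  move=> an bn; rewrite le_eqVlt => /orP[/eqP-> //|ab].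
  exact/ltW/C.
apply: le_lt_trans hi; have [kN|kN] : k = n%:Z \/ k <= n%:Z - 1 by lia.
  by rewrite kN addrC lerD2r -co_opp Cw //; lia.
by apply: lerD; rewrite -?co_opp Cw //; lia.
Qed.

(** Both x_k - x_l and (k - l) / 2n lie strictly between -1 and 1 and have the same sign, so no
    integer separates them. *)
Lemma alcove_sign x k l (j : int) : alcove (typeB R n) x ->
  (`|k| <= n)%N -> (`|l| <= n)%N -> k != l -> k != - l ->
  (j%:~R < co x k - co x l) = (2 * n%:Z * j < k - l).
Proof.
move=> A kn ln kl nkl; have [lk|lk] : l < k \/ k < l by lia.
  have /andP[h0 h1] := alcove_bounds A kn ln lk nkl.
  have [j0|j0] := lerP j 0.
    have j1 : (j%:~R : R) <= 0 by rewrite lerz0.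
    rewrite (le_lt_trans j1 h0).
    by symmetry; nia.
  have j1 : (1 : R) <= j%:~R by rewrite ler1z; lia.
  rewrite ltNge (le_trans (ltW h1) j1) /=; symmetry; apply/negbTE; rewrite -leNgt; nia.
have nlk : l != - k by lia.
have /andP[h0 h1] := alcove_bounds A ln kn lk nlk.
have [j0|j0] := lerP 0 j.
  have j1 : (0 : R) <= j%:~R by rewrite ler0z.
  rewrite ltNge; have -> /= : co x k - co x l <= j%:~R by lra.
  symmetry; apply/negbTE; rewrite -leNgt; nia.
have j1 : (j%:~R : R) <= -1 by rewrite -[-1]/((-1)%:~R) ler_int; lia.
have -> : j%:~R < co x k - co x l by lra.
by symmetry; nia.
Qed.

Lemma alcove_sign_lt x k l (j : int) : alcove (typeB R n) x ->
  (`|k| <= n)%N -> (`|l| <= n)%N -> k != l -> k != - l ->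
  (co x k - co x l < j%:~R) = (k - l < 2 * n%:Z * j).
Proof.
move=> A kn ln kl nkl; have lk : l != k by rewrite eq_sym.
have nlk : l != - k by lia.
have := alcove_sign (- j) A ln kn lk nlk.
rewrite mulrNz ltrNl opprB => ->; lia.
Qed.
End Coordinates.

(** * Signed permutations and the affine Weyl group *)

Lemma odd_fun0 (m : int -> int) : (forall k, m (- k) = - m k) -> m 0 = 0.
Proof.
move=> mo; move: (mo 0); rewrite oppr0 => /eqP.
by rewrite -addr_eq0 -mulr2n mulrn_eq0 => /eqP.
Qed.

Section SignedPerm.
Variable n : nat.
Implicit Types (g h m : int -> int) (k l : int).

Lemma signed_perm_intro g h : (forall k, g (- k) = - g k) ->
  (forall k, (0 < `|k| <= n)%N -> (0 < `|g k| <= n)%N /\ h (g k) = k) ->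
  (forall k, (0 < `|k| <= n)%N -> (0 < `|h k| <= n)%N /\ g (h k) = k) ->
  signed_perm n g.
Proof.
move=> go gh hg; split=> //; split=> [k /gh[]//|k l|k /hg[hk E]].
  by rewrite !inE => /gh[_ E1] /gh[_ E2] E; rewrite -E1 -E2 E.
by exists (h k).
Qed.

Section One.
Variable g : int -> int.
Hypothesis gP : signed_perm n g.

Lemma sperm_opp k : g (- k) = - g k. Proof. by case: gP. Qed.

Lemma sperm0 : g 0 = 0.
Proof. exact: odd_fun0 sperm_opp. Qed.

Lemma sperm_bound k : (`|k| <= n)%N -> (`|g k| <= n)%N.
Proof.
move=> kn; have [->|k0] := eqVneq k 0; first by rewrite sperm0.
case: gP => _ [f _ _]; have /f /= : [set i : int | (0 < `|i| <= n)%N] k by rewrite /=; lia.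
by case/andP.
Qed.

Lemma sperm_neq0 k : (`|k| <= n)%N -> k != 0 -> g k != 0.
Proof.
move=> kn k0.
case: gP => _ [f _ _]; have /f /= : [set i : int | (0 < `|i| <= n)%N] k by rewrite /=; lia.
by lia.
Qed.

Lemma sperm_inj k l : (`|k| <= n)%N -> (`|l| <= n)%N -> g k = g l -> k = l.
Proof.
move=> kn ln E; have [k0|k0] := eqVneq k 0.
  have [->//|l0] := eqVneq l 0.
  by have := sperm_neq0 ln l0; rewrite -E k0 sperm0 eqxx.
have [l0|l0] := eqVneq l 0.
  by have := sperm_neq0 kn k0; rewrite E l0 sperm0 eqxx.
case: gP => _ [_ i _]; apply: i => //; rewrite inE /=; lia.
Qed.

Lemma sperm_eq k l : (`|k| <= n)%N -> (`|l| <= n)%N -> (g k == g l) = (k == l).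
Proof. by move=> kn ln; apply/eqP/eqP => [/sperm_inj->//|->]. Qed.

Lemma sperm_eqN k l : (`|k| <= n)%N -> (`|l| <= n)%N -> (g k == - g l) = (k == - l).
Proof. by move=> kn ln; rewrite -sperm_opp sperm_eq //; lia. Qed.

Lemma sperm_inverse : exists2 h, signed_perm n h &
  forall k, (`|k| <= n)%N -> h (g k) = k /\ g (h k) = k.
Proof.
have [h0 h0P] : {h0 : int -> int & forall k, (0 < `|k| <= n)%N -> (0 < `|h0 k| <= n)%N /\ g (h0 k) = k}.
  apply: (@choice _ _ (fun k y => (0 < `|k| <= n)%N -> (0 < `|y| <= n)%N /\ g y = k)) => k.
  have [kn|kn] := boolP (0 < `|k| <= n)%N; last by exists 0.
  by case: gP => _ [_ _ /(_ k kn)[y yn E]]; exists y.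
pose h k : int := if (0 < `|k| <= n)%N then h0 k else k.
have hP k : (0 < `|k| <= n)%N -> (0 < `|h k| <= n)%N /\ g (h k) = k.
  by move=> kn; rewrite /h kn; apply: h0P.
have h_0 : h 0 = 0 by [].
have Kh k : (0 < `|k| <= n)%N -> (0 < `|g k| <= n)%N /\ h (g k) = k.
  move=> kn; have gk : (0 < `|g k| <= n)%N.
    have := @sperm_bound k; have := @sperm_neq0 k; lia.
  split=> //; have [b E] := hP _ gk.
  by apply: sperm_inj E; lia.
exists h => [|k kn].
  apply: (signed_perm_intro (h := g)) => // k.
  have [kn|kn] := boolP (0 < `|k| <= n)%N; last first.
    have kn' : ~~ (0 < `|- k| <= n)%N by lia.
    by rewrite /h (negbTE kn) (negbTE kn').
  have kn' : (0 < `|- k| <= n)%N by lia.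
  have [b E] := hP _ kn; have [b' E'] := hP _ kn'.
  apply: sperm_inj; [lia|lia|by rewrite E' sperm_opp E].
have [->|k0] := eqVneq k 0; first by rewrite h_0 sperm0 h_0.
by split; [apply Kh|apply hP]; lia.
Qed.

End One.

Lemma sperm_comp g h : signed_perm n g -> signed_perm n h -> signed_perm n (g \o h).
Proof.
move=> gP hP; have [g' g'P gK] := sperm_inverse gP; have [h' h'P hK] := sperm_inverse hP.
apply: (signed_perm_intro (h := h' \o g')) => [k|k kn|k kn] /=.
- by rewrite !sperm_opp.
- have kn' : (`|k| <= n)%N by lia.
  have k0 : k != 0 by lia.
  have b := sperm_bound hP kn'; have b' := sperm_bound gP b.
  have c := sperm_neq0 hP kn' k0; have c' := sperm_neq0 gP b c.
  by split; [lia|rewrite (gK _ b).1 (hK _ kn').1].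
- have kn' : (`|k| <= n)%N by lia.
  have k0 : k != 0 by lia.
  have b := sperm_bound g'P kn'; have b' := sperm_bound h'P b.
  have c := sperm_neq0 g'P kn' k0; have c' := sperm_neq0 h'P b c.
  by split; [lia|rewrite (hK _ b).2 (gK _ kn').2].
Qed.

Lemma sperm_id : signed_perm n id.
Proof. exact: (signed_perm_intro (h := id)). Qed.

Definition coord_sum (m : int -> int) : int := \sum_(i < n) m i.+1%:Z.

(** A signed permutation rearranges the values up to sign, and a sign change preserves parity. *)
Lemma coord_sum_sperm m g : (forall k, m (- k) = - m k) -> signed_perm n g ->
  (2 %| coord_sum (m \o g) - coord_sum m)%Z.
Proof.
move=> mo gP; have b (i : 'I_n) : (`|g i.+1%:Z|.-1 < n)%N.
  have i1 : (`|i.+1%:Z| <= n)%N by have := ltn_ord i; lia.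
  by have := sperm_bound gP i1; have := sperm_neq0 gP i1 isT; lia.
pose s i := Ordinal (b i).
have si : injective s.
  move=> i j [] E; apply/val_inj => /=.
  have i1 : (`|i.+1%:Z| <= n)%N by have := ltn_ord i; lia.
  have j1 : (`|j.+1%:Z| <= n)%N by have := ltn_ord j; lia.
  have := sperm_neq0 gP i1 isT; have := sperm_neq0 gP j1 isT => p q.
  have [|] : g i.+1%:Z = g j.+1%:Z \/ g i.+1%:Z = - g j.+1%:Z by lia.
    by move=> /(sperm_inj gP i1 j1); lia.
  rewrite -sperm_opp // => /(sperm_inj gP i1); lia.
rewrite /coord_sum [X in _ - X](reindex_inj si) /= -sumrB.
apply: (big_ind (fun x : int => (2 %| x)%Z)) => [|x y|i _]; [by []|lia|].
have i1 : (`|i.+1%:Z| <= n)%N by have := ltn_ord i; lia.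
have := sperm_neq0 gP i1 isT => p.
have [gp|gp] : 0 < g i.+1%:Z \/ g i.+1%:Z < 0 by lia.
  rewrite (_ : Posz (`|g i.+1%:Z|.-1.+1) = g i.+1%:Z) ?subrr //; lia.
have -> : Posz (`|g i.+1%:Z|.-1.+1) = - g i.+1%:Z by lia.
rewrite mo; lia.
Qed.

(** The linear part of a reflection: for a = -b it is the sign change at b, which belongs to the
    short root e_b. *)
Definition sswap (a b k : int) : int :=
  if k == a then b else if k == b then a else
  if k == - a then - b else if k == - b then - a else k.

Lemma sswap_sperm a b : (`|a| <= n)%N -> (`|b| <= n)%N -> a != 0 -> b != 0 ->
  signed_perm n (sswap a b).
Proof.
move=> an bn a0 b0; apply: (signed_perm_intro (h := sswap a b)) => k; rewrite /sswap;
  do ![case: ifP => /eqP ?]; lia.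
Qed.

Lemma sswapK a b k : a != 0 -> b != 0 -> sswap a b (sswap a b k) = k.
Proof.
move=> a0 b0; rewrite /sswap.
case: (eqVneq k a) => ? /=; first by do ![case: eqVneq => ? //=]; lia.
case: (eqVneq k b) => ? /=; first by do ![case: eqVneq => ? //=]; lia.
case: (eqVneq k (- a)) => ? /=; first by do ![case: eqVneq => ? //=]; lia.
case: (eqVneq k (- b)) => ? /=; first by do ![case: eqVneq => ? //=]; lia.
by do ![case: eqVneq => ? //=]; lia.
Qed.

End SignedPerm.

Lemma generated_cat T (S : set (T -> T)) f h :
  generated S f -> generated S h -> generated S (f \o h).
Proof.
elim=> [//|s f' Ss _ IH] /IH; exact: generated_comp.
Qed.

Lemma generated_sub T (S S' : set (T -> T)) f :
  S `<=` S' -> generated S f -> generated S' f.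
Proof. by move=> SS; elim=> [|s f' /SS]; [exact: generated_id|move=> *; exact: generated_comp]. Qed.

Section AffineWeyl.
Variables (R : realType) (n : nat).
Hypothesis n2 : (2 <= n)%N.
Implicit Types (x y : 'rV[R]_n) (k l : int) (g m : int -> int).
Local Notation e := (evec R n).
Local Notation V := 'rV[R]_n.

Lemma co_sperm_act g x k : signed_perm n g -> (`|k| <= n)%N ->
  co (sperm_act g x) (g k) = co x k.
Proof.
move=> gP; have pos l : 0 < l -> (`|l| <= n)%N -> co (sperm_act g x) (g l) = co x l.
  move=> l0 ln; have [i ->] := ord_of l0 ln.
  have bj (j : 'I_n) : (`|j.+1%:Z| <= n)%N by have := ltn_ord j; lia.
  have gj (j : 'I_n) : g j.+1%:Z != 0 := sperm_neq0 gP (bj j) isT.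
  rewrite co_sum (bigD1 i) //= big1 ?addr0 => [|j ne]; rewrite coZ co_evec ?sperm_bound ?gj ?bj //.
    rewrite eqxx (sperm_eqN gP) // co_ord.
    have -> : (i.+1%:Z == - i.+1%:Z) = false by apply/eqP; lia.
    by rewrite subr0 mulr1.
  rewrite (sperm_eq gP) // (sperm_eqN gP) //.
  have -> : (j.+1%:Z == - i.+1%:Z) = false by apply/eqP; lia.
  have -> : (j.+1%:Z == i.+1%:Z) = false.
    by apply/negbTE; apply: contra ne => /eqP[] /val_inj ->.
  by rewrite subr0 mulr0.
move=> kn; have [k0|k0|->] := ltgtP k 0.
- by rewrite -[k]opprK (sperm_opp gP) !(co_opp _ (- _)) !(co_opp _ (g _)) pos //; lia.
- exact: pos.
- by rewrite (sperm0 gP) !co0.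
Qed.

Lemma sperm_act_inj g h : signed_perm n g -> signed_perm n h ->
  (forall k, (`|k| <= n)%N -> g k = h k) -> @sperm_act R n g = sperm_act h.
Proof.
move=> gP hP gh; apply/funext => x; apply: eq_bigr => i _.
by rewrite gh //; have := ltn_ord i; lia.
Qed.

(* f maps the coordinate k to the coordinate g k and then shifts it:
   f x = g . (x - m), where the integer vector m has even coordinate sum. *)
Definition isaff g m (f : V -> V) : Prop :=
  [/\ signed_perm n g, forall k, m (- k) = - m k, (2 %| coord_sum n m)%Z
  & forall x k, (`|k| <= n)%N -> co (f x) (g k) = co x k - (m k)%:~R].

Lemma isaff_inj g m f f' : isaff g m f -> isaff g m f' -> f = f'.
Proof.
move=> [gP _ _ H] [_ _ _ H']; apply/funext => x; apply: co_inj => k _ kn.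
have [h hP hK] := sperm_inverse gP.
by rewrite -(hK k kn).2 H ?H' // sperm_bound.
Qed.

Lemma isaff_eq g m g' m' f : isaff g m f -> signed_perm n g' ->
  (forall k, m' (- k) = - m' k) ->
  (forall k, (`|k| <= n)%N -> g' k = g k /\ m' k = m k) -> isaff g' m' f.
Proof.
move=> [gP mo ms H] g'P m'o E; split=> // [|x k kn]; last first.
  by have [-> ->] := E k kn; apply: H.
rewrite /coord_sum (eq_bigr (fun i : 'I_n => m i.+1%:Z)) // => i _.
by apply E; have := ltn_ord i; lia.
Qed.

Lemma isaff_comp g m f g' m' f' : isaff g m f -> isaff g' m' f' ->
  isaff (g' \o g) (fun k => m k + m' (g k)) (f' \o f).
Proof.
move=> [gP mo ms H] [g'P m'o ms' H']; split.
- exact: sperm_comp.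
- by move=> k; rewrite (sperm_opp gP) m'o mo opprD.
- have := coord_sum_sperm m'o gP.
  rewrite /coord_sum big_split /= -/(coord_sum n m) -/(coord_sum n m') => h.
  by rewrite -[X in _ + X](subrK (coord_sum n m')) rpredD // rpredD.
- by move=> x k kn /=; rewrite H' ?sperm_bound // H // intrD opprD addrA.
Qed.

Lemma isaff_intro0 g f : signed_perm n g ->
  (forall x k, (`|k| <= n)%N -> co (f x) (g k) = co x k) -> isaff g (fun=> 0) f.
Proof.
by move=> gP H; split=> // [|x k kn]; rewrite ?subr0 ?H // /coord_sum big1.
Qed.

Lemma isaff_id : isaff id (fun=> 0) idfun.
Proof. by apply: isaff_intro0 => //; exact: sperm_id. Qed.

Lemma isaff_inv g m f : isaff g m f -> exists g' m' f',
  [/\ isaff g' m' f', cancel f f', cancel f' f,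
      forall k, (`|k| <= n)%N -> g' (g k) = k /\ g (g' k) = k
    & forall k, m' k = - m (g' k)].
Proof.
move=> fP; have [gP mo ms H] := fP; have [h hP hK] := sperm_inverse gP.
pose m' k := - m (h k).
have m'o k : m' (- k) = - m' k by rewrite /m' (sperm_opp hP) mo.
pose f' x := vec n (fun k => co x (g k) - (m' (g k))%:~R) : V.
have f'P x k : (`|k| <= n)%N -> co (f' x) k = co x (g k) - (m' (g k))%:~R.
  by move=> kn; rewrite co_vec // => l; rewrite (sperm_opp gP) m'o co_opp intrN opprD.
have f'A : isaff h m' f'.
  split=> // [|x k kn]; last by rewrite f'P ?sperm_bound // (hK k kn).2.
  have := coord_sum_sperm mo hP.
  rewrite /m' /coord_sum sumrN -/(coord_sum n m) -/(coord_sum n (m \o h)); lia.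
exists h, m', f'; split=> //.
- move=> x; apply: co_inj => k _ kn.
  by rewrite f'P // H // /m' (hK k kn).1 intrN opprK subrK.
- move=> x; apply: co_inj => k _ kn.
  rewrite -(hK k kn).2 H ?sperm_bound // f'P ?sperm_bound // /m' !(hK k kn).2.
  by rewrite intrN opprK addrK.
Qed.

Lemma isaff_sperm g : signed_perm n g -> isaff g (fun=> 0) (sperm_act g).
Proof. by move=> gP; apply: isaff_intro0 => // x k kn; rewrite co_sperm_act. Qed.

(** Coordinate q of e_b, as an integer. *)
Definition delta (b q : int) : int := (q == b)%:Z - (q == - b)%:Z.

Lemma co_evec_delta b q : (`|b| <= n)%N -> (`|q| <= n)%N -> b != 0 ->
  co (e b) q = (delta b q)%:~R.
Proof.
move=> bn qn b0; rewrite co_evec // rmorphB /= -!pmulrn.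
by rewrite [b == q]eq_sym (_ : (b == - q) = (q == - b)) //; lia.
Qed.

Lemma deltaN b q : delta b (- q) = - delta b q.
Proof. rewrite /delta; lia. Qed.

Lemma delta_id b : b != 0 -> delta b b = 1.
Proof.
move=> b0; rewrite /delta eqxx (_ : (b == - b) = false) //.
by apply/negbTE; rewrite -addr_eq0 -mulr2n mulrn_eq0.
Qed.

Lemma delta_ne b q : q != b -> q != - b -> delta b q = 0.
Proof. by rewrite /delta => /negbTE-> /negbTE->. Qed.

Lemma coord_sum_delta b : (`|b| <= n)%N -> b != 0 -> coord_sum n (delta b) = sgz b.
Proof.
move=> cn c0; have c1 : 0 < `|b| by lia.
have c2 : (`| `|b| | <= n)%N by lia.
have [i iE] := ord_of c1 c2.
rewrite /coord_sum /delta (bigD1 i) //= big1 => [|i' ne]; first by rewrite -iE; lia.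
have : i.+1 != i'.+1 by apply: contra ne => /eqP[] /val_inj ->.
move=> ?; have -> : (i'.+1%:Z == b) = false by lia.
by have -> : (i'.+1%:Z == - b) = false by lia.
Qed.

Lemma co_reflection_long a b (j : int) x q : (`|a| <= n)%N -> (`|b| <= n)%N ->
  a != 0 -> b != 0 -> a != b -> a != - b -> (`|q| <= n)%N ->
  co (reflection (e b - e a) j x) q =
  co x q - (co x b - co x a - j%:~R) * (delta b q - delta a q)%:~R.
Proof.
move=> an bn a0 b0 ab aNb qn; rewrite coB coZ /coroot coZ !dot_root !coB !co_evec_delta //.
have -> : delta b b = 1 by rewrite /delta; lia.
have -> : delta a b = 0 by rewrite /delta; lia.
have -> : delta b a = 0 by rewrite /delta; lia.
have -> : delta a a = 1 by rewrite /delta; lia.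
rewrite -!rmorphB /=; congr (_ - _ * _).
by rewrite (_ : 2 / _ = 1) ?mul1r // divff // pnatr_eq0.
Qed.

Lemma isaff_reflection_long a b (j : int) : (`|a| <= n)%N -> (`|b| <= n)%N ->
  a != 0 -> b != 0 -> a != b -> a != - b ->
  isaff (sswap a b) (fun k => j * (delta b k - delta a k)) (reflection (e b - e a) j).
Proof.
move=> an bn a0 b0 ab aNb; split.
- exact: sswap_sperm.
- by move=> k; rewrite -mulrN !deltaN; congr (_ * _); lia.
- rewrite /coord_sum -mulr_sumr sumrB; apply: dvdz_mull.
  by rewrite -!/(coord_sum n _) !coord_sum_delta //; lia.
- move=> x k kn; have sn : (`|sswap a b k| <= n)%N by rewrite sperm_bound //; exact: sswap_sperm.
  rewrite co_reflection_long // /sswap.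
  case: (eqVneq k a) => [->|ka].
    have -> : delta b b - delta a b = 1 by rewrite /delta; lia.
    have -> : delta b a - delta a a = -1 by rewrite /delta; lia.
    by rewrite mulrN1; ring.
  case: (eqVneq k b) => [->|kb].
    have -> : delta b b - delta a b = 1 by rewrite /delta; lia.
    have -> : delta b a - delta a a = -1 by rewrite /delta; lia.
    by rewrite mulr1; ring.
  case: (eqVneq k (- a)) => [->|kNa].
    have -> : delta b (- b) - delta a (- b) = -1 by rewrite /delta; lia.
    have -> : delta b (- a) - delta a (- a) = 1 by rewrite /delta; lia.
    by rewrite mulr1 !co_opp; ring.
  case: (eqVneq k (- b)) => [->|kNb].
    have -> : delta b (- b) - delta a (- b) = -1 by rewrite /delta; lia.
    have -> : delta b (- a) - delta a (- a) = 1 by rewrite /delta; lia.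
    by rewrite mulrN1 !co_opp; ring.
  by rewrite !delta_ne // subr0 mulr0; ring.
Qed.

Lemma isaff_reflection_short b (j : int) : (`|b| <= n)%N -> b != 0 ->
  isaff (sswap (- b) b) (fun k => 2 * j * delta b k) (reflection (e b) j).
Proof.
move=> bn b0; split.
- by apply: sswap_sperm => //; lia.
- by move=> k; rewrite -mulrN deltaN.
- by rewrite /coord_sum -mulr_sumr -mulrA; exact: dvdz_mulr.
- move=> x k kn; have sn : (`|sswap (- b) b k| <= n)%N.
    by rewrite sperm_bound //; apply: sswap_sperm => //; lia.
  rewrite coB coZ /coroot coZ -![dot _ (e b)]/(co _ b) !co_evec_delta //.
  have -> : delta b b = 1 by rewrite /delta; lia.
  rewrite /sswap opprK divr1.
  case: (eqVneq k (- b)) => [->|kNb].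
    have -> : delta b b = 1 by rewrite /delta; lia.
    have -> : delta b (- b) = -1 by rewrite /delta; lia.
    by rewrite co_opp mulrN1; ring.
  case: (eqVneq k b) => [->|kb].
    have -> : delta b b = 1 by rewrite /delta; lia.
    have -> : delta b (- b) = -1 by rewrite /delta; lia.
    by rewrite co_opp mulr1; ring.
  have -> : delta b k = 0 by rewrite /delta; lia.
  by rewrite mulr0; ring.
Qed.

Lemma isaff_posroot a (j : int) : posroot (typeB R n) a ->
  exists g m, isaff g m (reflection a j).
Proof.
move=> /posrootP[k [l [kn ln lk nkl ->]]].
have [l0|l0] := eqVneq l 0.
  rewrite l0 evec0 subr0; do 2!eexists; apply: isaff_reflection_short => //; lia.
have [k0|k0] := eqVneq k 0.
  rewrite k0 evec0 sub0r -evecN; do 2!eexists; apply: isaff_reflection_short => //; lia.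
by do 2!eexists; apply: isaff_reflection_long => //; lia.
Qed.

Lemma affine_weyl_isaff f : affine_weyl (typeB R n) f -> exists g m, isaff g m f.
Proof.
elim=> [|s h [a [j [aP ->]]] _ [g [m H]]]; first by do 2!eexists; exact: isaff_id.
have [g' [m' H']] := isaff_posroot j aP.
by do 2!eexists; exact: isaff_comp H H'.
Qed.

Lemma weyl_sperm f : weyl (typeB R n) f ->
  exists2 g, signed_perm n g & f = sperm_act g.
Proof.
suff : weyl (typeB R n) f -> exists g, isaff g (fun=> 0) f.
  move=> H /H[g gP]; have [gS _ _ _] := gP; exists g => //.
  exact: isaff_inj gP (isaff_sperm gS).
elim=> [|s h [a aP ->] _ [g H]]; first by exists id; exact: isaff_id.
have [g' [m' H']] : exists g' m', isaff g' m' (reflection a 0) /\ m' =1 fun=> 0.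
  move: aP => /posrootP[k [l [kn ln lk nkl ->]]].
  have [l0|l0] := eqVneq l 0.
    rewrite l0 evec0 subr0; do 2!eexists; split; first by apply: isaff_reflection_short => //; lia.
    by move=> i; rewrite mulr0 mul0r.
  have [k0|k0] := eqVneq k 0.
    rewrite k0 evec0 sub0r -evecN; do 2!eexists; split; first by apply: isaff_reflection_short => //; lia.
    by move=> i; rewrite mulr0 mul0r.
  do 2!eexists; split; first by apply: isaff_reflection_long => //; lia.
  by move=> i /=; rewrite mul0r.
exists (g' \o g); have C := isaff_comp H H'.1.
apply: isaff_eq C _ _ _; [by case: H H'.1 => gP _ _ _ [g'P _ _ _]; exact: sperm_comp|by move=> ?; rewrite oppr0|].
by move=> k _; rewrite H'.2 addr0.
Qed.

Lemma isaff0_sperm g m f : isaff g m f -> (forall k, (`|k| <= n)%N -> m k = 0) -> f = sperm_act g.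
Proof.
move=> fP m0; have [gP _ _ _] := fP; apply: isaff_inj (isaff_sperm gP).
by apply: isaff_eq fP gP _ _ => [k|k kn]; rewrite ?oppr0 ?m0.
Qed.

Lemma posroot_long a b : (`|a| <= n)%N -> (`|b| <= n)%N -> a < b -> a != - b ->
  posroot (typeB R n) (e b - e a).
Proof. by move=> an bn ab aNb; apply/posrootP; exists b, a; split=> //; lia. Qed.

Lemma posroot_short b : (`|b| <= n)%N -> 0 < b -> posroot (typeB R n) (e b).
Proof. by move=> bn b0; apply/posrootP; exists b, 0; rewrite evec0 subr0; split=> //; lia. Qed.

(** Induction on d, all indices above d being fixed: composing with the reflection that exchanges
    g(d + 1) and d + 1 fixes d + 1 as well. *)
Lemma sperm_weyl g : signed_perm n g -> weyl (typeB R n) (sperm_act g).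
Proof.
suff W (d : nat) : forall g, (d <= n)%N -> signed_perm n g ->
    (forall k : int, d%:Z < k -> (`|k| <= n)%N -> g k = k) -> weyl (typeB R n) (sperm_act g).
  by move=> gP; apply: (W n) => // k; lia.
elim: d {g} => [|d IH] g dn gP gfix.
  have -> : @sperm_act R n g = idfun; last exact: generated_id.
  apply: isaff_inj isaff_id.
  apply: isaff_eq (isaff_sperm gP) (sperm_id n) _ _ => [k|k kn]; first by rewrite oppr0.
  split=> //; have [k0|k0|->] := ltgtP k 0; last by rewrite (sperm0 gP).
    by rewrite -[k]opprK (sperm_opp gP) gfix //; lia.
  by rewrite gfix //; lia.
pose b : int := d.+1; pose c := g b.
have bn : (`|b| <= n)%N by rewrite /b; lia.
have b0 : b != 0 by [].
have cn : (`|c| <= n)%N := sperm_bound gP bn.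
have c0 : c != 0 := sperm_neq0 gP bn b0.
(* Larger absolute values are already taken by the fixed points. *)
have cb : (`|c| <= d.+1)%N.
  rewrite leqNgt; apply/negP => dc.
  have E : g `|c| = `|c| by apply: gfix; lia.
  have [cE|cE] : c = `|c| \/ c = - `|c|%:Z by lia.
    have : `|c|%:Z = b by apply: (sperm_inj gP); [lia|lia|by rewrite E -cE].
    by rewrite /b; lia.
  have : - `|c|%:Z = b by apply: (sperm_inj gP); [lia|lia|by rewrite (sperm_opp gP) E -cE].
  by rewrite /b; lia.
have [cbE|cbN] := eqVneq c b.
  apply: IH => //; first lia.
  move=> k dk kn; have [->|kb] := eqVneq k b; first exact: cbE.
  by apply: gfix => //; rewrite /b in kb; lia.
pose s := sswap c b.
have sP : signed_perm n s by exact: sswap_sperm.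
have sK k : s (s k) = k by apply: sswapK.
have sgP := sperm_comp sP gP.
have sgW : weyl (typeB R n) (sperm_act (s \o g)).
  apply: IH => //; first lia.
  move=> k dk kn /=; have [->|kb] := eqVneq k b.
    by rewrite -/c /s /sswap eqxx.
  rewrite gfix //; last by rewrite /b in kb; lia.
  rewrite /s /sswap (negbTE kb) /b.
  have -> : (k == c) = false by lia.
  have -> : (k == - c) = false by lia.
  by have -> : (k == - d.+1%:Z) = false by lia.
have [a aP aE] : exists2 a, posroot (typeB R n) a & reflection a 0 = @sperm_act R n s.
  have [cNb|cNb] := eqVneq c (- b).
    exists (e b); first exact: posroot_short.
    have := isaff_reflection_short 0 bn b0; rewrite -cNb => /isaff0_sperm; apply=> k _.
    by rewrite mulr0 mul0r.
  exists (e b - e c); first by apply: posroot_long => //; rewrite /b in cb cbN cNb *; lia.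
  by apply: isaff0_sperm (isaff_reflection_long 0 cn bn c0 b0 cbN cNb) _ => k _; rewrite mul0r.
have -> : @sperm_act R n g = reflection a 0 \o sperm_act (s \o g).
  rewrite aE; apply: isaff_inj (isaff_sperm gP) _.
  have C := isaff_comp (isaff_sperm sgP) (isaff_sperm sP).
  by apply: isaff_eq C gP _ _ => [k|k kn]; rewrite ?oppr0 //= ?sK ?addr0.
by apply: generated_comp sgW; exists a.
Qed.

Definition trans v x : V := x + v.

(** The product of the reflections in the parallel hyperplanes H_{a,0} and H_{a,j} is the
    translation by j times the coroot. *)
Lemma trans_coroot a (j : int) : posroot (typeB R n) a ->
  affine_weyl (typeB R n) (trans (coroot a *~ j)).
Proof.
move=> aP; have -> : trans (coroot a *~ j) = reflection a j \o (reflection a 0 \o idfun).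
  apply/funext => x; have a0 : dot a a != 0.
    rewrite gt_eqF //; case/posrootP: aP => k [l [kn ln lk nkl ->]].
    have pos i : 0 <= (delta i i)%:~R :> R by rewrite ler0z /delta; lia.
    rewrite dot_root !coB; have [l0|l0] := eqVneq l 0.
      rewrite l0 evec0 !co0 /co !dot0l -/(co _ _) co_evec_delta //; last by lia.
      by rewrite !subr0 ltr0z /delta; lia.
    have [k0|k0] := eqVneq k 0.
      rewrite k0 evec0 !co0 /co !dot0l -/(co _ _) co_evec_delta //.
      by rewrite !sub0r oppr0 opprK add0r ltr0z /delta; lia.
    by rewrite !co_evec_delta // -!rmorphB /= ltr0z /delta; lia.
  have ca : dot (coroot a) a = 2 by rewrite dotZl divfK.
  rewrite /= /reflection /trans dotDl dotNl dotZl ca subr0.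
  rewrite -addrA -opprD -scalerDl -scaler_int; congr (_ + _).
  by rewrite -scaleNr; congr (_ *: _); ring.
apply: generated_comp; first by exists a, j.
by apply: generated_comp; [exists a, 0|exact: generated_id].
Qed.

(** The coroots 2 e_1 and e_i - e_1 form a basis. The long ones fix the coordinates 2, ..., n; at
    coordinate 1 the coordinate sum then remains to be supplied, in units of 2. *)
Lemma even_vec_decomp v m : (forall k, (`|k| <= n)%N -> co v k = (m k)%:~R) ->
  (2 %| coord_sum n m)%Z ->
  v = coroot (e 1) *~ (coord_sum n m %/ 2)%Z
      + \sum_(i < n | (0 < i)%N) coroot (e i.+1%:Z - e 1) *~ m i.+1%:Z.
Proof.
move=> vm ms; have n1 : (`|1 : int| <= n)%N by lia.
have long (i : 'I_n) : (0 < i)%N -> coroot (e i.+1%:Z - e 1) = e i.+1%:Z - e 1.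
  move=> i0; have il : (`|i.+1%:Z| <= n)%N by have := ltn_ord i; lia.
  rewrite /coroot dot_root !coB !co_evec_delta //.
  have -> : delta 1 1 = 1 by [].
  have -> : delta i.+1 i.+1 = 1 by rewrite /delta; lia.
  have -> : delta i.+1 1 = 0 by rewrite /delta; lia.
  have -> : delta 1 i.+1 = 0 by rewrite /delta; lia.
  by rewrite -!rmorphB (_ : 2 / _ = 1) ?scale1r // divff // pnatr_eq0.
have short : coroot (e 1) = 2 *: e 1.
  rewrite /coroot -/(co _ 1) co_evec_delta //.
  by have -> : delta 1 1 = 1 by []; rewrite divr1.
apply: co_inj => k k0 kn; have [i iE] := ord_of k0 kn; rewrite {}iE in k0 kn *.
rewrite coD coMz short coZ co_evec_delta // co_sum.
have term (i' : 'I_n) : (0 < i')%N -> co (coroot (e i'.+1%:Z - e 1) *~ m i'.+1%:Z) i.+1%:Z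
    = (m i'.+1%:Z * (delta i'.+1%:Z i.+1%:Z - delta 1 i.+1%:Z))%:~R.
  move=> i0; have il : (`|i'.+1%:Z| <= n)%N by have := ltn_ord i'; lia.
  rewrite long // coMz coB !co_evec_delta //.
  by rewrite -rmorphB -mulrzr -intrM mulrC.
rewrite (eq_bigr _ term) -rmorph_sum /= -mulrzr -[2]/(2%:~R) -!rmorphM -rmorphD /= vm //.
congr (_%:~R).
have S : coord_sum n m = m 1%N%:Z + \sum_(i < n | (0 < i)%N) m i.+1%:Z.
  have z : (0 < n)%N by lia.
  rewrite /coord_sum (bigD1 (Ordinal z)) //=; congr (_ + _); apply: eq_bigl => i'.
  by rewrite -val_eqE /= lt0n.
have [i0|i0] := posnP i.
  rewrite (eq_bigr (fun i : 'I_n => - m i.+1%:Z)) => [|i' i'0].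
    rewrite sumrN i0; have -> : delta 1 1%N = 1 by [].
    rewrite mulr1; move: S ms; set T := \sum_(_ < n | _) _; move: (coord_sum n m) T => c T.
    lia.
  rewrite i0; have -> : delta i'.+1%:Z 1%N - delta 1 1%N = -1 by rewrite /delta; lia.
  by rewrite mulrN1.
have -> : delta 1 i.+1%:Z = 0 by rewrite /delta; lia.
rewrite (bigD1 i) //= big1 => [|i' /andP[_ ne]].
  have -> : delta i.+1%:Z i.+1%:Z = 1 by rewrite /delta; lia.
  by rewrite mulr0 mul0r add0r subr0 mulr1 ?addr0.
have : i.+1 != i'.+1 by apply: contra ne => /eqP[] /val_inj ->.
move=> ?; have -> : delta i'.+1%:Z i.+1%:Z = 0 by rewrite /delta; lia.
by rewrite subr0 mulr0.
Qed.

Lemma isaff_zero g m f : isaff g m f -> exists m', [/\ forall k, m' (- k) = - m' k,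
  (2 %| coord_sum n m')%Z & forall k, (`|k| <= n)%N -> co (f 0) k = (m' k)%:~R].
Proof.
move=> [gP mo ms H]; have [h hP hK] := sperm_inverse gP.
exists (fun k => - m (h k)); split=> [k||k kn]; first by rewrite (sperm_opp hP) mo.
  have := coord_sum_sperm mo hP.
  rewrite /coord_sum sumrN -/(coord_sum n m) -/(coord_sum n (m \o h)); lia.
by rewrite -{1}(hK k kn).2 H ?sperm_bound // /co dot0l sub0r rmorphN.
Qed.

Lemma coroot_latticeP v : coroot_lattice (typeB R n) v <->
  exists m, [/\ forall k, m (- k) = - m k, (2 %| coord_sum n m)%Z &
    forall k, (`|k| <= n)%N -> co v k = (m k)%:~R].
Proof.
have n1 : (`|1 : int| <= n)%N by lia.
have r1 : posroot (typeB R n) (e 1) by exact: posroot_short.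
have r2 (i : 'I_n) : (0 < i)%N -> posroot (typeB R n) (e i.+1%:Z - e 1).
  by move=> i0; apply: posroot_long; have := ltn_ord i; lia.
split=> [[s]|[m [mo ms vm]]].
  elim: s v => [|p s IH] v sP ->.
    exists (fun=> 0); split=> [k||k _]; rewrite ?oppr0 //; first by rewrite /coord_sum big1.
    by rewrite big_nil /co dot0l.
  have [m [mo ms H]] := IH _ (fun q qs => sP q (mem_behead (s := p :: s) qs)) erefl.
  (* A coroot is the image of 0 under the reflection in H_{a,1}, so [isaff_zero] gives its
     integrality and its parity. *)
  have [g [m0 /isaff_zero[m1 [m1o m1s H1]]]] := isaff_posroot 1 (sP p (mem_head _ _)).
  have H1' k : (`|k| <= n)%N -> co (coroot p.2) k = (m1 k)%:~R.
    move=> kn; rewrite -H1 //; congr (co _ k).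
    by rewrite /reflection dot0l !sub0r scaleNr opprK scale1r.
  exists (fun k => m1 k * p.1 + m k); split=> [k||k kn].
  - by rewrite m1o mo mulNr opprD.
  - rewrite /coord_sum big_split /= -mulr_suml.
    by rewrite rpredD ?dvdz_mulr.
  - by rewrite big_cons coD coMz H // H1' // rmorphD rmorphM /= mulrzr.
exists ((coord_sum n m %/ 2, e 1)%Z :: [seq (m i.+1%:Z, e i.+1%:Z - e 1) | i : 'I_n <- index_enum 'I_n & (0 < i)%N]).
  move=> p; rewrite inE => /predU1P[->//|/mapP[i]].
  by rewrite mem_filter => /andP[i0 _] ->; exact: r2.
by rewrite big_cons big_map big_filter /=; exact: even_vec_decomp.
Qed.

Lemma trans_affine v : coroot_lattice (typeB R n) v -> affine_weyl (typeB R n) (trans v).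
Proof.
move=> [s sP ->]; elim: s sP => [|p s IH] sP.
  by rewrite (_ : trans _ = idfun); [exact: generated_id|apply/funext => x; rewrite /trans big_nil addr0].
rewrite (_ : trans _ = trans (coroot p.2 *~ p.1) \o trans (\sum_(q <- s) coroot q.2 *~ q.1)).
  apply: generated_cat; first by apply/trans_coroot/sP/mem_head.
  by apply: IH => q qs; apply: sP; rewrite inE qs orbT.
by apply/funext => x; rewrite /trans /= big_cons -addrA [X in _ + X]addrC.
Qed.

(** The map f is its linear part followed by the translation by f(0), which lies in the coroot
    lattice. *)
Lemma isaff_affine_weyl g m f : isaff g m f -> affine_weyl (typeB R n) f.
Proof.
move=> fP; have [gP mo ms H] := fP.
have [m' [m'o m's H']] := isaff_zero fP.
have -> : f = trans (f 0) \o sperm_act g.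
  apply/funext => x; apply: co_inj => k _ kn.
  have [h hP hK] := sperm_inverse gP; rewrite -(hK k kn).2 /trans /= coD.
  rewrite co_sperm_act ?H ?sperm_bound //.
  by rewrite /co dot0l sub0r.
apply: generated_cat; first by apply/trans_affine/coroot_latticeP; exists m'.
apply: generated_sub (sperm_weyl gP) => s [a aP ->]; by exists a, 0.
Qed.

End AffineWeyl.

(** * Rows and the small floor condition *)

Section Rows.
Variables (n : nat) (m : int -> int).
Hypothesis n2 : (2 <= n)%N.
Implicit Types r p a b : int.
Local Notation N := (2 * n%:Z).

(* 2n times the signed coordinate g r of f p0, for p0 = (1, 2, ..., n) / 2n and
   isaff g m f. *)
Definition row_pos r : int := r - N * m r.

(* r' = r + 1 modulo 2n; n and -n are distinct rows in the same residue class *)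
Definition adj_rows r r' : Prop := r' = r + 1 \/ r' = r + 1 - N.

Lemma adjacent_pos r r' : adj_rows r r' ->
  exists s, row_pos r' = row_pos r + 1 + N * s.
Proof.
rewrite /row_pos => -[]->; first by exists (m r - m (r + 1)); ring.
by exists (m r - m (r + 1 - N) - 1); ring.
Qed.

Lemma pos_adjacent r r' s : (`|r| <= n)%N -> (`|r'| <= n)%N ->
  row_pos r' = row_pos r + 1 + N * s -> adj_rows r r'.
Proof.
move=> rn r'n; rewrite /row_pos => E.
have {}E : r' = r + 1 + N * (s + m r' - m r) by lia.
move: (s + m r' - m r) E => t E.
have [t0|[t0|t0]] : t = 0 \/ t = -1 \/ (t < -1 \/ 0 < t) by lia.
- by left; rewrite E t0; lia.
- by right; rewrite E t0; lia.
- by nia.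
Qed.

(** Rows of equal position are congruent modulo 2n, so only n and -n could collide. Their positions
    are opposite odd multiples of n, hence distinct. *)
Lemma row_pos_inj r r' : (`|r| <= n)%N -> (`|r'| <= n)%N ->
  m (- n%:Z) = - m n%:Z -> row_pos r = row_pos r' -> r = r'.
Proof.
rewrite /row_pos => rn r'n mo E.
have [//|ne] := eqVneq r r'.
have {}E' : r - r' = N * (m r - m r') by lia.
have [s0|s0] : `|r - r'| = N \/ `|r - r'| < N by lia.
  have [[rE r'E]|[rE r'E]] : r = n%:Z /\ r' = - n%:Z \/ r = - n%:Z /\ r' = n%:Z by lia.
    have [m0|m0] : m n%:Z <= 0 \/ 1 <= m n%:Z by lia.
      by move: E; rewrite rE r'E mo; nia.
    by move: E; rewrite rE r'E mo; nia.
  have [m0|m0] : m n%:Z <= 0 \/ 1 <= m n%:Z by lia.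
    by move: E; rewrite rE r'E mo; nia.
  by move: E; rewrite rE r'E mo; nia.
move: (m r - m r') E' => t E'.
have [t0|[t0|t0]] : t = 0 \/ 1 <= t \/ t <= -1 by lia.
- by move: ne; rewrite t0 in E'; lia.
- by nia.
- by nia.
Qed.

Lemma next_row r : (`|r| <= n)%N -> exists2 r', (`|r'| <= n)%N & adj_rows r r'.
Proof.
move=> rn; have [rE|rN] := eqVneq r n%:Z.
  by exists (r + 1 - N); [lia|right].
by exists (r + 1); [lia|left].
Qed.

Lemma prev_row r : (`|r| <= n)%N -> exists2 r', (`|r'| <= n)%N & adj_rows r' r.
Proof.
move=> rn; have [rE|rN] := eqVneq r (- n%:Z).
  by exists (r - 1 + N); [lia|right; lia].
by exists (r - 1); [lia|left; lia].
Qed.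

Hypothesis small : forall r r', (`|r| <= n)%N -> (`|r'| <= n)%N ->
  adj_rows r r' -> row_pos r' <= row_pos r + N + 1.

(* Walk down from a through the residues a - 1, a - 2, ...: as long as the two
   gaps are not left, all positions stay above a; but the residue of b + 1 has
   a position at most b + 2n + 1. *)
Lemma gap_tight a b : (`|a| <= n)%N -> (`|b| <= n)%N ->
  row_pos b + N + 1 <= row_pos a ->
  (forall r, (`|r| <= n)%N -> row_pos b < row_pos r -> row_pos a - N - 1 < row_pos r) ->
  (forall r, (`|r| <= n)%N -> row_pos b + N + 1 <= row_pos r -> row_pos a <= row_pos r) ->
  row_pos a = row_pos b + N + 1.
Proof.
move=> an bn ab G1 G2; set D := row_pos a - row_pos b - N.
have [D1|D2] : D = 1 \/ 2 <= D by rewrite /D; lia.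
  by move: D1; rewrite /D; lia.
have W (d : nat) : d%:Z + 1 < D -> forall r t, (`|r| <= n)%N ->
    row_pos r = row_pos a - (d%:Z + 1) + N * t -> row_pos a <= row_pos r.
  elim: d => [|d IH] dD r t rn E.
    have /(small rn an) h : adj_rows r a.
      by apply: (pos_adjacent (s := - t)) => //; rewrite E; ring.
    have h1 : row_pos b < row_pos r by move: D2; rewrite /D; lia.
    have h2 := G1 r rn h1.
    have t0 : -1 < t by rewrite E in h2; nia.
    have [t1|t1] : t = 0 \/ 0 < t by lia.
      by apply: G2 => //; rewrite E t1; move: dD; rewrite /D; lia.
    by rewrite E; nia.
  have [p pn rp] := next_row rn.
  have [s sE] := adjacent_pos rp.
  have hp : row_pos a <= row_pos p.
    apply: (IH _ p (t + s)) => //; first lia.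
    by rewrite sE E; lia.
  have h := small rn pn rp.
  have h1 : row_pos b < row_pos r by move: D2; rewrite /D; lia.
  have h2 := G1 r rn h1.
  have t0 : -1 < t by rewrite E in h2; nia.
  have [t1|t1] : t = 0 \/ 0 < t by lia.
    by apply: G2 => //; rewrite E t1; move: dD; rewrite /D; lia.
  have [dN|dN] : d.+1%:Z + 1 <= N \/ N < d.+1%:Z + 1 by lia.
    by rewrite E; nia.
  by apply: G2 => //; rewrite E; move: dD; rewrite /D; nia.
have [r rn br] := next_row bn.
have [s sE] := adjacent_pos br.
have h := small bn rn br.
have DE : D = `|D|%N :> int by lia.
(* The residue of b + 1 lies D - 1 steps below a, whence d = D - 2. *)
have := W (`|D|.-2)%N; rewrite (_ : _.-2%:Z + 1 = D - 1); last by lia.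
move=> W1; have {W1} := W1 _ r (s - 1) rn.
rewrite sE => W1; have : row_pos a <= row_pos b + 1 + N * s by apply: W1; [lia|rewrite /D; ring].
by move: D2; rewrite /D; lia.
Qed.

Section Climb.
Variables (R : realType) (Z : int -> R).
Hypothesis Zmono : forall r r', (`|r| <= n)%N -> (`|r'| <= n)%N ->
  row_pos r < row_pos r' -> Z r < Z r'.
Hypothesis Zjump : forall r r', (`|r| <= n)%N -> (`|r'| <= n)%N ->
  adj_rows r r' -> row_pos r' = row_pos r + N + 1 -> Z r + 1 < Z r'.
Hypothesis mo : m (- n%:Z) = - m n%:Z.

(* Walk up from a through the residues a + 1, a + 2, ...: the level
   (position - residue) / 2n rises by at most 1 in each step, and each level is
   first reached by a jump of exactly 2n + 1. *)
Lemma climb a b (k : nat) : (`|a| <= n)%N -> (`|b| <= n)%N ->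
  row_pos a + N * k%:Z < row_pos b -> Z a + k%:R < Z b.
Proof.
move=> an bn ab.
(* For a row i steps above a on level t, each level t0 <= t is witnessed by a row r0, no higher than
   the position i steps above a on level t0, whose value exceeds Z a + t0. The clause for i = 0
   singles out a, because n and -n share a residue. *)
have W (i : nat) : forall r t, (`|r| <= n)%N -> (i = 0%N -> r = a) ->
    row_pos r = row_pos a + i%:Z + N * t -> forall t0 : nat, t0%:Z <= t ->
    exists r0, [/\ (`|r0| <= n)%N, row_pos r0 <= row_pos a + i%:Z + N * t0%:Z
      & (t0 = 0%N /\ r0 = a) \/ Z a + t0%:R < Z r0].
  elim: i => [|i IH] r t rn i0 E t0 tt.
    have t00 : t0 = 0%N by move: E; rewrite i0 //; nia.
    by exists a; split=> //; [lia|left].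
  have [->|t0N] := eqVneq t0 0%N; first by exists a; split=> //; [lia|left].
  have [p [pn pr pi]] : exists p, [/\ (`|p| <= n)%N, adj_rows p r & i = 0%N -> p = a].
    have [i1|i1] := eqVneq i 0%N; last first.
      by have [p pn pr] := prev_row rn; exists p; split=> // i'; rewrite i' in i1.
    by exists a; split=> //; apply: (pos_adjacent (s := t)) => //; rewrite E i1; lia.
  have [s sE] := adjacent_pos pr.
  have pE : row_pos p = row_pos a + i%:Z + N * (t - s) by lia.
  have h := small pn rn pr.
  have s1 : s <= 1 by nia.
  (* Either level t0 was reached before the last step, or that step jumps from level t0 - 1 to t0
     and [Zjump] applies. *)
  have [st|st] : t0%:Z <= t - s \/ t - s = t0%:Z - 1 by lia.
    have [r0 [r0n r0E r0Z]] := IH _ _ pn pi pE _ st.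
    by exists r0; split=> //; lia.
  have st' : t0.-1%:Z <= t - s by lia.
  have [r0 [r0n r0E r0Z]] := IH _ _ pn pi pE _ st'.
  exists r; split=> //; first by rewrite E; have -> : t = t0 by lia.
  right; have s1E : s = 1 by lia.
  have jump : Z p + 1 < Z r by apply: Zjump => //; rewrite sE s1E; ring.
  have r0p : Z r0 <= Z p.
    have : row_pos r0 <= row_pos p by rewrite pE st; move: r0E; have -> : t0.-1%:Z = t0%:Z - 1 by lia.
    rewrite le_eqVlt => /orP[/eqP/row_pos_inj->//|lt0]; exact/ltW/Zmono.
  have -> : t0%:R = t0.-1%:R + 1 :> R by rewrite natr1 prednK // lt0n.
  case: r0Z => [[-> r0a]|r0Z]; first by rewrite r0a in r0p; lra.
  by lra.
set e := row_pos b - row_pos a - N * k%:Z.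
have [||||r0 [r0n r0E [[k0 r0a]|r0Z]]] := W `|e|%N b k%:Z _ _ _ k.
- by [].
- by rewrite /e; lia.
- by rewrite /e; lia.
- by [].
- by rewrite k0 addr0; apply: Zmono => //; move: ab; rewrite k0; lia.
apply: lt_le_trans r0Z _.
have : row_pos r0 <= row_pos b by move: r0E; rewrite /e; lia.
rewrite le_eqVlt => /orP[/eqP/row_pos_inj->//|lt0]; exact/ltW/Zmono.
Qed.

End Climb.
End Rows.

(** The wall given by adjacent rows r, r' has the root e_{g r'} - e_{g r} and the height (Y(r') -
    Y(r) - 1) / 2n. The condition says that a wall of positive height has height 1 and a positive
    root. *)
Definition small_floors (n : nat) (g m : int -> int) : Prop :=
  forall r r', (`|r| <= n)%N -> (`|r'| <= n)%N -> adj_rows n r r' ->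
  row_pos n m r' <= row_pos n m r + 2 * n%:Z + 1 /\
  (row_pos n m r' = row_pos n m r + 2 * n%:Z + 1 -> g r < g r').

(** The pairs (r, r') and (-r', -r) describe the same wall, so one pair for each of the n + 1 walls
    suffices. *)
Lemma small_floors_half (n : nat) (g m : int -> int) : (2 <= n)%N ->
  (forall k, m (- k) = - m k) -> (forall k, g (- k) = - g k) ->
  (forall r, 0 <= r < n%:Z -> m r - 1 <= m (r + 1) /\ (m (r + 1) = m r - 1 -> g r < g (r + 1))) ->
  m (n%:Z - 1) + m n%:Z <= 2 ->
  (m (n%:Z - 1) + m n%:Z = 2 -> g (n%:Z - 1) + g n%:Z < 0) ->
  small_floors n g m.
Proof.
move=> n2 mo go H H1 H2.
have S1 r : 0 <= r < n%:Z -> row_pos n m (r + 1) <= row_pos n m r + 2 * n%:Z + 1 /\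
  (row_pos n m (r + 1) = row_pos n m r + 2 * n%:Z + 1 -> g r < g (r + 1)).
  move=> /H[h1 h2]; rewrite /row_pos; split; first nia.
  by move=> E; apply: h2; nia.
have S2 : row_pos n m (- n%:Z) <= row_pos n m (n%:Z - 1) + 2 * n%:Z + 1 /\
  (row_pos n m (- n%:Z) = row_pos n m (n%:Z - 1) + 2 * n%:Z + 1 -> g (n%:Z - 1) < g (- n%:Z)).
  rewrite /row_pos mo go; split; first nia.
  by move=> E; have := H2; nia.
have posN r : row_pos n m (- r) = - row_pos n m r by rewrite /row_pos mo; ring.
move=> r r' rn r'n [E|E].
  have [r0|r0] := lerP 0 r; first by rewrite E; apply: S1; lia.
  have [|h1 h2] := S1 (- r'); first lia.
  have rE : - r' + 1 = - r by lia.
  move: h1 h2; rewrite rE !posN !go => h1 h2; split; first lia.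
  by move=> E'; have : - g r' < - g r by [apply: h2; lia|]; lia.
have [rE|rE] : r = n%:Z - 1 \/ r = n%:Z by lia.
  have -> : r' = - n%:Z by lia.
  by rewrite rE.
have -> : r' = - (n%:Z - 1) by lia.
move: S2; rewrite {}rE !posN !go => -[h1 h2]; split; first lia.
by move=> E'; have : g (n%:Z - 1) < - g n%:Z by [apply: h2; lia|]; lia.
Qed.

(** * Shi regions and their minimal alcoves *)

Lemma finite_card_setD1 (T : choiceType) (A : set T) a :
  finite_set A -> A a -> ~ (A #<= A `\ a)%card.
Proof.
move=> Af Aa le; have Df : finite_set (A `\ a) by exact: finite_setD.
have /finite_setP[p pE] := Af; have /finite_setP[q qE] := Df.
have : (p <= q)%N.
  by rewrite -card_le_II; rewrite -(card_le_eql pE) -(card_le_eqr qE).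
have := card_fset_set pE; have := card_fset_set qE.
rewrite fset_setD1 // => h1 h2 pq.
have := finmap.cardfsD1 a (fset_set A); rewrite in_fset_set // mem_set // h1 h2 /=; lia.
Qed.

Section Shi.
Variables (R : realType) (n : nat).
Hypothesis n2 : (2 <= n)%N.
Implicit Types (x y z : 'rV[R]_n) (k l r : int) (g m : int -> int).
Local Notation e := (evec R n).
Local Notation V := 'rV[R]_n.
Local Notation Phi := (typeB R n).
Local Notation N := (2 * n%:Z).
Local Notation pos := (row_pos n).

(** Half the sum of the positive coroots, divided by the Coxeter number 2n. *)
Definition base_pt : V := vec n (fun k => k%:~R / (2 * n%:R)).

Lemma co_base k : (`|k| <= n)%N -> co base_pt k = k%:~R / (2 * n%:R).
Proof. by move=> kn; rewrite co_vec // => l; rewrite rmorphN mulNr. Qed.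

Let nR : 0 < 2 * n%:R :> R.
Proof. by rewrite mulr_gt0 // ltr0n; lia. Qed.

Lemma alcove_base : alcove Phi base_pt.
Proof.
apply/(alcoveP n2); split=> [k kP|]; rewrite !co_base; try by lia.
  by rewrite ltr_pM2r ?invr_gt0 // ltr_int; lia.
rewrite -mulrDl -rmorphD /= ltr_pdivrMr // mul1r.
by rewrite -[2]/(2%:~R) -[n%:R]/(n%:~R) -intrM ltr_int; lia.
Qed.

Section Alcove.
Variables (g m : int -> int) (f : V -> V).
Hypothesis fP : isaff g m f.

Lemma co_isaff_sub y k l : (`|k| <= n)%N -> (`|l| <= n)%N ->
  co (f y) (g k) - co (f y) (g l) = co y k - co y l + (m l - m k)%:~R.
Proof. by case: fP => _ _ _ H kn ln; rewrite !H // rmorphB /=; ring. Qed.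

(** By [alcove_sign] the point y behaves like [base_pt], whose image has the coordinates (position)
    / 2n. *)
Lemma isaff_gt y k l (j : int) : alcove Phi y ->
  (`|k| <= n)%N -> (`|l| <= n)%N -> k != l -> k != - l ->
  (j%:~R < co (f y) (g k) - co (f y) (g l)) = (pos m l + N * j < pos m k).
Proof.
move=> A kn ln kl nkl; rewrite co_isaff_sub // -ltrBlDr -rmorphB /= alcove_sign //.
by rewrite /row_pos; apply/idP/idP; lia.
Qed.

Lemma isaff_lt y k l (j : int) : alcove Phi y ->
  (`|k| <= n)%N -> (`|l| <= n)%N -> k != l -> k != - l ->
  (co (f y) (g k) - co (f y) (g l) < j%:~R) = (pos m k < pos m l + N * j).
Proof.
move=> A kn ln kl nkl; rewrite co_isaff_sub // -ltrBrDr -rmorphB /= alcove_sign_lt //.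
by rewrite /row_pos; apply/idP/idP; lia.
Qed.

Lemma separates0P k l (j : int) : (`|k| <= n)%N -> (`|l| <= n)%N -> k != l -> k != - l ->
  separates (e (g k) - e (g l)) j [set 0] (f @` alcove Phi) <->
  (0 < j /\ pos m l + N * j < pos m k) \/ (j < 0 /\ pos m k < pos m l + N * j).
Proof.
move=> kn ln kl nkl; have z : dot 0 (e (g k) - e (g l)) = 0 :> R by rewrite dot0l.
have p0 : (f @` alcove Phi) (f base_pt) by exists base_pt => //; exact: alcove_base.
split=> [[[H0 H1]|[H0 H1]]|[[j0 H]|[j0 H]]].
- left; have := H0 0 erefl; rewrite /= z ltr0z => -> ; split=> //.
  by have := H1 _ p0; rewrite /= dot_root isaff_gt //; exact: alcove_base.
- right; have := H0 0 erefl; rewrite /= z ltrz0 => -> ; split=> //.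
  by have := H1 _ p0; rewrite /= dot_root isaff_lt //; exact: alcove_base.
- left; split=> [_ ->|_ [y A <-]] /=; first by rewrite z ltr0z.
  by rewrite dot_root isaff_gt.
- right; split=> [_ ->|_ [y A <-]] /=; first by rewrite z ltrz0.
  by rewrite dot_root isaff_lt.
Qed.

Lemma isaff_root a : posroot Phi a -> exists k l,
  [/\ (`|k| <= n)%N, (`|l| <= n)%N, k != l, k != - l & a = e (g k) - e (g l)] /\ g l < g k.
Proof.
move=> /posrootP[k [l [kn ln lk nkl ->]]].
have [gP _ _ _] := fP; have [h hP hK] := sperm_inverse gP.
have hk := sperm_bound hP kn; have hl := sperm_bound hP ln.
exists (h k), (h l); rewrite (hK k kn).2 (hK l ln).2; split=> //; split=> //.
  by rewrite (sperm_eq hP) //; lia.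
by rewrite (sperm_eqN hP).
Qed.

End Alcove.

Definition shi_same x y : Prop := forall k l (j : int), (`|k| <= n)%N -> (`|l| <= n)%N ->
  l < k -> k != - l -> j = 0 \/ j = 1 ->
  (j%:~R < co x k - co x l) = (j%:~R < co y k - co y l).

Lemma shi_complementP x : shi_complement Phi x <->
  forall k l (j : int), (`|k| <= n)%N -> (`|l| <= n)%N ->
  l < k -> k != - l -> j = 0 \/ j = 1 -> co x k - co x l != j%:~R.
Proof.
split=> H.
  move=> k l j kn ln lk nkl j01; apply/eqP => E.
  apply: (H (e k - e l) j) => //; last by rewrite /hyperplane /= dot_root.
  by apply/posrootP; exists k, l.
move=> a j /posrootP[k [l [kn ln lk nkl ->]]] j01; rewrite /hyperplane /= dot_root => /eqP.
exact/negP/H.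
Qed.

(** On a hyperplane neither strict inequality holds, so two positions would differ by exactly 2n j;
    the rows would be congruent modulo 2n, but their distance is strictly between 0 and 2n. *)
Lemma isaff_neq g m f y k l (j : int) : isaff g m f -> alcove Phi y ->
  (`|k| <= n)%N -> (`|l| <= n)%N -> k != l -> k != - l -> co (f y) k - co (f y) l != j%:~R.
Proof.
move=> fP A kn ln kl nkl; apply/eqP => E.
have [gP _ _ _] := fP; have [h hP hK] := sperm_inverse gP.
have hk := sperm_bound hP kn; have hl := sperm_bound hP ln.
have ne : h k != h l by rewrite (sperm_eq hP).
have nne : h k != - h l by rewrite (sperm_eqN hP).
have := isaff_gt fP j A hk hl ne nne; have := isaff_lt fP j A hk hl ne nne.
rewrite (hK k kn).2 (hK l ln).2 E ltxx => h1 h2.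
have E' : pos m (h k) = pos m (h l) + N * j by lia.
have {}E' : h k - h l = N * (m (h k) - m (h l) + j) by move: E'; rewrite /row_pos; lia.
move: (m (h k) - m (h l) + j) E' => t E'.
have hkl : 0 < `|h k - h l| < N by lia.
have [t0|[t0|t0]] : t = 0 \/ 1 <= t \/ t <= -1 by lia.
- by rewrite t0 in E'; lia.
- nia.
- nia.
Qed.


Lemma alcove_shi g m f y : isaff g m f -> alcove Phi y -> shi_complement Phi (f y).
Proof.
move=> fP A; apply/shi_complementP => k l j kn ln lk nkl _.
by apply: (isaff_neq _ fP) => //; lia.
Qed.

Lemma co_continuous k : continuous (fun x => co x k).
Proof.
have [kn|kn] := leqP `|k| n; last first.
  by rewrite (_ : (fun x => co x k) = fun=> 0); [exact: cst_continuous|apply/funext => x; rewrite co_out].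
have [k0|k0|->] := ltgtP k 0.
- have k1 : 0 < - k by lia.
  have kn' : (`|- k| <= n)%N by lia.
  have [i iE] := ord_of k1 kn'.
  rewrite (_ : (fun x => co x k) = fun x => - x 0 i); last first.
    by apply/funext => x; rewrite -[k]opprK co_opp iE co_ord.
  by move=> x; apply: continuousN; exact: coord_continuous.
- have [i ->] := ord_of k0 kn.
  rewrite (_ : (fun x => co x i.+1%:Z) = fun x => x 0 i); first exact: coord_continuous.
  by apply/funext => x; rewrite co_ord.
- by rewrite (_ : (fun x => co x 0) = fun=> 0); [exact: cst_continuous|apply/funext => x; rewrite co0].
Qed.

(** The image of a component under x_k - x_l is an interval that misses j. *)
Lemma component_same x y : connected_component (shi_complement Phi) x y -> shi_same x y.
Proof.
move=> Cxy k l j kn ln lk nkl j01.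
set C := connected_component _ x in Cxy *.
have Cx : C x.
  apply: connected_component_refl; apply: contrapT => nx.
  by move: Cxy; rewrite /C connected_component_out.
have Csub : C `<=` shi_complement Phi by exact: connected_component_sub.
pose F z : R := co z k - co z l.
have cF : continuous F by move=> z; exact: (cvgB (@co_continuous k z) (@co_continuous l z)).
have /connected_intervalP I : connected (F @` C).
  apply: connected_continuous_connected; first exact: component_connected.
  exact/continuous_subspaceT.
have FN z : C z -> F z != j%:~R by move=> /Csub/shi_complementP; apply.
have nj : ~ (F @` C) j%:~R by case=> z /FN/eqP.
have W a b : C a -> C b -> j%:~R < F a -> j%:~R < F b.
  move=> Ca Cb ja; rewrite ltNge; apply/negP => bj; apply: nj.
  apply: (I (F b) (F a)); [by exists b|by exists a|by rewrite bj ltW].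
by apply/idP/idP; exact: W.
Qed.

Lemma conv_gt0 (t a b : R) : 0 <= t <= 1 -> 0 < a -> 0 < b -> 0 < (1 - t) * a + t * b.
Proof.
move=> /andP[t0 t1] a0 b0; have [->|tN] := eqVneq t 0; first by lra.
by apply: ltr_wpDl; rewrite ?mulr_ge0 ?mulr_gt0 // ?lt_def ?tN //; lra.
Qed.

(** The segment from x to y stays strictly on one side of each Shi hyperplane. *)
Lemma same_component x y : shi_complement Phi x -> shi_complement Phi y ->
  shi_same x y -> connected_component (shi_complement Phi) x y.
Proof.
move=> Sx Sy xy; pose F (t : R) : V := x + t *: (y - x).
have cF : continuous F.
  by move=> t; apply: cvgD; [exact: cvg_cst|apply: cvgZr_tmp; exact: cvg_id].
have F0 : F 0 = x by rewrite /F scale0r addr0.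
have F1 : F 1 = y by rewrite /F scale1r addrC subrK.
have := @connected_component_max _ (shi_complement Phi) (F @` `[0, 1]) x.
apply.
- by exists 0 => //=; rewrite in_itv /= lexx ler01.
- move=> u [t /=]; rewrite in_itv /= => /andP[t0 t1] <-.
  apply/shi_complementP => k l j kn ln lk nkl j01.
  have := xy k l j kn ln lk nkl j01.
  have /shi_complementP/(_ k l j kn ln lk nkl j01) := Sx.
  have /shi_complementP/(_ k l j kn ln lk nkl j01) := Sy.
  rewrite /F !coD !coZ !coB.
  set a := co x k - co x l; set b := co y k - co y l => bj aj s.
  have -> : co x k + t * (co y k - co x k) - (co x l + t * (co y l - co x l)) =
    (1 - t) * a + t * b by rewrite /a /b; ring.
  have [ja|ja|ja] := ltgtP j%:~R a; last by rewrite ja eqxx in aj.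
    have jb : j%:~R < b by rewrite -s.
    rewrite gt_eqF //; have : 0 < (1 - t) * (a - j%:~R) + t * (b - j%:~R).
      by apply: conv_gt0; rewrite ?t0 ?t1 // subr_gt0.
    by lra.
  have jb : b < j%:~R by rewrite lt_neqAle bj leNgt -s -leNgt ltW.
  rewrite lt_eqF //; have : 0 < (1 - t) * (j%:~R - a) + t * (j%:~R - b).
    by apply: conv_gt0; rewrite ?t0 ?t1 // subr_gt0.
  by lra.
- apply: connected_continuous_connected; first exact: segment_connected.
  exact/continuous_subspaceT.
- by exists 1 => //=; rewrite in_itv /= lexx ler01.
Qed.

(* The positions of the rows bound the coordinates on the whole Shi region from
   below, because every step of length 2n + 1 is a floor H_{a, 1}. *)
Lemma small_floors_minimal g m f : isaff g m f -> small_floors n g m -> shi_minimal Phi f.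
Proof.
move=> fP SF; have [gP mo ms H] := fP; split; first exact: isaff_affine_weyl fP.
have A0 := alcove_base.
exists (connected_component (shi_complement Phi) (f base_pt)).
have self : f @` alcove Phi `<=` connected_component (shi_complement Phi) (f base_pt).
  move=> _ [y A <-]; apply: same_component; [exact: alcove_shi fP A0|exact: alcove_shi fP A|].
  move=> k l j kn ln lk nkl _.
  have [h hP hK] := sperm_inverse gP.
  rewrite -(hK k kn).2 -(hK l ln).2.
  have hk := sperm_bound hP kn; have hl := sperm_bound hP ln.
  have ne : h k != h l by rewrite (sperm_eq hP) //; lia.
  have nne : h k != - h l by rewrite (sperm_eqN hP).
  by rewrite !(isaff_gt fP).
split=> //; first by exists (f base_pt) => //; exact: alcove_shi fP A0.
move=> f' f'W sub; apply: subset_card_le => -[a j] /= [aP sep].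
split=> //=; have [k [l [[kn ln kl nkl aE] glk]]] := isaff_root fP aP.
rewrite /= in aE sep.
have [g' [m' f'P]] := affine_weyl_isaff n2 f'W.
pose z := f' base_pt; have [g'P _ _ _] := f'P.
have same : shi_same (f base_pt) z.
  by apply: component_same; apply: sub; exists base_pt.
(* The point z lies in the same Shi region, so for positive roots and heights 0 and 1 the positions
   of [f] decide its inequalities. *)
have gt r r' (i : int) : (`|r| <= n)%N -> (`|r'| <= n)%N -> r != r' -> r != - r' ->
    g r < g r' -> i = 0 \/ i = 1 ->
    (i%:~R < co z (g r') - co z (g r)) = (pos m r + N * i < pos m r').
  move=> rn r'n ne nne gr i01.
  have nne' : g r' != - g r by rewrite (sperm_eqN gP) //; lia.
  rewrite -same ?sperm_bound // (isaff_gt fP) //; lia.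
have zne r r' (i : int) : (`|r| <= n)%N -> (`|r'| <= n)%N -> r != r' -> r != - r' ->
    co z (g r') - co z (g r) != i%:~R.
  move=> rn r'n ne nne; apply: (isaff_neq i f'P); rewrite ?sperm_bound //.
    by rewrite (sperm_eq gP) // eq_sym.
  by rewrite (sperm_eqN gP) //; lia.
have mono0 r r' : (`|r| <= n)%N -> (`|r'| <= n)%N -> r != - r' ->
    pos m r < pos m r' -> co z (g r) < co z (g r').
  move=> rn r'n nne lt; have ne : r != r' by apply: contraTneq lt => ->; rewrite ltxx.
  have [gr|gr|/(sperm_inj gP rn r'n)E] := ltgtP (g r) (g r'); last by rewrite E eqxx in ne.
    have := gt r r' 0 rn r'n ne nne gr (or_introl erefl).
    by rewrite mulr0 addr0 lt subr_gt0.
  have [] : r' != r /\ r' != - r by split; lia.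
  move=> ne' nne'; have := gt r' r 0 r'n rn ne' nne' gr (or_introl erefl).
  rewrite mulr0 addr0 subr_gt0 => h; rewrite lt_neqAle; apply/andP; split.
    by have := zne r r' 0 rn r'n ne nne; rewrite subr_eq0 eq_sym.
  by rewrite leNgt h -leNgt ltW.
(* Opposite rows are compared by no root; both are compared with row 0 instead. *)
have mono r r' : (`|r| <= n)%N -> (`|r'| <= n)%N ->
    pos m r < pos m r' -> co z (g r) < co z (g r').
  move=> rn r'n lt; have [rE|rE] := eqVneq r (- r'); last exact: mono0.
  have r'0 : r' != 0 by apply: contraTneq lt => r0; rewrite rE r0 ltxx.
  have p0 : pos m 0 = 0 by rewrite /row_pos odd_fun0 // mulr0 subr0.
  have pN : pos m r = - pos m r' by rewrite /row_pos rE mo; ring.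
  have : co z (g 0) < co z (g r') by apply: mono0 => //; rewrite ?p0; lia.
  by rewrite (sperm0 gP) co0 rE (sperm_opp gP) co_opp; lra.
have jump r r' : (`|r| <= n)%N -> (`|r'| <= n)%N -> adj_rows n r r' ->
    pos m r' = pos m r + N + 1 -> co z (g r) + 1 < co z (g r').
  move=> rn r'n rr' E; have [_ /(_ E) gr] := SF r r' rn r'n rr'.
  have ne : r != r' by case: rr'; lia.
  have nne : r != - r' by case: rr'; lia.
  have := gt r r' 1 rn r'n ne nne gr (or_intror erefl).
  by rewrite ltrBrDl => ->; lia.
(* Climbing turns the known inequalities of heights 0 and 1 into those of every height. *)
have low r r' (i : nat) : (`|r| <= n)%N -> (`|r'| <= n)%N ->
    pos m r + N * i%:Z < pos m r' -> co z (g r) + i%:R < co z (g r').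
  move=> rn r'n; apply: (@climb n m n2 _ R (fun r => co z (g r))) => // r1 r2 h1 h2 h3.
  by case: (SF r1 r2 h1 h2 h3).
(* Separation of the whole alcove of [f'] is read off from its single point z. *)
have {}f'sep k1 l1 (i : int) : (`|k1| <= n)%N -> (`|l1| <= n)%N -> k1 != l1 -> k1 != - l1 ->
    (0 < i /\ i%:~R < co z (g k1) - co z (g l1)) \/ (i < 0 /\ co z (g k1) - co z (g l1) < i%:~R) ->
    separates (e (g k1) - e (g l1)) i [set 0] (f' @` alcove Phi).
  move=> k1n l1n ne nne hi; have [h hP hK] := sperm_inverse g'P.
  have bk := sperm_bound gP k1n; have bl := sperm_bound gP l1n.
  have hk := sperm_bound hP bk; have hl := sperm_bound hP bl.
  have ne' : h (g k1) != h (g l1) by rewrite (sperm_eq hP) // (sperm_eq gP).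
  have nne' : h (g k1) != - h (g l1) by rewrite (sperm_eqN hP) // (sperm_eqN gP).
  rewrite -(hK _ bk).2 -(hK _ bl).2; apply/(separates0P f'P) => //.
  rewrite -(isaff_gt f'P _ A0) // -(isaff_lt f'P _ A0) //.
  by rewrite (hK _ bk).2 (hK _ bl).2.
move: sep; rewrite aE => /(separates0P fP j kn ln kl nkl) sep; apply: f'sep => //.
case: sep => -[j0 h]; [left|right]; split=> //.
  have jE : j = `|j|%N by lia.
  by rewrite jE in h *; have := low _ _ _ ln kn h; rewrite -pmulrn; lra.
have jE : j = - `|j|%N%:Z by lia.
have h' : pos m k + N * `|j|%N%:Z < pos m l by rewrite jE in h; lia.
by rewrite jE rmorphN /= -pmulrn; have := low _ _ _ kn ln h'; lra.
Qed.

(** Minimality compares cardinals, and finiteness makes a proper subset strictly smaller. *)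
Lemma separating_finite g m f : isaff g m f -> finite_set (separating Phi (f @` alcove Phi)).
Proof.
move=> fP; have A0 := alcove_base.
pose I := [seq i%:Z - n%:Z | i <- iota 0 (2 * n).+1].
have memI k : (`|k| <= n)%N -> k \in I.
  by move=> kn; apply/mapP; exists `|(k + n%:Z)%R|%N; rewrite ?mem_iota; lia.
pose B := \sum_(k <- I) `|pos m k|%N.
have boundB k : (`|k| <= n)%N -> (`|pos m k| <= B)%N.
  by move=> /memI kI; rewrite /B (big_rem k) //= leq_addr.
pose J := [seq i%:Z - (2 * B)%:Z | i <- iota 0 (4 * B).+1].
pose s := [seq (p, j) | p <- [seq e k - e l | k <- I, l <- I], j <- J].
apply: sub_finite_set (finite_seq s) => -[a j] [/= aP sep].
have [k [l [[kn ln kl nkl aE] glk]]] := isaff_root fP aP.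
rewrite /= in aE sep.
have [gP _ _ _] := fP.
apply: (allpairs_f pair).
  by rewrite aE; apply: (allpairs_f (fun k l => e k - e l)); rewrite memI ?sperm_bound.
have : (`|j| <= 2 * B)%N.
  have := boundB k kn; have := boundB l ln.
  move: sep; rewrite aE => /(separates0P fP j kn ln kl nkl); nia.
by move=> jB; apply/mapP; exists `|(j + (2 * B)%:Z)%R|%N; rewrite ?mem_iota; lia.
Qed.

End Shi.

(** * Reflecting a minimal alcove in one of its walls *)

Section Crossing.
Variables (R : realType) (n : nat).
Hypothesis n2 : (2 <= n)%N.
Implicit Types (x y z : 'rV[R]_n) (k l r q : int) (g m : int -> int).
Local Notation e := (evec R n).
Local Notation V := 'rV[R]_n.
Local Notation Phi := (typeB R n).
Local Notation N := (2 * n%:Z).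
Local Notation pos := (row_pos n).

Lemma reflectionN a (j : int) : reflection (- a) (- j) = reflection a j :> (V -> V).
Proof.
apply/funext => x; rewrite /reflection /coroot.
rewrite [dot x _]dotC dotNl [dot a x]dotC dotNl [dot a _]dotC dotNl opprK.
by rewrite rmorphN /= opprK !scalerN -!scaleNr !opprD !opprK.
Qed.

Lemma intN : N%:~R = 2 * n%:R :> R.
Proof. by rewrite intrM. Qed.

(** Positions are indexed here by the label q = g r instead of the row r, so that alcoves with
    different g can be compared coordinate by coordinate. *)
Lemma isaff_label g m (f : V -> V) : isaff g m f -> exists X : int -> int,
  [/\ forall k, (`|k| <= n)%N -> X (g k) = pos m k,
      forall y q q' (j : int), alcove Phi y -> (`|q| <= n)%N -> (`|q'| <= n)%N ->
        q != q' -> q != - q' -> (j%:~R < co (f y) q' - co (f y) q) = (X q + N * j < X q'),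
      forall q q' (j : int), (`|q| <= n)%N -> (`|q'| <= n)%N -> q != q' -> q != - q' ->
        separates (e q' - e q) j [set 0] (f @` alcove Phi) <->
        (0 < j /\ X q + N * j < X q') \/ (j < 0 /\ X q' < X q + N * j)
    & forall q, (`|q| <= n)%N -> co (f (base_pt R n)) q = (X q)%:~R / (2 * n%:R)].
Proof.
move=> fP; have [gP mo ms H] := fP; have [h hP hK] := sperm_inverse gP.
have ne q q' : (`|q| <= n)%N -> (`|q'| <= n)%N -> q != q' -> h q' != h q.
  by move=> qn q'n qq; rewrite (sperm_eq hP) // eq_sym.
have nne q q' : (`|q| <= n)%N -> (`|q'| <= n)%N -> q != - q' -> h q' != - h q.
  by move=> qn q'n qq; rewrite (sperm_eqN hP) //; lia.
exists (pos m \o h); split=> [k kn|y q q' j A qn q'n qq nqq|q q' j qn q'n qq nqq|q qn] /=.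
- by rewrite (hK k kn).1.
- rewrite -{1}(hK q qn).2 -{1}(hK q' q'n).2.
  by apply: (isaff_gt n2 fP); rewrite ?sperm_bound ?ne ?nne.
- rewrite -{1}(hK q qn).2 -{1}(hK q' q'n).2.
  by apply: (separates0P n2 fP); rewrite ?sperm_bound ?ne ?nne.
- rewrite -{1}(hK q qn).2 H ?sperm_bound // co_base ?sperm_bound //.
  rewrite /row_pos intrB intrM intN; field.
  by rewrite pnatr_eq0; lia.
Qed.

Let nR : 2 * n%:R != 0 :> R.
Proof. by rewrite mulf_neq0 // pnatr_eq0; lia. Qed.

Lemma label_neq g0 m0 f0 X0 q q' (j : int) : isaff g0 m0 f0 ->
  (forall q, (`|q| <= n)%N -> co (f0 (base_pt R n)) q = (X0 q)%:~R / (2 * n%:R)) ->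
  (`|q| <= n)%N -> (`|q'| <= n)%N -> q != q' -> q != - q' -> X0 q' != X0 q + N * j.
Proof.
move=> f0P X0P qn q'n qq nqq; apply/eqP => E.
have q'q : q' != q by rewrite eq_sym.
have nq'q : q' != - q by lia.
have := isaff_neq n2 j f0P (alcove_base R n2) q'n qn q'q nq'q.
rewrite !X0P // E intrD intrM intN => /eqP; apply.
by field; move: nR; rewrite mulf_eq0 negb_or => /andP[].
Qed.

Section Reflect.
Variables (g m : int -> int) (f : V -> V) (X : int -> int) (a b d : int).
Hypothesis fP : isaff g m f.
Hypotheses (an : (`|a| <= n)%N) (bn : (`|b| <= n)%N) (b0 : b != 0).
Hypotheses (ab : a != b) (aNb : a != - b).
Hypothesis XP : forall q, (`|q| <= n)%N -> co (f (base_pt R n)) q = (X q)%:~R / (2 * n%:R).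
Hypothesis Xab : X b = X a + N * d + 1.

Let s : V -> V := reflection (e b - e a) d.
(** Coordinate q of the coroot of e_b - e_a. The image of [base_pt] lies 1 / 2n above the wall, so
    the reflection lowers the position of label q by exactly this amount. *)
Let kappa q : int := if a == 0 then 2 * delta b q else delta b q - delta a q.

Lemma delta_cases c q : c != 0 -> [\/ q = c /\ delta c q = 1, q = - c /\ delta c q = -1
  | [/\ q != c, q != - c & delta c q = 0]].
Proof.
move=> c0; rewrite /delta; have [->|qc] := eqVneq q c.
  by apply: Or31; split=> //; lia.
have [->|qNc] := eqVneq q (- c); first by apply: Or32; split=> //; lia.
by apply: Or33.
Qed.

Lemma kappa_short q : a = 0 -> [\/ q = b /\ kappa q = 2, q = - b /\ kappa q = -2
  | [/\ q != b, q != - b & kappa q = 0]].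
Proof.
move=> a0; rewrite /kappa a0 eqxx.
by have [[-> ->]|[-> ->]|[? ? ->]] := delta_cases q b0; [apply: Or31|apply: Or32|apply: Or33].
Qed.

Lemma kappa_long q : a != 0 -> [\/ (q = b \/ q = - a) /\ kappa q = 1,
  (q = a \/ q = - b) /\ kappa q = -1 | kappa q = 0].
Proof.
move=> a0; rewrite /kappa (negbTE a0).
have [[qb ->]|[qb ->]|[qb qNb ->]] := delta_cases q b0;
  have [[qa ->]|[qa ->]|[qa qNa ->]] := delta_cases q a0; try by lia.
- by apply: Or31; split; [left|].
- by apply: Or32; split; [right|].
- by apply: Or32; split; [left|].
- by apply: Or31; split; [right|].
- by apply: Or33.
Qed.

(** A root pairs with the coroot to at most 2. For a long wall root only the root itself attains 2;
    for the short root e_b other roots e_b - e_q do too, and [reflect_sign] excludes these by their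
    positions. *)
Lemma kappa_diff q q' : q != q' -> q != - q' -> kappa q' - kappa q <= 2 /\
  (kappa q' - kappa q = 2 -> if a == 0 then (q' = b /\ kappa q = 0) \/ (q = - b /\ kappa q' = 0)
     else (q' = b /\ q = a) \/ (q' = - a /\ q = - b)).
Proof.
move=> qq nqq; have [a0|a0] := eqVneq a 0.
  by have := kappa_short q a0; have := kappa_short q' a0 => -[[? ->]|[? ->]|[? ? ->]] [[? ->]|[? ->]|[? ? ->]];
    split; lia.
by have := kappa_long q a0; have := kappa_long q' a0 => -[[? ->]|[? ->]|->] [[? ->]|[? ->]|->];
  split; lia.
Qed.

Lemma reflect_label g' m' X' : isaff g' m' (s \o f) ->
  (forall q, (`|q| <= n)%N -> co ((s \o f) (base_pt R n)) q = (X' q)%:~R / (2 * n%:R)) ->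
  forall q, (`|q| <= n)%N -> X' q = X q - kappa q.
Proof.
move=> sfP X'P q qn; apply: (@intr_inj R).
apply: (mulIf (invr_neq0 nR)); rewrite -X'P //=.
have E : co (f (base_pt R n)) b - co (f (base_pt R n)) a - d%:~R = 1 / (2 * n%:R).
  rewrite !XP // Xab !intrD intrM intN.
  by field; move: nR; rewrite mulf_eq0 negb_or => /andP[].
rewrite /s /kappa; have [a0|a0] := eqVneq a 0 => /=.
  rewrite a0 evec0 subr0 coB coZ /coroot coZ -![dot _ (e b)]/(co _ b) !co_evec_delta //.
  have -> : delta b b = 1 by rewrite /delta; lia.
  move: E; rewrite a0 co0 subr0 => ->; rewrite XP // divr1.
  have -> : (X q - 2 * delta b q)%:~R = (X q)%:~R - 2 * (delta b q)%:~R :> R.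
    by rewrite intrB intrM.
  by rewrite mulrBl mulrA; congr (_ - _); ring.
have -> : (X q - (delta b q - delta a q))%:~R =
    (X q)%:~R - (delta b q - delta a q)%:~R :> R by rewrite intrB.
by rewrite co_reflection_long // E XP // mulrBl; congr (_ - _); ring.
Qed.

Lemma reflect_wall g' m' X' : isaff g' m' (s \o f) ->
  (forall q, (`|q| <= n)%N -> co ((s \o f) (base_pt R n)) q = (X' q)%:~R / (2 * n%:R)) ->
  X' b = X' a + N * d - 1.
Proof.
move=> sfP X'P; rewrite !(reflect_label sfP X'P) // Xab /kappa.
have -> : delta b b = 1 by rewrite /delta; lia.
have -> : delta b a = 0 by rewrite /delta; lia.
have -> : delta a b = 0 by rewrite /delta; lia.
case: eqVneq => a0; first by lia.
have -> : delta a a = 1 by rewrite /delta; lia.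
by lia.
Qed.

(* A reflection in a wall of the alcove moves it across no other hyperplane. *)
Lemma reflect_sign g' m' X' q q' (j : int) : isaff g' m' (s \o f) ->
  (forall q, (`|q| <= n)%N -> co ((s \o f) (base_pt R n)) q = (X' q)%:~R / (2 * n%:R)) ->
  (`|q| <= n)%N -> (`|q'| <= n)%N -> q != q' -> q != - q' ->
  [\/ e q' - e q = e b - e a /\ j = d, e q' - e q = e a - e b /\ j = - d
    | (X q + N * j < X q') = (X' q + N * j < X' q')].
Proof.
move=> sfP X'P qn q'n qq nqq.
have XN := label_neq _ fP XP; have X'N := label_neq _ sfP X'P.
have X'E := reflect_label sfP X'P.
suff W q1 q1' (j1 : int) : (`|q1| <= n)%N -> (`|q1'| <= n)%N -> q1 != q1' -> q1 != - q1' ->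
    X q1 + N * j1 < X q1' -> X' q1' < X' q1 + N * j1 -> e q1' - e q1 = e b - e a /\ j1 = d.
  have [h|h] := ltrP (X q + N * j) (X q').
    have [h'|h'] := ltrP (X' q + N * j) (X' q'); first by apply: Or33.
    apply: Or31; apply: W => //; have := X'N q q' j qn q'n qq nqq; lia.
  have [h'|h'] := ltrP (X' q + N * j) (X' q'); last by apply: Or33.
  have [E jd] : e q - e q' = e b - e a /\ - j = d.
    have := XN q q' j qn q'n qq nqq => ?.
    by apply: W => //; lia.
  by apply: Or32; split; [rewrite -opprB E opprB|lia].
move=> {}qn {}q'n {}qq {}nqq h h'.
have [k2 k2E] := kappa_diff qq nqq.
move: h'; rewrite !X'E // => h'.
(* A positive integer becomes negative by losing at most 2, so it was 1 and the loss is 2. *)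
have D1 : X q1' = X q1 + N * j1 + 1 by lia.
have /k2E {}k2E : kappa q1' - kappa q1 = 2 by lia.
(* Only label 0 has a position divisible by 2n; any other would put the image of [base_pt] on a
   hyperplane of the short root. *)
have Xz q2 t : (`|q2| <= n)%N -> X q2 = N * t -> q2 = 0.
  move=> q2n E; apply/eqP; apply: contraT => q20.
  have X00 : X 0 = 0.
    have z : (`|0 : int| <= n)%N by [].
    apply: (@intr_inj R); apply: (mulIf (invr_neq0 nR)).
    by rewrite -XP // co0 mul0r.
  have := XN 0 q2 t; rewrite X00 E add0r eqxx; apply=> //; [by rewrite eq_sym|lia].
move: k2E; case: (eqVneq a 0) => [a0|a0] k2E.
  have X00 : X a = 0.
    apply: (@intr_inj R); apply: (mulIf (invr_neq0 nR)).
    by rewrite -XP // a0 co0 mul0r.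
  have Xbn : X (- b) = - X b.
    apply: (@intr_inj R); apply: (mulIf (invr_neq0 nR)).
    by rewrite -XP; [rewrite co_opp XP // rmorphN mulNr|lia].
  have [[qE q'E]|[qE q'E]] := k2E.
  - have q0 : q1 = 0 by apply: (Xz _ (d - j1)) => //; move: D1; rewrite qE; lia.
    split; first by rewrite qE q0 a0.
    have jd : N * (d - j1) = 0 by move: D1; rewrite qE q0 -a0; lia.
    by nia.
  - have q0 : q1' = 0 by apply: (Xz _ (j1 - d)) => //; move: D1; rewrite qE; lia.
    split; first by rewrite qE q0 a0 evecN evec0 sub0r opprK subr0.
    have jd : N * (d - j1) = 0 by move: D1; rewrite qE q0 -a0; lia.
    by nia.
have XaN : X (- a) = - X a.
  apply: (@intr_inj R); apply: (mulIf (invr_neq0 nR)).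
  by rewrite -XP; [rewrite co_opp XP // rmorphN mulNr|lia].
have Xbn : X (- b) = - X b.
  apply: (@intr_inj R); apply: (mulIf (invr_neq0 nR)).
  by rewrite -XP; [rewrite co_opp XP // rmorphN mulNr|lia].
have [[qE q'E]|[qE q'E]] := k2E.
- split; first by rewrite qE q'E.
  have jd : N * (d - j1) = 0 by move: D1; rewrite qE q'E; lia.
  by nia.
- split; first by rewrite qE q'E !evecN opprK addrC.
  have jd : N * (d - j1) = 0 by move: D1; rewrite qE q'E; lia.
  by nia.
Qed.

End Reflect.

Lemma component_isaff g m f S y : isaff g m f -> shi_region Phi S ->
  f @` alcove Phi `<=` S -> alcove Phi y ->
  S = connected_component (shi_complement Phi) (f y).
Proof.
move=> fP [x Sx ->] sub A; apply: same_connected_component.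
by apply: sub; exists y.
Qed.

Lemma posroot_gt0 a y : posroot Phi a -> alcove Phi y -> 0 < dot y a.
Proof.
move=> /posrootP[k [l [kn ln lk nkl ->]]] A; rewrite dot_root.
by case/andP: (alcove_bounds n2 A kn ln lk nkl).
Qed.

(** Otherwise the wall is not a Shi hyperplane, and the reflection in it yields an alcove of the
    same Shi region with exactly this hyperplane removed from the separating ones. *)
Lemma minimal_no_wall g m f a b (d : int) : isaff g m f -> shi_minimal Phi f ->
  (`|a| <= n)%N -> (`|b| <= n)%N -> b != 0 -> a != b -> a != - b ->
  pos m b = pos m a + N * d + 1 -> 0 < d -> d = 1 /\ g a < g b.
Proof.
move=> fP [fW [S [Sreg sub minf]]] an bn b0 ab aNb E d0.
have [gP mo ms H] := fP; have A0 := alcove_base R n2.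
have [X [Xg Xgt Xsep XP]] := isaff_label fP.
have gan := sperm_bound gP an; have gbn := sperm_bound gP bn.
have gb0 := sperm_neq0 gP bn b0.
have gab : g a != g b by rewrite (sperm_eq gP).
have gaNb : g a != - g b by rewrite (sperm_eqN gP).
have Xab : X (g b) = X (g a) + N * d + 1 by rewrite !Xg.
pose s : V -> V := reflection (e (g b) - e (g a)) d.
have [//|bad] := pselect (d = 1 /\ g a < g b); exfalso.
(* The wall is written with a positive root r. If g b < g a, the root changes sign and the height
   becomes -d, which is negative. *)
have [r [k [rP sE k01 rE]]] : exists (r : V) (k : int), [/\ posroot Phi r, s = reflection r k, k <> 0 /\ k <> 1
    & (r = e (g b) - e (g a) /\ k = d) \/ (r = e (g a) - e (g b) /\ k = - d)].
  have [gba|gba] := ltP (g a) (g b).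
    exists (e (g b) - e (g a)), d; split=> //; [exact: posroot_long| |by left].
    by split=> d1; [lia|apply: bad].
  exists (e (g a) - e (g b)), (- d); split=> //; last by right.
  - by apply: posroot_long => //; lia.
  - by rewrite /s -reflectionN opprB.
  - lia.
have rU c j : posroot Phi c -> c = e (g b) - e (g a) /\ j = d \/ c = e (g a) - e (g b) /\ j = - d ->
    c = r /\ j = k.
  move=> cP; have no c' : posroot Phi c' -> posroot Phi (- c') -> False.
    move=> /posroot_gt0/(_ A0) h /posroot_gt0/(_ A0).
    by rewrite dotC dotNl dotC; lra.
  case: rE => [[rE kE]|[rE kE]] => -[[cE jE]|[cE jE]]; rewrite cE jE rE kE //; exfalso.
    by apply: (no _ rP); rewrite rE opprB -cE.
  by apply: (no _ rP); rewrite rE opprB -cE.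
have sfW : affine_weyl Phi (s \o f) by apply: generated_comp => //; exists r, k.
have [g' [m' sfP]] := affine_weyl_isaff n2 sfW.
have [X' [_ X'gt X'sep X'P]] := isaff_label sfP.
have sgn q q' j := @reflect_sign _ _ _ _ _ _ _ fP gan gbn gb0 gab gaNb XP Xab _ _ _ q q' j sfP X'P.
have X'ab : X' (g b) = X' (g a) + N * d - 1.
  exact: (reflect_wall gan gbn gb0 gab gaNb XP Xab sfP X'P).
have sub' : (s \o f) @` alcove Phi `<=` S.
  rewrite (component_isaff fP Sreg sub A0) => _ [y A <-].
  apply: same_component; [exact: alcove_shi fP A0|exact: alcove_shi sfP A|].
  move=> q' q j q'n qn qq' nqq' j01.
  have ne : q != q' by rewrite lt_eqF.
  have nne : q != - q' := neq_opp_sym nqq'.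
  rewrite Xgt // X'gt //.
  have qP : posroot Phi (e q' - e q) by exact: posroot_long.
  have [h|h|//] := sgn q q' j qn q'n ne nne.
    by have [_ jk] := rU _ _ qP (or_introl h); rewrite jk in j01; case: j01 k01 => -> [].
  by have [_ jk] := rU _ _ qP (or_intror h); rewrite jk in j01; case: j01 k01 => -> [].
have notin : ~ separating Phi ((s \o f) @` alcove Phi) (r, k).
  case=> _ /=; case: rE => -[-> ->].
    by move=> /X'sep -/(_ gan gbn gab gaNb); lia.
  have gba : g b != g a by rewrite eq_sym.
  have gbNa : g b != - g a by lia.
  by move=> /X'sep -/(_ gbn gan gba gbNa); lia.
have isin : separating Phi (f @` alcove Phi) (r, k).
  split=> //=; case: rE => -[-> ->].
    by apply/Xsep => //; lia.
  have gba : g b != g a by rewrite eq_sym.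
  have gbNa : g b != - g a by lia.
  by apply/Xsep => //; lia.
apply: (finite_card_setD1 (separating_finite n2 fP) isin).
apply: card_le_trans (minf _ sfW sub') _; apply: subset_card_le => -[c j] cj.
split; last by move=> /= cjE; apply: notin; rewrite -cjE.
have [/= cP csep] := cj; split=> //=.
have [q' [q [[q'n qn qq' nqq' cE] _]]] := isaff_root n2 (isaff_id R n) cP.
rewrite /= in cE; rewrite cE in cP csep cj *.
have ne : q != q' by rewrite eq_sym.
have nne : q != - q' := neq_opp_sym nqq'.
move: csep => /X'sep -/(_ qn q'n ne nne) csep; apply/Xsep => //.
have XN := label_neq j fP XP qn q'n ne nne; have X'N := label_neq j sfP X'P qn q'n ne nne.
have [h|h|h] := sgn q q' j qn q'n ne nne.
- by have [h1 h2] := rU _ _ cP (or_introl h); exfalso; apply: notin; rewrite -h1 -h2.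
- by have [h1 h2] := rU _ _ cP (or_intror h); exfalso; apply: notin; rewrite -h1 -h2.
- by case: csep => -[j0 h']; [left|right]; split=> //; lia.
Qed.

Lemma minimal_small_floors g m f : isaff g m f -> shi_minimal Phi f -> small_floors n g m.
Proof.
move=> fP fmin; have [gP mo ms H] := fP.
apply: small_floors_half => // [k|r rP||].
- exact: sperm_opp gP k.
- have [d0|d0] := lerP (m r - m (r + 1)) 0; first by split; lia.
  have [d1 gr] : m r - m (r + 1) = 1 /\ g r < g (r + 1).
    apply: (minimal_no_wall fP fmin) => //; try by lia.
    by rewrite /row_pos; ring.
  by split; [lia|].
(* The affine wall, between the rows n - 1 and -n, has the height m(n - 1) + m(n) - 1. *)
- have [d0|d0] := lerP (m (n%:Z - 1) + m n%:Z - 1) 0; first by lia.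
  have [] : m (n%:Z - 1) + m n%:Z - 1 = 1 /\ g (n%:Z - 1) < g (- n%:Z); last by lia.
  apply: (minimal_no_wall fP fmin) => //; try by lia.
  by rewrite /row_pos mo; ring.
- move=> E; have d0 : 0 < m (n%:Z - 1) + m n%:Z - 1 by rewrite E.
  have [] : m (n%:Z - 1) + m n%:Z - 1 = 1 /\ g (n%:Z - 1) < g (- n%:Z).
    apply: (minimal_no_wall fP fmin) => //; try by lia.
    by rewrite /row_pos mo; ring.
  by rewrite (sperm_opp gP); lia.
Qed.

End Crossing.

(** * The Anderson map *)

(** Starting from -n, an increasing integer map satisfies g k >= k; applied to -k, oddness gives the
    reverse inequality. *)
Lemma sperm_increasing_id (n : nat) (g : int -> int) : signed_perm n g ->
  (forall k l : int, (`|k| <= n)%N -> (`|l| <= n)%N -> l < k -> g l < g k) ->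
  forall k : int, (`|k| <= n)%N -> g k = k.
Proof.
move=> gP mono; have low (i : nat) : (i <= 2 * n)%N -> i%:Z - n%:Z <= g (i%:Z - n%:Z).
  elim: i => [|i IH] iN.
    have b : (`|0%:Z - n%:Z| <= n)%N by lia.
    by move: (g _) (sperm_bound gP b) => t; lia.
  have := IH (ltnW iN); have := mono (i.+1%:Z - n%:Z) (i%:Z - n%:Z); lia.
have {}low k : (`|k| <= n)%N -> k <= g k.
  move=> kn; have kE : k = `|(k + n%:Z)%R|%N%:Z - n%:Z by lia.
  by rewrite kE; apply: low; lia.
move=> k kn; have := low k kn; have kn' : (`|- k| <= n)%N by lia.
by have := low _ kn'; rewrite (sperm_opp gP); lia.
Qed.

Section Anderson.
Variables (R : realType) (n : nat).
Hypothesis n2 : (2 <= n)%N.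
Implicit Types (x y z : 'rV[R]_n) (k l r q : int) (g m : int -> int).
Local Notation e := (evec R n).
Local Notation V := 'rV[R]_n.
Local Notation Phi := (typeB R n).
Local Notation N := (2 * n%:Z).
Local Notation pos := (row_pos n).

(** All positive coordinates lie in (0, 1) before and after, so each is moved as it is or becomes 1
    - x_k. Two such flips violate the bound on sums, a single one the parity of m. Without flips g
    preserves the order. *)
Lemma alcove_rigid g m (f : V -> V) x : isaff g m f -> alcove Phi x -> alcove Phi (f x) ->
  forall k, (`|k| <= n)%N -> g k = k /\ m k = 0.
Proof.
move=> [gP mo ms H] A A'.
have z : (`|0 : int| <= n)%N by [].
have C := (chamberP n2 x).1 (alcove_chamber A).
have C' := (chamberP n2 (f x)).1 (alcove_chamber A').
have bd y k : alcove Phi y -> (`|k| <= n)%N -> 0 < k -> 0 < co y k < 1.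
  move=> Ay kn k0; have kN0 : k != - 0 by rewrite oppr0; lia.
  by have := alcove_bounds n2 Ay kn z k0 kN0; rewrite co0 subr0.
have val k : (`|k| <= n)%N -> 0 < k -> (0 < g k /\ m k = 0) \/ (g k < 0 /\ m k = 1).
  move=> kn k0; have kN : k != 0 by lia.
  have gk := sperm_neq0 gP kn kN; have gb := sperm_bound gP kn.
  have /andP[b0 b1] := bd x k A kn k0.
  have [g0|g0] : 0 < g k \/ 0 < - g k by lia.
    left; split=> //; have /andP[c0 c1] := bd _ _ A' gb g0.
    rewrite H // in c0 c1; have h1 : -1 < (m k)%:~R :> R by lra.
    have h2 : (m k)%:~R < 1 :> R by lra.
    by move: h1 h2; rewrite -[-1]/((-1)%:~R) -[1]/(1%:~R) !ltr_int; lia.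
  right; split; first by lia.
  have gb' : (`|- g k| <= n)%N by lia.
  have /andP[c0 c1] := bd _ _ A' gb' g0.
  rewrite co_opp H // in c0 c1; have h1 : 0 < (m k)%:~R :> R by lra.
  have h2 : (m k)%:~R < 2 :> R by lra.
  by move: h1 h2; rewrite -[2]/(2%:~R) ltr0z ltr_int; lia.
(* Both x_k + x_l < 1 and (1 - x_k) + (1 - x_l) < 1 would hold. *)
have once k l : (`|k| <= n)%N -> (`|l| <= n)%N -> 0 < k -> 0 < l -> k != l -> m k = 1 -> m l = 1 -> False.
  move=> kn ln k0 l0 kl mk ml.
  have kN : k != 0 by lia.
  have lN : l != 0 by lia.
  have [[]|[gk _]] := val k kn k0; first by rewrite mk.
  have [[]|[gl _]] := val l ln l0; first by rewrite ml.
  have gkn := sperm_bound gP kn; have gln := sperm_bound gP ln.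
  have ln' : (`|- l| <= n)%N by lia.
  have lk : - l < k by lia.
  have nkl : k != - - l by lia.
  have /andP[b0 b1] := alcove_bounds n2 A kn ln' lk nkl.
  have gln' : (`|- g l| <= n)%N by lia.
  have glk : g k < - g l by lia.
  have ngkl : - g l != - g k by have := sperm_inj gP kn ln; lia.
  have /andP[c0 c1] := alcove_bounds n2 A' gln' gkn glk ngkl.
  by move: b0 b1 c0 c1; rewrite !co_opp !H // mk ml; lra.
(* A single flip makes the coordinate sum of m equal to 1. *)
have m0 k : (`|k| <= n)%N -> 0 < k -> m k = 0.
  move=> kn k0; have [[]//|[_ mk]] := val k kn k0; exfalso.
  have [i iE] := ord_of k0 kn.
  move: ms; rewrite /coord_sum (bigD1 i) //= big1 => [|j ne].
    by rewrite -iE mk.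
  have jn : (`|j.+1%:Z| <= n)%N by have := ltn_ord j; lia.
  have kj : k != j.+1%:Z by rewrite iE; apply: contra ne => /eqP[] /val_inj ->.
  by have [[]//|[_ mj]] := val j.+1%:Z jn isT; have := once _ _ kn jn k0 isT kj mk mj.
have {}m0 k : (`|k| <= n)%N -> m k = 0.
  move=> kn; have [k0|k0|->] := ltgtP k 0; [|exact: m0|exact: odd_fun0].
  by rewrite -[k]opprK mo m0 ?oppr0 //; lia.
move=> k kn; split; last exact: m0.
apply: (sperm_increasing_id gP) => // a b an bn ba.
have lt : co (f x) (g b) < co (f x) (g a) by rewrite !H // !m0 // !subr0; exact: C.
rewrite ltNge; apply/negP; rewrite le_eqVlt => /orP[/eqP E|/C' h].
  by rewrite E ltxx in lt.
by have := lt_trans lt (h (sperm_bound gP bn) (sperm_bound gP an)); rewrite ltxx.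
Qed.

Lemma alcove_rigid_id g m (f : V -> V) x : isaff g m f -> alcove Phi x -> alcove Phi (f x) ->
  f = idfun.
Proof.
move=> fP A A'; have E := alcove_rigid fP A A'; apply: isaff_inj (isaff_id R n).
apply: isaff_eq fP (sperm_id n) _ _ => // k kn.
by have [-> ->] := E k kn.
Qed.

Lemma isaff_exists g m : signed_perm n g -> (forall k, m (- k) = - m k) ->
  (2 %| coord_sum n m)%Z -> exists f : V -> V, isaff g m f.
Proof.
move=> gP mo ms; have [h hP hK] := sperm_inverse gP.
exists (fun x => vec n (fun l => co x (h l) - (m (h l))%:~R)); split=> // x k kn.
rewrite co_vec ?sperm_bound // ?(hK k kn).1 // => l.
by rewrite (sperm_opp hP) mo co_opp rmorphN /= opprD.
Qed.

(* w_f is the translation by (1, 2, ..., n) if n (n + 1) / 2 is even; otherwise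
   it is composed with the symmetry x_n -> 1 - x_n of the alcove. *)
Definition triangular_even : bool := (n %% 4 == 0)%N || (n %% 4 == 3)%N.

Definition wf_g k : int := if triangular_even then k else if `|k|%N == n then - k else k.

Definition wf_m k : int :=
  if ~~ triangular_even && (`|k|%N == n) then k + sgz k else - k.

Lemma sum_triangular (i : nat) : 2 * \sum_(j < i) j.+1%:Z = i%:Z * (i%:Z + 1).
Proof.
elim: i => [|i IH]; first by rewrite big_ord0.
by rewrite big_ord_recr /= mulrDr IH; lia.
Qed.

Lemma triangular_evenE : (2 %| \sum_(j < n) j.+1%:Z)%Z = triangular_even.
Proof.
have := sum_triangular n; move: (\sum_(j < n) _) => S.
rewrite /triangular_even; have := divn_eq n 4; have := ltn_pmod n (isT : (0 < 4)%N).
move: (n %/ 4)%N (n %% 4)%N => a b b4 -> E.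
have [bE|[bE|[bE|bE]]] : b = 0%N \/ b = 1%N \/ b = 2%N \/ b = 3%N by lia.
- have -> : S = 2 * (4 * (a%:Z * a%:Z) + a%:Z) by move: E; rewrite bE; lia.
  by rewrite dvdz_mulr // bE.
- have -> : S = 2 * (4 * (a%:Z * a%:Z) + 3 * a%:Z) + 1 by move: E; rewrite bE; lia.
  by rewrite bE /=; lia.
- have -> : S = 2 * (4 * (a%:Z * a%:Z) + 5 * a%:Z + 1) + 1 by move: E; rewrite bE; lia.
  by rewrite bE /=; lia.
- have -> : S = 2 * (4 * (a%:Z * a%:Z) + 7 * a%:Z + 3) by move: E; rewrite bE; lia.
  by rewrite dvdz_mulr // bE.
Qed.

Lemma wf_g_sperm : signed_perm n wf_g.
Proof.
by apply: (signed_perm_intro (h := wf_g)) => [k|k kn|k kn]; rewrite /wf_g;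
  case: triangular_even => //; do ![case: ifP => /= ?]; lia.
Qed.

Lemma wf_m_odd k : wf_m (- k) = - wf_m k.
Proof. by rewrite /wf_m abszN; case: ifP => _ //; rewrite sgzN opprD. Qed.

Lemma wf_m_even : (2 %| coord_sum n wf_m)%Z.
Proof.
have n0 : (n.-1 < n)%N by lia.
(* In the odd case the value n + 1 at n exceeds -n by the odd number 2n + 1, which repairs the
   parity. *)
pose c (j : 'I_n) : int := if (j == Ordinal n0) && ~~ triangular_even then N + 1 else 0.
have -> : coord_sum n wf_m = \sum_(j < n) (c j - j.+1%:Z).
  apply: eq_bigr => j _; rewrite /wf_m /c -val_eqE /= [_ && ~~ _]andbC.
  have -> : (j.+1 == n) = (j == n.-1 :> nat) by have := ltn_ord j; lia.
  by case: eqP => [->|_]; rewrite ?andbF ?andbT; [case: triangular_even => /=; lia|rewrite sub0r].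
have := triangular_evenE; rewrite sumrB [\sum_(j < n) c j](bigD1 (Ordinal n0)) //= [X in _ + X - _]big1 => [|j /negbTE jN].
  by rewrite /c eqxx /=; move: (\sum_(j < n) _) => S; case: triangular_even => /=; lia.
by rewrite /c jN.
Qed.

(** The explicit element f0 maps the alcove onto the dilated one. The element chosen by [xget] does
    the same, so the two agree by rigidity of the alcove. *)
Lemma w_fP : isaff wf_g wf_m (w_f Phi).
Proof.
have [f0 f0P] := isaff_exists wf_g_sperm wf_m_odd wf_m_even.
have [h [hm [f1 [f1P K K' hK mE]]]] := isaff_inv n2 f0P.
have [_ _ _ H0] := f0P.
pose F : set V := [set x | (forall a, simpleroot Phi a -> 1 < dot x a) /\
             dot x (highestroot Phi) < (coxeter Phi)%:R].
have hiE x : dot x (highestroot Phi) = co x (n%:Z - 1) + co x n%:Z.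
  have -> : n%:Z - 1 = n.-1 by lia.
  by rewrite /= dotC dotDl !(dotC _ x).
have FP x : F x <-> alcove Phi (f1 x).
  have E k : (`|k| <= n)%N -> co (f1 x) k = co x (wf_g k) + (wf_m k)%:~R.
    by move=> kn; rewrite -{2}(K' x) H0 // subrK.
  have small k : 0 <= k < n%:Z -> co (f1 x) k = co x k - k%:~R.
    move=> kn; rewrite E; last by lia.
    have kN : (`|k|%N == n) = false by lia.
    by rewrite /wf_g /wf_m kN andbF rmorphN; case: ifP.
  have top : co (f1 x) n%:Z = if triangular_even then co x n%:Z - n%:R else n%:R + 1 - co x n%:Z.
    rewrite E // /wf_g /wf_m /= eqxx; case: triangular_even => /=.
      by rewrite rmorphN.
    have -> : sgz n%:Z = 1 by lia.
    by rewrite co_opp rmorphD /=; ring.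
  have n1 : co (f1 x) (n%:Z - 1) = co x (n%:Z - 1) - n%:R + 1.
    by rewrite small; [rewrite rmorphB /=; ring|lia].
  have coxE : (coxeter Phi)%:R = 2 * n%:R :> R by rewrite /= natrM.
  split=> [[S hi]|/(alcoveP n2)[S hi]].
    have S' k : 0 <= k < n%:Z -> 1 < co x (k + 1) - co x k.
      move=> kn; have [->|k0] := eqVneq k 0.
        by rewrite -dot_root evec0 subr0; apply: S; left.
      rewrite -dot_root; apply: S; right; exists `|k|%N; first by lia.
      have -> : (`|k|.+1)%N%:Z = k + 1 by lia.
      by have -> : `|k|%N%:Z = k by lia.
    rewrite hiE coxE in hi.
    have Sn : 1 < co x n%:Z - co x (n%:Z - 1).
      by have := S' (n%:Z - 1); rewrite subrK; apply; lia.
    apply/(alcoveP n2); split=> [k kn|]; last by rewrite top n1; case: ifP => _; lra.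
    have [kN|kN] := eqVneq k (n%:Z - 1).
      by rewrite kN subrK top n1; case: ifP => _; lra.
    rewrite !small; try by lia.
    by have := S' k kn; rewrite rmorphD /=; lra.
  have Sn := S (n%:Z - 1); rewrite subrK top n1 in Sn hi.
  have {}Sn := Sn ltac:(lia).
  have S' k : 0 <= k < n%:Z -> 1 < co x (k + 1) - co x k.
    move=> kn; have [kN|kN] := eqVneq k (n%:Z - 1).
      by rewrite kN subrK; move: Sn hi; case: ifP => _; lra.
    by have := S k kn; rewrite !small; try lia; rewrite rmorphD /=; lra.
  split; last by rewrite hiE coxE; move: Sn hi; case: ifP => _; lra.
  move=> a [->|[i iP ->]].
    by rewrite -[e 1]subr0 -evec0 dot_root; apply: (S' 0); lia.
  by rewrite dot_root; have := S' i%:Z; rewrite -PoszD addn1; apply; lia.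
have F0 : f0 @` alcove Phi = F.
  rewrite eqEsubset; split=> [_ [y A <-]|x /FP A]; first by apply/FP; rewrite K.
  by exists (f1 x); rewrite ?K'.
have [wW wF] : [set w | affine_weyl Phi w /\ w @` alcove Phi = F] (w_f Phi).
  by apply: (@xgetPex _ _ [set w | affine_weyl Phi w /\ w @` alcove Phi = F]); exists f0; split=> //; exact: isaff_affine_weyl f0P.
suff -> : w_f Phi = f0 by [].
have [g [m wP]] := affine_weyl_isaff n2 wW.
have A0 := alcove_base R n2.
have A1 : alcove Phi ((f1 \o w_f Phi) (base_pt R n)).
  by apply/FP; rewrite -wF; exists (base_pt R n).
have E := alcove_rigid_id (isaff_comp wP f1P) A0 A1.
apply/funext => x; rewrite -[w_f Phi x]K'; congr f0.
by have := congr1 (fun f => f x) E.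
Qed.

Lemma co_w_f_inv0 k : (`|k| <= n)%N -> co (w_f_inv0 Phi) k = (wf_m k)%:~R.
Proof.
have wP := w_fP; have [_ _ _ H] := wP => kn.
have [h [hm [f1 [f1P K K' hK mE]]]] := isaff_inv n2 wP.
have w0 : w_f Phi (w_f_inv0 Phi) = 0.
  by apply: (@xgetPex _ _ [set x | w_f Phi x = 0]); exists (f1 0); rewrite /= K'.
have := H (w_f_inv0 Phi) k kn; rewrite w0 /co dot0l => /eqP.
by rewrite eq_sym subr_eq0 => /eqP.
Qed.

Lemma lattice0 : coroot_lattice Phi 0.
Proof. by exists [::] => //; rewrite big_nil. Qed.

(* Shifting f^-1 (base_pt) by (1, 2, ..., n) moves it into the alcove dilated by
   2n + 1, so f is determined by its class, the alcove being rigid. *)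
Definition shifted g m : V := vec n (fun k => (N * (m k + k) + g k)%:~R / (N * (N + 1))%:~R).

(** Clearing denominators, each wall inequality compares the values of m with weight 2n and then
    those of g. As differences of g stay below 2n here, g only breaks ties, as in [small_floors]. *)
Lemma shifted_alcove g m (f : V -> V) : isaff g m f -> small_floors n g m ->
  alcove Phi (shifted g m).
Proof.
move=> [gP mo _ _] SF.
have coE k : (`|k| <= n)%N -> co (shifted g m) k = (N * (m k + k) + g k)%:~R / (N * (N + 1))%:~R.
  move=> kn; rewrite co_vec // => l.
  by rewrite mo (sperm_opp gP) -opprD mulrN -opprD rmorphN mulNr.
have D : 0 < (N * (N + 1))%:~R :> R by rewrite ltr0z; nia.
apply/(alcoveP n2); split=> [k kn|].
  have kb : (`|k| <= n)%N by lia.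
  have k1b : (`|(k + 1)%R| <= n)%N by lia.
  rewrite !coE // ltr_pM2r ?invr_gt0 // ltr_int.
  have [h1 h2] := SF k (k + 1) kb k1b (or_introl erefl).
  have gk := sperm_bound gP kb; have gk1 := sperm_bound gP k1b.
  have gN : g (k + 1) != - g k by rewrite (sperm_eqN gP) //; lia.
  move: h1 h2; rewrite /row_pos => h1 h2.
  have [d|d] : m k - m (k + 1) = 1 \/ m k - m (k + 1) <= 0 by nia.
    by have := h2 ltac:(nia); nia.
  by have gd : - N < g (k + 1) - g k by [lia|]; nia.
have nb : (`|n%:Z| <= n)%N by [].
have n1b : (`|(n%:Z - 1)%R| <= n)%N by lia.
have nNb : (`|- n%:Z| <= n)%N by lia.
rewrite !coE // -mulrDl -rmorphD ltr_pdivrMr // mul1r ltr_int.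
have [|h1 h2] := SF (n%:Z - 1) (- n%:Z) n1b nNb; first by right; lia.
have gn := sperm_bound gP nb; have gn1 := sperm_bound gP n1b.
have gN : g n%:Z != g (n%:Z - 1) by rewrite (sperm_eq gP) //; lia.
move: h1 h2; rewrite /row_pos mo (sperm_opp gP) => h1 h2.
have [d|d] : m (n%:Z - 1) + m n%:Z = 2 \/ m (n%:Z - 1) + m n%:Z <= 1 by nia.
  by have := h2 ltac:(nia); nia.
by have gd : g (n%:Z - 1) + g n%:Z < N by [lia|]; nia.
Qed.

Lemma coset_mod_eq x y : coset_mod Phi x = coset_mod Phi y ->
  exists2 z, coroot_lattice Phi z & x = y + z *+ (2 * n).+1.
Proof.
move=> E; have : coset_mod Phi x x by exists 0; [exact: lattice0|rewrite mul0rn addr0].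
by rewrite E => -[z zQ <-]; exists z.
Qed.

(** Modulo (2n + 1) Z^n the vector w_f^{-1}(0) is -(1, ..., n); this is the quotient of the
    difference by 2n + 1. *)
Definition flip_n k : int := if ~~ triangular_even && (`|k|%N == n) then sgz k else 0.

Lemma wf_m_flip k : (`|k| <= n)%N -> k + wf_m k = (N + 1) * flip_n k.
Proof.
by rewrite /wf_m /flip_n => kn; case: ifP => [/andP[_ /eqP]|_]; [|rewrite mulr0]; lia.
Qed.

(** A common class provides an element (gam, t) of the affine Weyl group that carries [shifted g m]
    to [shifted g' m']. Both points lie in the alcove, so it is the identity. *)
Lemma anderson_inj g m f g' m' f' : isaff g m f -> small_floors n g m ->
  isaff g' m' f' -> small_floors n g' m' -> anderson Phi f = anderson Phi f' -> f = f'.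
Proof.
move=> fP SF f'P SF' /coset_mod_eq[z /(coroot_latticeP n2)[Y [Yo Ys zY]] E].
have [gP mo ms H] := fP; have [g'P m'o m's H'] := f'P.
have A := shifted_alcove fP SF; have A' := shifted_alcove f'P SF'.
have [h hP hK] := sperm_inverse g'P.
pose gam := h \o g.
have gamP : signed_perm n gam by exact: sperm_comp.
have g'gam k : (`|k| <= n)%N -> g' (gam k) = g k.
  by move=> kn; rewrite /gam /= (hK _ (sperm_bound gP kn)).2.
pose t k := flip_n k - flip_n (gam k) + Y (g k).
have flo k : flip_n (- k) = - flip_n k by rewrite /flip_n abszN sgzN; case: ifP.
have to_ k : t (- k) = - t k.
  by rewrite /t !(sperm_opp gamP) (sperm_opp gP) !flo Yo; ring.
(* The lattice vector Y has even sum, and the two flip terms agree modulo 2. *)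
have te : (2 %| coord_sum n t)%Z.
  rewrite /coord_sum big_split sumrB /=.
  have := coord_sum_sperm Yo gP; have := coord_sum_sperm flo gamP.
  move: Ys; rewrite /coord_sum /=.
  move: (\sum_(i < n) flip_n (gam _)) (\sum_(i < n) flip_n i.+1%:Z) (\sum_(i < n) Y (g _)) (\sum_(i < n) Y i.+1%:Z) => a b c d; lia.
have rel k : (`|k| <= n)%N -> m' (gam k) + gam k = m k + k - (N + 1) * t k.
  move=> kn; have gk := sperm_bound gP kn; have gamk := sperm_bound gamP kn.
  have e1 : co (f (w_f_inv0 Phi)) (g k) = (wf_m k - m k)%:~R.
    by rewrite H // co_w_f_inv0 // rmorphB.
  have e2 : co (f' (w_f_inv0 Phi)) (g k) = (wf_m (gam k) - m' (gam k))%:~R.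
    by rewrite -(g'gam k kn) H' // co_w_f_inv0 // rmorphB.
  have := congr1 (fun x => co x (g k)) E; rewrite coD coMn !coN zY // e1 e2.
  have q : (2 * n).+1%:R = (N + 1)%:~R :> R by rewrite -addn1 natrD natrM intrD intrM.
  rewrite -!rmorphN -[_ *+ _]mulr_natr q -rmorphM -rmorphD => /intr_inj.
  have := wf_m_flip kn; have := wf_m_flip gamk; rewrite /t; lia.
have D0 : (N * (N + 1))%:~R != 0 :> R by rewrite intr_eq0; nia.
have shE g0 m0 k : signed_perm n g0 -> (forall k, m0 (- k) = - m0 k) -> (`|k| <= n)%N ->
    co (shifted g0 m0) k = (N * (m0 k + k) + g0 k)%:~R / (N * (N + 1))%:~R.
  move=> g0P m0o kn; rewrite co_vec // => l.
  by rewrite m0o (sperm_opp g0P) -opprD mulrN -opprD rmorphN mulNr.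
have [F FP] := isaff_exists gamP to_ te.
have FE : F (shifted g m) = shifted g' m'.
  have [gam' gam'P gamK] := sperm_inverse gamP; have [_ _ _ HF] := FP.
  apply: co_inj => l _ ln; have lb := sperm_bound gam'P ln.
  rewrite -(gamK l ln).2 HF // !shE ?sperm_bound // g'gam // rel //.
  set k := gam' l.
  have -> : N * (m k + k - (N + 1) * t k) + g k = N * (m k + k) + g k - t k * (N * (N + 1)) by ring.
  set a := N * (m k + k) + g k; set d := N * (N + 1) in D0 *.
  have -> : (a - t k * d)%:~R = a%:~R - (t k)%:~R * d%:~R :> R by rewrite intrB intrM.
  by rewrite mulrBl mulfK.
have rig := alcove_rigid FP A; rewrite FE in rig; have {}rig := rig A'.
apply: isaff_inj fP _; apply: isaff_eq f'P gP mo _ => // k kn.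
have [gk tk] := rig k kn; have := g'gam k kn; have := rel k kn.
by rewrite gk tk mulr0 subr0 => /addIr-> ->.
Qed.

End Anderson.

(** * Chambers and floors *)

Section Floors.
Variables (R : realType) (n : nat).
Hypothesis n2 : (2 <= n)%N.
Implicit Types (x y z : 'rV[R]_n) (k l r s p q : int).
Local Notation e := (evec R n).
Local Notation V := 'rV[R]_n.
Local Notation Phi := (typeB R n).
Local Notation N := (2 * n%:Z).
Local Notation pos := (row_pos n).

Lemma nbhs_co x (P : set V) : nbhs x P <->
  exists2 eps : R, 0 < eps &
    forall z, (forall k, (`|k| <= n)%N -> `|co z k - co x k| < eps) -> P z.
Proof.
split=> [/nbhs_ballP[eps /= eps0 H]|[eps eps0 H]].
  exists eps => // z zx; apply: H; split=> // i j; rewrite !ord1 /ball /=.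
  by rewrite distrC -!co_ord; apply: zx; exact: (ltn_ord j).
apply/nbhs_ballP; exists eps => //= z [_ zx]; apply: H => k kn.
have [k0|k0|->] := ltgtP k 0; last by rewrite !co0 subrr normr0.
  have k1 : 0 < - k by lia.
  have kn' : (`|- k| <= n)%N by lia.
  have [i iE] := ord_of k1 kn'.
  rewrite -[k]opprK iE !co_opp opprK addrC !co_ord; exact: zx.
have [i ->] := ord_of k0 kn.
by rewrite distrC !co_ord; exact: zx.
Qed.

Lemma closure_co (B : set V) z : closure B z <-> forall eps : R, 0 < eps ->
  exists2 z', B z' & forall k, (`|k| <= n)%N -> `|co z' k - co z k| < eps.
Proof.
split=> [C eps eps0|H U /nbhs_co[eps eps0 HU]].
  have [|z' [Bz' zz']] := C [set z' | forall k, (`|k| <= n)%N -> `|co z' k - co z k| < eps].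
    by apply/nbhs_co; exists eps.
  by exists z'.
by have [z' Bz' zz'] := H _ eps0; exists z'; split=> //; apply: HU.
Qed.

(** The lower bound of y_s - y_r on the alcove for adjacent rows; -1 belongs to the affine wall. *)
Definition wall_level (r s : int) : R := if s == r + 1 then 0 else -1.

Lemma alcove_walls y : alcove Phi y <-> forall r s, (`|r| <= n)%N -> (`|s| <= n)%N ->
  adj_rows n r s -> wall_level r s < co y s - co y r.
Proof.
split=> [A r s rn sn [sE|sE]|H].
- rewrite sE in sn *; rewrite /wall_level eqxx subr_gt0.
  have C := (chamberP n2 y).1 (alcove_chamber A); apply: C => //; lia.
- rewrite /wall_level ifF; last by lia.
  have sr : s < r by lia.
  have rs : r != - s by lia.
  by have /andP[_] := alcove_bounds n2 A rn sn sr rs; lra.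
apply/(alcoveP n2); split=> [k kn|].
  have := H k (k + 1); rewrite /wall_level eqxx subr_gt0; apply; [lia|lia|by left].
have := H (n%:Z - 1) (- n%:Z); rewrite /wall_level ifF; last by lia.
rewrite co_opp => h; have : -1 < - co y n%:Z - co y (n%:Z - 1) by apply: h; [lia|lia|right; lia].
by lra.
Qed.

Definition closed_alcove y : Prop := forall r s, (`|r| <= n)%N -> (`|s| <= n)%N ->
  adj_rows n r s -> wall_level r s <= co y s - co y r.

Lemma closed_mono y r s : closed_alcove y -> (`|r| <= n)%N -> (`|s| <= n)%N -> r <= s ->
  co y r <= co y s.
Proof.
move=> C rn sn rs; have -> : s = r + `|s - r|%N%:Z by lia.
have : r + `|s - r|%N%:Z <= n%:Z by lia.
elim: (`|s - r|%N) => [|i IH] h; first by rewrite addr0.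
apply: (le_trans (IH _)); first lia.
have := C (r + i%:Z) (r + i.+1%:Z); rewrite /wall_level ifT; last by lia.
by rewrite subr_ge0; apply; [lia|lia|left; lia].
Qed.

Lemma closed_bound y r s : closed_alcove y -> (`|r| <= n)%N -> (`|s| <= n)%N ->
  s - r <= N - 1 -> co y s - co y r <= 1.
Proof.
move=> C rn sn rs; have top : co y (n%:Z - 1) + co y n%:Z <= 1.
  have := C (n%:Z - 1) (- n%:Z); rewrite /wall_level ifF; last by lia.
  rewrite co_opp => h; have : -1 <= - co y n%:Z - co y (n%:Z - 1) by apply: h; [lia|lia|right; lia].
  by lra.
have [sN|sN] : s = n%:Z \/ s <= n%:Z - 1 by lia.
  have : co y (- (n%:Z - 1)) <= co y r by apply: (closed_mono C); lia.
  by rewrite sN co_opp; lra.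
have : co y (- n%:Z) <= co y r by apply: (closed_mono C); lia.
have : co y s <= co y (n%:Z - 1) by apply: (closed_mono C); lia.
by rewrite co_opp; lra.
Qed.

Let N0 : 0 < N%:~R :> R. Proof. by rewrite ltr0z; lia. Qed.

Lemma facet_point r s : (`|r| <= n)%N -> (`|s| <= n)%N -> adj_rows n r s ->
  exists2 y : V, co y s - co y r = wall_level r s &
    forall p q, (`|p| <= n)%N -> (`|q| <= n)%N -> adj_rows n p q ->
      [\/ p = r /\ q = s, p = - s /\ q = - r
        | wall_level p q + 1 / N%:~R <= co y q - co y p].
Proof.
move=> rn sn [sE|sE].
  (* The row i is the lower one of whichever pair (r, s) or (-s, -r) is nonnegative. Subtracting c
     from [base_pt] closes the gap between i and i + 1, and symmetrically the one between -i - 1 and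
     -i. *)
  pose i := if 0 <= r then r else - s.
  pose c k : int := (i < k)%R%:Z - (i < - k)%R%:Z.
  have cN k : c (- k) = - c k by rewrite /c opprK; lia.
  pose y : V := vec n (fun k => (k - c k)%:~R / N%:~R).
  have yE k : (`|k| <= n)%N -> co y k = (k - c k)%:~R / N%:~R.
    by move=> kn; rewrite co_vec // => l; rewrite cN -opprD rmorphN mulNr.
  have dE p q : (`|p| <= n)%N -> (`|q| <= n)%N ->
      co y q - co y p = (q - p - (c q - c p))%:~R / N%:~R.
    move=> pn qn; rewrite !yE // -mulrBl -rmorphB; congr (_%:~R / _); ring.
  exists y; first by rewrite dE // /wall_level sE eqxx (_ : _ - _ = 0) ?mul0r // /c /i; case: ifP; lia.
  move=> p q pn qn [qE|qE]; rewrite dE //; rewrite /wall_level.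
    rewrite qE eqxx add0r.
    have [cE|[cE|cE]] : p = r \/ (p = - s \/ p + 1 - p - (c (p + 1) - c p) = 1) by rewrite /c /i; case: ifP; lia.
    - by apply: Or31; rewrite cE sE.
    - by apply: Or32; rewrite cE sE; split=> //; lia.
    - by apply: Or33; rewrite cE.
  rewrite ifF; last by lia.
  apply: Or33; rewrite -(ler_pM2r N0) mulrDl !divfK ?gt_eqF //.
  have : (1 - N)%:~R <= (q - p - (c q - c p))%:~R :> R by rewrite ler_int /c; lia.
  by rewrite rmorphB /=; lra.
have M0 : 0 < (N - 1)%:~R :> R by rewrite ltr0z; lia.
(* The denominator 2n - 1 gives y_{n-1} + y_n = 1 and keeps all other gaps open. *)
pose y : V := vec n (fun k => k%:~R / (N - 1)%:~R).
have yE k : (`|k| <= n)%N -> co y k = k%:~R / (N - 1)%:~R.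
  by move=> kn; rewrite co_vec // => l; rewrite rmorphN mulNr.
have dE p q : (`|p| <= n)%N -> (`|q| <= n)%N -> co y q - co y p = (q - p)%:~R / (N - 1)%:~R.
  by move=> pn qn; rewrite !yE // -mulrBl -rmorphB.
exists y.
  rewrite dE // /wall_level ifF; last by lia.
  have -> : s - r = - (N - 1) by lia.
  by rewrite rmorphN mulNr divff // gt_eqF.
move=> p q pn qn [qE|qE].
  apply: Or33; rewrite dE // /wall_level qE eqxx add0r.
  have -> : p + 1 - p = 1 by lia.
  by rewrite !mul1r lef_pV2 ?posrE // ler_int; lia.
have [pr|pr] : p = r \/ p = - s by lia.
  by apply: Or31; split; lia.
by apply: Or32; split; lia.
Qed.

Variables (g m D : int -> int) (f : V -> V).
Hypotheses (fP : isaff g m f) (DP : signed_perm n D).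
Hypothesis Dmono : forall k l, (`|k| <= n)%N -> (`|l| <= n)%N -> l < k ->
  pos m (D l) < pos m (D k).
Local Notation W := (sperm_act (g \o D) : V -> V).
Local Notation B := (W @^-1` (f @` alcove Phi)).

Let gP : signed_perm n g. Proof. by case: fP. Qed.
Let mo k : m (- k) = - m k. Proof. by case: fP. Qed.
Let WP : signed_perm n (g \o D). Proof. exact: sperm_comp. Qed.
Let A0 := alcove_base R n2.

Lemma sorted_chamber y : alcove Phi y ->
  exists2 x, chamber Phi x & W x = f y.
Proof.
move=> A; pose x : V := vec n (fun k => co (f y) (g (D k))).
have xE k : (`|k| <= n)%N -> co x k = co (f y) (g (D k)).
  by move=> kn; rewrite co_vec // => l; rewrite (sperm_opp DP) (sperm_opp gP) co_opp.
have gt k l : (`|k| <= n)%N -> (`|l| <= n)%N -> l < k -> k != - l -> co x l < co x k.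
  move=> kn ln lk nkl; rewrite !xE // -subr_gt0.
  have := @isaff_gt R n n2 g m f fP y (D k) (D l) 0 A.
  rewrite mulr0 addr0 => -> //; rewrite ?sperm_bound ?(sperm_eq DP) ?(sperm_eqN DP) //; [|lia].
  exact: Dmono.
exists x.
  apply/(chamberP n2) => k l kn ln lk; have [kl|] := eqVneq k (- l); last exact: gt.
  have : co x 0 < co x k by apply: gt; rewrite ?oppr0; lia.
  have -> : l = - k by lia.
  by rewrite co0 co_opp; lra.
apply: co_inj => l _ ln; have [h hP hK] := sperm_inverse WP.
by rewrite -(hK l ln).2 co_sperm_act ?sperm_bound // xE ?sperm_bound.
Qed.

(** If W and the chosen g' both reach f([base_pt]) from the chamber, then g'^{-1} (g D) preserves
    the order of the signed coordinates, so it is the identity. *)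
Lemma chamber_ofE : chamber_of Phi (f @` alcove Phi) = W.
Proof.
have [wW wC] : [set w | weyl Phi w /\ f @` alcove Phi `<=` w @` chamber Phi] (chamber_of Phi (f @` alcove Phi)).
  apply: (@xgetPex _ _ [set w | weyl Phi w /\ f @` alcove Phi `<=` w @` chamber Phi]).
  exists W; split; first exact: sperm_weyl.
  by move=> _ [y A <-]; have [x Cx <-] := sorted_chamber A; exists x.
have [g' g'P wE] := weyl_sperm n2 wW; rewrite wE.
have [x Cx xE] := sorted_chamber A0.
have [|x' Cx' x'E] := wC (f (base_pt R n)); first by exists (base_pt R n).
apply: sperm_act_inj => // k kn.
have [h hP hK] := sperm_inverse g'P.
pose gam := h \o (g \o D).
have gamP : signed_perm n gam by exact: sperm_comp.
have g'gam l : (`|l| <= n)%N -> g' (gam l) = g (D l).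
  by move=> ln; rewrite /gam /= (hK _ _).2 // (sperm_bound WP).
have coE l : (`|l| <= n)%N -> co x' (gam l) = co x l.
  move=> ln; rewrite -(co_sperm_act n2 x' g'P (sperm_bound gamP ln)) g'gam // -wE x'E -xE.
  by rewrite -[g (D l)]/((g \o D) l) co_sperm_act.
have := g'gam k kn; rewrite (sperm_increasing_id gamP) // => a b an bn ba.
have lt : co x' (gam b) < co x' (gam a) by rewrite !coE //; apply: (chamberP n2 x).1.
rewrite ltNge; apply/negP; rewrite le_eqVlt => /orP[/eqP E|].
  by rewrite E ltxx in lt.
move=> /((chamberP n2 x').1 Cx' _ _ (sperm_bound gamP bn) (sperm_bound gamP an)).
by move/(lt_trans lt); rewrite ltxx.
Qed.

(** Rows at distance 2n + 1 are adjacent, and [facet_point] supplies an interior point of the facet.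
    At a larger distance the facet would also lie in the wall between the rows D l and D l + 1; that
    wall would have to be the same hyperplane, which is impossible. *)
Lemma floor_values a : is_floor Phi a 1 B <-> exists k l,
  [/\ (`|k| <= n)%N, (`|l| <= n)%N, l < k, k != - l &
    a = e k - e l /\ pos m (D k) = pos m (D l) + N + 1].
Proof.
have [Di DiP DiK] := sperm_inverse DP.
(* This is f^{-1} (W z), so B is the preimage of the alcove under [U]; [U'] inverts it. *)
pose U z : V := vec n (fun r => co z (Di r) + (m r)%:~R).
have UE z r : (`|r| <= n)%N -> co (U z) r = co z (Di r) + (m r)%:~R.
  by move=> rn; rewrite co_vec // => l; rewrite (sperm_opp DiP) mo co_opp rmorphN opprD.
have UD z k : (`|k| <= n)%N -> co (U z) (D k) = co z k + (m (D k))%:~R.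
  by move=> kn; rewrite UE ?sperm_bound // (DiK k kn).1.
pose U' y : V := vec n (fun k => co y (D k) - (m (D k))%:~R).
have U'E y k : (`|k| <= n)%N -> co (U' y) k = co y (D k) - (m (D k))%:~R.
  by move=> kn; rewrite co_vec // => l; rewrite (sperm_opp DP) mo co_opp rmorphN opprD.
have UU' y : U (U' y) = y.
  apply: co_inj => r _ rn; rewrite UE // U'E ?sperm_bound // (DiK r rn).2.
  by rewrite subrK.
have fU z : f (U z) = W z.
  have [_ _ _ H] := fP; apply: co_inj => l _ ln; have [h hP hK] := sperm_inverse WP.
  have hl := sperm_bound hP ln.
  rewrite -(hK l ln).2 co_sperm_act // /= H ?sperm_bound // UD //.
  by rewrite addrK.
have finj y y' : f y = f y' -> y = y'.
  have [_ _ _ H] := fP => E; apply: co_inj => k _ kn.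
  by have := H y k kn; rewrite E H // => /addIr.
have BP z : B z <-> alcove Phi (U z).
  split=> [[y A E]|A]; last by exists (U z).
  by rewrite (finj (U z) y) // fU E.
have Bgt k l z : (`|k| <= n)%N -> (`|l| <= n)%N -> k != l -> k != - l -> B z ->
    (1 < co z k - co z l) = (pos m (D l) + N < pos m (D k)).
  move=> kn ln kl nkl /BP A.
  have := @isaff_gt R n n2 g m f fP (U z) (D k) (D l) 1 A.
  rewrite mulr1 => <- //; rewrite ?sperm_bound ?(sperm_eq DP) ?(sperm_eqN DP) // fU.
  by rewrite -[g (D k)]/((g \o D) k) -[g (D l)]/((g \o D) l) !co_sperm_act.
have Bclosed z : closure B z -> closed_alcove (U z).
  move=> /closure_co C r s rn sn rs; rewrite leNgt; apply/negP => lt.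
  pose eps := (wall_level r s - (co (U z) s - co (U z) r)) / 2.
  have eps0 : 0 < eps by rewrite /eps; lra.
  have [z' /BP/alcove_walls/(_ r s rn sn rs) A zz'] := C _ eps0.
  have := zz' (Di s) (sperm_bound DiP sn); have := zz' (Di r) (sperm_bound DiP rn).
  move: A; rewrite /eps !UE // !ltr_norml => A /andP[? ?] /andP[? ?]; lra.
split; last first.
  move=> [k [l [kn ln lk nkl [-> E]]]].
  have kl : k != l by lia.
  have Dk := sperm_bound DP kn; have Dl := sperm_bound DP ln.
  split.
  - by apply/posrootP; exists k, l.
  - have adj : adj_rows n (D l) (D k).
      by apply: (@pos_adjacent n m n2 _ _ 1) => //; rewrite E; lia.
    have [y0 y0E y0w] := facet_point Dl Dk adj.
    have lev : (m (D l) - m (D k))%:~R = 1 - wall_level (D l) (D k) :> R.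
      move: E; rewrite /row_pos /wall_level; case: adj => DE.
        rewrite DE eqxx subr0 => E; have -> : m (D l) - m (D l + 1) = 1 by nia.
        by [].
      rewrite ifF; last by lia.
      move=> E; have -> : m (D l) - m (D k) = 2 by rewrite DE in E *; nia.
      by rewrite opprK.
    have hypE z : hyperplane (e k - e l) 1 z -> co (U z) (D k) - co (U z) (D l) = wall_level (D l) (D k).
      rewrite /hyperplane /= dot_root !UD // => hz.
      by move: lev; rewrite rmorphB /=; lra.
    exists (U' y0).
      rewrite /hyperplane /= dot_root !U'E //.
      by move: lev y0E; rewrite rmorphB /=; lra.
    apply/nbhs_co; pose del : R := 1 / N%:~R.
    have del0 : 0 < del by rewrite divr_gt0.
    exists (del / 4); first by rewrite divr_gt0.
    move=> z zx /hypE zE.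
    have close r : (`|r| <= n)%N -> `|co (U z) r - co y0 r| < del / 4.
      move=> rn; have := zx (Di r) (sperm_bound DiP rn).
      rewrite U'E ?sperm_bound // (DiK r rn).2 UE //.
      by rewrite opprB addrA.
    have C : closed_alcove (U z).
      move=> p q pn qn pq; have [[-> ->]|[-> ->]|h] := y0w p q pn qn pq.
      - by rewrite zE.
      - rewrite !co_opp opprK addrC zE /wall_level.
        by have -> : (- D l == - D k + 1) = (D k == D l + 1) by lia.
      - have := close p pn; have := close q qn.
        by rewrite !ltr_norml => /andP[? ?] /andP[? ?]; rewrite -/del in h; lra.
    apply/closure_co => eps eps0.
    (* Moving z towards the interior point x makes all wall inequalities strict. M exceeds every
       coordinate of x - z in absolute value, hence t M < eps. *)
    pose x := U' (base_pt R n).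
    pose M := 1 + \sum_(i < n) `|co x i.+1%:Z - co z i.+1%:Z|.
    have M1 : 1 <= M by rewrite lerDl sumr_ge0.
    pose t := eps / (M + eps).
    have Me : 0 < M + eps by lra.
    have t0 : 0 < t by rewrite divr_gt0.
    have t1 : t < 1 by rewrite ltr_pdivrMr //; lra.
    exists (z + t *: (x - z)).
      apply/BP/alcove_walls => p q pn qn pq.
      have h1 := (alcove_walls (base_pt R n)).1 A0 p q pn qn pq.
      have h2 := C p q pn qn pq.
      rewrite -(UU' (base_pt R n)) -/x in h1.
      move: h1 h2; rewrite !UE // !coD !coZ !coB.
      set a1 := co x _; set b1 := co x _; set a2 := co z _; set b2 := co z _ => h1 h2.
      have -> : a2 + t * (a1 - a2) + (m q)%:~R - (b2 + t * (b1 - b2) + (m p)%:~R) =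
         (1 - t) * (a2 + (m q)%:~R - (b2 + (m p)%:~R)) + t * (a1 + (m q)%:~R - (b1 + (m p)%:~R)) by ring.
      by nra.
    have small i : (`|i| <= n)%N -> 0 < i -> `|co x i - co z i| < M.
      move=> iN i0; have [j ->] := ord_of i0 iN.
      rewrite /M (bigD1 j) //=; have : 0 <= \sum_(i < n | i != j) `|co x i.+1%:Z - co z i.+1%:Z|.
        by rewrite sumr_ge0.
      by lra.
    move=> i iN; rewrite coD coZ coB addrC addKr normrM gtr0_norm //.
    have {}small : `|co x i - co z i| < M.
      have [i0|i0|->] := ltgtP i 0; last by rewrite !co0 subrr normr0; lra.
        rewrite -[i]opprK !(co_opp _ (- i)) -opprD normrN; apply: small; lia.
      exact: small.
    rewrite /t mulrAC ltr_pdivrMr // ltr_pM2l //; lra.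
  - left; split=> [_ ->|z Bz] /=; first by rewrite dot0l ltr01.
    by rewrite dot_root Bgt // E; lia.
move=> [/posrootP[k [l [kn ln lk nkl ->]]] [x0 Hx0 near0] sep].
exists k, l; split=> //; split=> //.
have kl : k != l by lia.
have BU' : B (U' (base_pt R n)) by apply/BP; rewrite UU'.
have gtN : pos m (D l) + N < pos m (D k).
  rewrite -(Bgt _ _ _ kn ln kl nkl BU').
  case: sep => -[h0 h1]; first by have := h1 _ BU'; rewrite /= dot_root.
  by have := h0 0 erefl; rewrite /= dot0l ltr10.
have [//|big] : pos m (D k) = pos m (D l) + N + 1 \/ pos m (D l) + N + 2 <= pos m (D k) by lia.
exfalso; have /nbhs_co[eps eps0 nearP] := near0.
have C z : (forall k, (`|k| <= n)%N -> `|co z k - co x0 k| < eps) ->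
    co z k - co z l = 1 -> closed_alcove (U z).
  by move=> zx zkl; apply/Bclosed/nearP => //; rewrite /hyperplane /= dot_root.
have {}Hx0 : co x0 k - co x0 l = 1 by move: Hx0; rewrite /hyperplane /= dot_root.
(* Passing to (-l, -k), which represents the same root, makes D l + 1 a row. *)
wlog rN : k l kn ln lk nkl kl gtN big C Hx0 {sep near0 nearP BU'} / D l < n%:Z.
  move=> W0; have [lN|lN] := ltrP (D l) n%:Z; first exact: (W0 k l).
  have kn' : (`|- k| <= n)%N by lia.
  have ln' : (`|- l| <= n)%N by lia.
  have posN r : pos m (- r) = - pos m r by rewrite /row_pos mo; ring.
  apply: (W0 (- l) (- k)); rewrite ?(sperm_opp DP) ?posN //; try by lia.
  - by move=> z zx; rewrite !co_opp opprK addrC; exact: C.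
  - by rewrite !co_opp opprK addrC.
  - have Dk := sperm_bound DP kn; have Dl := sperm_bound DP ln.
    have := sperm_eqN DP kn ln; lia.
have Dk := sperm_bound DP kn; have Dl := sperm_bound DP ln.
pose r := D l; pose s := D k; pose u := r + 1; pose q := Di u.
have un : (`|u| <= n)%N by rewrite /u /r; lia.
have qn : (`|q| <= n)%N by exact: sperm_bound.
have Dq : D q = u by rewrite /q (DiK u un).2.
have x0x0 i : (`|i| <= n)%N -> `|co x0 i - co x0 i| < eps by rewrite subrr normr0.
have sNr : s != - r by rewrite (sperm_eqN DP).
have sr : s != r by rewrite (sperm_eq DP).
(* the wall between the rows r and r + 1 contains the facet as well *)
have [us key] : u != s /\ forall z, (forall k, (`|k| <= n)%N -> `|co z k - co x0 k| < eps) ->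
    co z k - co z l = 1 -> co z q + (m u)%:~R = co z l + (m r)%:~R.
  have shift z : co z k - co z l = 1 -> co (U z) s - co (U z) r = (m s - m r + 1)%:~R.
    by move=> zE; rewrite !UD // rmorphD rmorphB /=; lra.
  have Uq z : co (U z) u = co z q + (m u)%:~R by rewrite -Dq UD.
  have Ul z : co (U z) r = co z l + (m r)%:~R by rewrite UD.
  have C0 := C _ x0x0 Hx0; have sh0 := shift _ Hx0.
  move: big; rewrite /row_pos -/r -/s => big.
  have [rs|rs] : r < s \/ s < r by lia.
    have lvl : m s - m r + 1 = 0.
      have h0 : 0 <= (m s - m r + 1)%:~R :> R by rewrite -sh0 subr_ge0; apply: closed_mono => //; lia.
      rewrite ler0z in h0; rewrite /r /s in rs big h0 sNr Dk Dl *; nia.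
    split; first by rewrite /u; nia.
    move=> z zx zkl; rewrite -Uq -Ul; apply/eqP; rewrite eq_le.
    have Cz := C z zx zkl; have := shift z zkl; rewrite lvl => /eqP; rewrite subr_eq0 => /eqP sE.
    rewrite -{1}sE !closed_mono //; rewrite /u; lia.
  have lvl : m s - m r + 1 = -1.
    have h0 : -1 <= (m s - m r + 1)%:~R :> R.
      rewrite -sh0 -[_ - co _ r]opprB lerN2; apply: closed_bound => //.
      by rewrite /r /s in rs sNr Dk Dl *; lia.
    have {}h0 : -1 <= m s - m r + 1 by rewrite -(@ler_int R).
    by rewrite /r /s in rs big h0 sNr Dk Dl *; nia.
  split; first by rewrite /u; lia.
  move=> z zx zkl; rewrite -Uq -Ul; apply/eqP; rewrite eq_le.
  have Cz := C z zx zkl; have := shift z zkl; rewrite lvl => sE.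
  apply/andP; split; last by apply: closed_mono => //; rewrite /u; lia.
  have : co (U z) u - co (U z) s <= 1.
    by apply: closed_bound => //; rewrite /u; nia.
  by move: sE; rewrite -[(-1)%:~R]/(-1 : R); lra.
(* Moving x0 inside the hyperplane keeps x_q - x_l constant, so e_q - e_l would be proportional to
   e_k - e_l. The vectors e_q and e_k + e_l refute this except for q = -k, l = 0. *)
have perturb (v : V) : co v k = co v l -> co v q = co v l.
  move=> vkl; pose M := 1 + \sum_(i < n) `|co v i.+1%:Z|.
  have M1 : 1 <= M by rewrite lerDl sumr_ge0.
  pose t := eps / (M + M).
  have t0 : 0 < t by rewrite divr_gt0 //; lra.
  have small i : (`|i| <= n)%N -> `|co v i| < M.
    have W1 j : (`|j| <= n)%N -> 0 < j -> `|co v j| < M.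
      move=> jn j0; have [j' ->] := ord_of j0 jn.
      rewrite /M (bigD1 j') //=; have : 0 <= \sum_(i < n | i != j') `|co v i.+1%:Z|.
        by rewrite sumr_ge0.
      by lra.
    move=> iN; have [i0|i0|->] := ltgtP i 0; last by rewrite co0 normr0; lra.
      rewrite -[i]opprK co_opp normrN; apply: W1; lia.
    exact: W1.
  have zx i : (`|i| <= n)%N -> `|co (x0 + t *: v) i - co x0 i| < eps.
    move=> iN; rewrite coD coZ addrC addKr normrM gtr0_norm // /t mulrAC ltr_pdivrMr; last by lra.
    by rewrite ltr_pM2l //; have := small i iN; lra.
  have z1 : co (x0 + t *: v) k - co (x0 + t *: v) l = 1.
    by rewrite !coD !coZ vkl; move: Hx0; lra.
  have := key _ zx z1; have := key _ x0x0 Hx0; rewrite !coD !coZ => h1 h2.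
  have : t * (co v q - co v l) = 0 by lra.
  by move/eqP; rewrite mulf_eq0 gt_eqF //= subr_eq0 => /eqP.
have ql : q != l by rewrite -(sperm_eq DP) // Dq /u -/r; lia.
have qNl : q != - l by rewrite -(sperm_eqN DP) // Dq /u -/r; lia.
have qk : q != k by rewrite -(sperm_eq DP) // Dq -/s.
have dl i j : (`|i| <= n)%N -> (`|j| <= n)%N -> i != 0 -> co (e i) j = (delta i j)%:~R.
  by move=> *; rewrite co_evec_delta.
have nlk : l != - k := neq_opp_sym nkl.
have lk' : l != k by rewrite eq_sym.
have sum_kl : k != 0 -> l != 0 -> co (e k + e l) k = 1 /\ co (e k + e l) l = 1.
  move=> k0 l0; rewrite !coD !dl // !delta_id // [delta l k]delta_ne // [delta k l]delta_ne //.
  by rewrite addr0 add0r.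
have [q0|q0] := eqVneq q 0.
  have k0 : k != 0 by rewrite -q0 eq_sym.
  have l0 : l != 0 by rewrite -q0 eq_sym.
  have [h1 h2] := sum_kl k0 l0.
  have := perturb (e k + e l); rewrite h1 h2 q0 co0 => /(_ erefl)/eqP.
  by rewrite eq_sym oner_eq0.
have [qNk|qNk] := eqVneq q (- k); last first.
  have kq : k != - q := neq_opp_sym qNk.
  have lq : l != - q := neq_opp_sym qNl.
  have kq' : k != q by rewrite eq_sym.
  have lq' : l != q by rewrite eq_sym.
  have := perturb (e q); rewrite !dl // delta_id // [delta q k]delta_ne // [delta q l]delta_ne //.
  by move=> /(_ erefl)/eqP; rewrite oner_eq0.
have k0 : k != 0 by move: q0; rewrite qNk oppr_eq0.
have [l0|l0] := eqVneq l 0; last first.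
  have [h1 h2] := sum_kl k0 l0.
  have := perturb (e k + e l); rewrite qNk co_opp h1 h2 => /(_ erefl)/eqP.
  by rewrite -subr_eq0 -opprD oppr_eq0 -mulr2n pnatr_eq0.
(* Here the two walls coincide. Then D k = -1 and m 1 = 1, so row -1 has the position 2n - 1, less
   than the assumed distance from row 0. *)
have r0 : r = 0 by rewrite /r l0 (sperm0 DP).
have s1 : s = -1 by apply: oppr_inj; rewrite opprK /s -(sperm_opp DP) -qNk Dq /u r0 add0r.
have := key _ x0x0 Hx0; have C0 := C _ x0x0 Hx0.
have u1 : u = 1 by rewrite /u r0.
have : co (U x0) u = co x0 q + (m u)%:~R by rewrite -Dq UD.
rewrite l0 co0 r0 odd_fun0 // => <-; rewrite u1 addr0 => h.
have m1 : co (U x0) s = co x0 k + (m s)%:~R by rewrite UD.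
move: m1 Hx0; rewrite l0 co0 subr0 s1 mo co_opp h oppr0 => h1 h2.
have h3 : (m 1)%:~R = 1 :> R by rewrite rmorphN in h1; lra.
have h4 : m 1 = 1 by apply: (@intr_inj R).
by move: big; rewrite /row_pos -/r -/s r0 s1 mo h4 odd_fun0 //; lia.
Qed.

End Floors.

(** * Paths as decreasing sequences of events *)

(** The default [true] of [nth] acts as an N after the end, so a final E counts as a valley. *)
Lemma valleyP (p : seq bool) (i j : nat) : valley p i j <-> exists q : nat,
  [/\ (q < size p)%N, nth true p q = false, nth true p q.+1 = true,
      i = (nE (take q p)).+1 & j = (nN (take q p)).+1].
Proof.
split=> [[[p1 [p2 [-> [-> ->]]]]|[p1 [-> [-> ->]]]]|[q [qs q0 q1 -> ->]]].
- exists (size p1); rewrite take_size_cat // size_cat /=; split=> //; first by lia.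
    by rewrite nth_cat ltnn subnn.
  by rewrite nth_cat ltnNge leqnSn /= subSn // subnn.
- exists (size p1); rewrite size_rcons ltnSn nth_rcons ltnn eqxx nth_default ?size_rcons //.
  by rewrite -cats1 take_size_cat // /nE /nN !count_cat /= !addn0 addn1.
have [qE|qE] := eqVneq q.+1 (size p); [right|left].
  exists (take q p); have pE : p = rcons (take q p) false.
    by rewrite -q0 -take_nth // qE take_size.
  have EE : nE p = (nE (take q p)).+1 by rewrite {1}pE -cats1 /nE count_cat /= addn1.
  have NE : nN p = nN (take q p) by rewrite {1}pE -cats1 /nN count_cat /= !addn0.
  by rewrite NE EE.
exists (take q p), (drop q.+2 p); split=> //.
by rewrite -{1}[p](cat_take_drop q) (drop_nth true) // q0 (drop_nth true) ?q1 //; lia.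
Qed.

Section Decreasing.
Implicit Types (s t : seq int) (x y : int).

Definition decr s : bool := sorted (fun x y => y < x) s.

Let gt_trans : transitive (fun x y : int => y < x).
Proof. by move=> x y z /= h1 h2; exact: lt_trans h2 h1. Qed.

Lemma decr_uniq s : decr s -> uniq s.
Proof. by apply: sorted_uniq => // x; rewrite ltxx. Qed.

Lemma decr_cat s t : decr s -> decr t ->
  (forall x y, x \in s -> y \in t -> y < x) -> decr (s ++ t).
Proof.
rewrite /decr !sorted_pairwise // pairwise_cat => -> -> H; rewrite !andbT.
by apply/allrelP => x y xs yt; exact: H.
Qed.

Lemma decr_take s (q : nat) : decr s -> (q < size s)%N ->
  take q s = [seq x <- s | nth 0 s q < x].
Proof.
elim: s q => [|a s IH] q //= ds qs; have dt : decr s by exact: path_sorted ds.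
have /allP amax : all (fun y => y < a) s by apply: order_path_min ds.
case: q qs => [|q] qs /=; last by rewrite IH // (amax _ (mem_nth 0 _)).
rewrite ltxx; apply/esym/eqP; rewrite -[_ == _]negbK -has_filter.
by apply/hasPn => y /amax ya; rewrite -leNgt ltW.
Qed.

Lemma decr_nth_lt s (q r : nat) : decr s -> (q < r)%N -> (r < size s)%N ->
  nth 0 s r < nth 0 s q.
Proof. by move=> ds qr rs; apply: (sorted_ltn_nth gt_trans 0 ds) => //; rewrite inE; lia. Qed.

Lemma decr_gap s (q : nat) x : decr s -> (q.+1 < size s)%N -> x \in s ->
  nth 0 s q <= x \/ x <= nth 0 s q.+1.
Proof.
move=> ds qs /(nthP 0)[r rs <-]; have [rq|qr] := leqP r q.
  left; move: rq; rewrite leq_eqVlt => /orP[/eqP->//|rq].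
  by apply/ltW/decr_nth_lt => //; lia.
right; move: qr; rewrite leq_eqVlt => /orP[/eqP->//|rq].
by apply/ltW/decr_nth_lt.
Qed.

Lemma decr_index_lt s x y : decr s -> x \in s -> y \in s -> x < y ->
  (index y s < index x s)%N.
Proof.
move=> ds xs ys xy; rewrite ltnNge leq_eqVlt; apply/negP => /orP[/eqP E|lt].
  by rewrite -(nth_index 0 xs) E nth_index // ltxx in xy.
have := decr_nth_lt ds lt; rewrite index_mem ys !nth_index // => /(_ isT).
by move=> h; have := lt_trans xy h; rewrite ltxx.
Qed.

Lemma count_uniq_eq (s t : seq int) (P : pred int) : uniq s -> uniq t ->
  (forall x, (x \in t) = (x \in s) && P x) -> count P s = size t.
Proof.
move=> us ut H; rewrite -size_filter; apply: perm_size; apply: uniq_perm => //.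
  exact: filter_uniq.
by move=> x; rewrite mem_filter H andbC.
Qed.

End Decreasing.

Section Events.
Variables (n : nat) (m : int -> int).
Hypothesis n2 : (2 <= n)%N.
Hypothesis mo : forall k, m (- k) = - m k.
Hypothesis mb : forall k, (`|k| <= n)%N -> (`|m k| <= 2 * n)%N.
Implicit Types (r s p q k l x y : int).
Local Notation N := (2 * n%:Z).
Local Notation pos := (row_pos n m).

Definition rows : seq int :=
  [seq i%:Z | i <- rev (iota 1 n)] ++ 0 :: [seq - i%:Z | i <- iota 1 n].

Lemma mem_rows r : (r \in rows) = (`|r| <= n)%N.
Proof.
rewrite mem_cat inE; apply/idP/idP.
  case/or3P => [/mapP[i]|/eqP->//|/mapP[i]]; rewrite ?mem_rev mem_iota => ? ->; lia.
move=> rn; have [r0|[r0|r0]] : r = 0 \/ r < 0 \/ 0 < r by lia.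
- by rewrite r0 eqxx orbT.
- apply/or3P/Or33/mapP; exists `|r|%N; rewrite ?mem_iota; lia.
- apply/or3P/Or31/mapP; exists `|r|%N; rewrite ?mem_rev ?mem_iota; lia.
Qed.

Lemma size_rows : size rows = (2 * n).+1.
Proof. by rewrite size_cat /= !size_map size_rev size_iota; lia. Qed.

Lemma rows_decr : decr rows.
Proof.
apply: decr_cat.
- rewrite map_rev /decr rev_sorted.
  by apply: homo_sorted (iota_ltn_sorted 1 n) => a b; rewrite ltz_nat.
- rewrite -cat1s; apply: decr_cat => //.
    by apply: homo_sorted (iota_ltn_sorted 1 n) => a b; lia.
  by move=> x y; rewrite inE => /eqP-> /mapP[i]; rewrite mem_iota; lia.
- move=> x y /mapP[i]; rewrite mem_rev mem_iota => ? ->.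
  by rewrite inE => /predU1P[->|/mapP[j]]; rewrite ?mem_iota; lia.
Qed.

(* The event of row r on level j: an N at the position 2 (N j + r), or an E just
   below it; doubling makes room for the E's, which get the odd positions. *)
Definition event j r : int := 2 * (N * j + r) - (m r != - j)%:Z.

Definition level j : seq int :=
  [seq event j r | r <- rows & (m r == - j) || (m r == - j - 1)].

Definition events : seq int :=
  flatten [seq level j%:Z | j <- rev (iota 0 (2 * n).+1)].

Lemma mem_level j x : reflect (exists r, [/\ (`|r| <= n)%N, x = event j r &
    m r = - j \/ m r = - j - 1]) (x \in level j).
Proof.
apply: (iffP mapP) => [[r]|[r [rn -> H]]].
  rewrite mem_filter mem_rows => /andP[H rn] ->; exists r; split=> //.
  by case/orP: H => /eqP; [left|right].
exists r => //; rewrite mem_filter mem_rows rn andbT.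
by case: H => ->; rewrite eqxx ?orbT.
Qed.

Lemma event_lt j r r' : r' < r -> event j r' < event j r.
Proof. by rewrite /event; case: eqP; case: eqP; lia. Qed.

Lemma level_decr j : decr (level j).
Proof.
apply: (homo_sorted (e := fun x y => y < x)); first by move=> r r' /=; exact: event_lt.
apply: sorted_filter; last exact: rows_decr.
by move=> x y z /= h1 h2; exact: lt_trans h2 h1.
Qed.

(** Two levels could only meet in row -n of the upper and row n of the lower one. Events on these
    levels need m(-n) < 0 and m(n) <= 0, against oddness. *)
Lemma level_lt j j' x y : 0 <= j' < j -> x \in level j -> y \in level j' -> y < x.
Proof.
move=> jj /mem_level[r [rn -> rj]] /mem_level[r' [r'n -> r'j]].
have [big|E] : j' + 2 <= j \/ j = j' + 1 by lia.
  by rewrite /event; case: eqP; case: eqP; nia.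
have [h|h] : N + r - r' > 0 \/ N + r - r' = 0 by lia.
  by rewrite /event E; case: eqP; case: eqP; lia.
have rE : r = - r' by lia.
by move: rj; rewrite rE mo E; lia.
Qed.

Lemma events_decr : decr events.
Proof.
suff W (k : nat) : decr (flatten [seq level j%:Z | j <- rev (iota 0 k)]) by exact: W.
elim: k => [//|k IH]; rewrite -[k.+1]addn1 iotaD /= rev_cat /= add0n.
apply: decr_cat => //; first exact: level_decr.
move=> x y xk /flattenP[s /mapP[j]]; rewrite mem_rev mem_iota => jk -> yj.
by apply: level_lt xk yj; lia.
Qed.

Lemma mem_events x : reflect (exists r, (`|r| <= n)%N /\
  (m r <= 0 /\ x = 2 * pos r \/ m r <= -1 /\ x = 2 * (pos r - N) - 1)) (x \in events).
Proof.
apply: (iffP flattenP) => [[s /mapP[j _ ->] /mem_level[r [rn -> H]]]|[r [rn H]]].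
  exists r; split=> //; rewrite /event /row_pos; case: H => mE; [left|right].
    by rewrite mE eqxx subr0; split; [lia|ring].
  have -> : (m r == - j%:Z) = false by lia.
  by rewrite mE /=; split; [lia|ring].
have mr := mb rn; case: H => -[m0 ->].
  exists (level `|m r|%N%:Z).
    by apply/mapP; exists `|m r|%N; rewrite ?mem_rev ?mem_iota //; lia.
  apply/mem_level; exists r; split=> //; last by left; lia.
  have -> : `|m r|%N%:Z = - m r by lia.
  by rewrite /event opprK eqxx /row_pos /=; ring.
exists (level (`|m r|%N.-1)%:Z).
  by apply/mapP; exists (`|m r|%N.-1); rewrite ?mem_rev ?mem_iota //; lia.
apply/mem_level; exists r; split=> //; last by right; lia.
have -> : (`|m r|%N.-1)%:Z = - m r - 1 by lia.
rewrite /event; have -> : (m r == - (- m r - 1)) = false by lia.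
by rewrite /row_pos /=; ring.
Qed.

(** The rows with m < 0, which contribute the E's, correspond under r -> -r to those with m > 0,
    which contribute no N. So the count is that of all 2n + 1 rows. *)
Lemma size_events : size events = (2 * n).+1.
Proof.
pose s := [seq 2 * pos r | r <- rows & m r <= 0] ++
          [seq 2 * (pos r - N) - 1 | r <- rows & m r <= -1].
have inj : {in rows &, injective pos}.
  move=> r r'; rewrite !mem_rows => rn r'n; exact: row_pos_inj.
have ur : uniq rows := decr_uniq rows_decr.
have us : uniq s.
  rewrite cat_uniq !map_inj_in_uniq ?filter_uniq //= ?andbT.
  - apply/hasPn => x /mapP[r _ ->]; apply/mapP => -[r' _]; lia.
  - move=> r r'; rewrite !mem_filter => /andP[_ rr] /andP[_ r'r] E; apply: inj => //; lia.
  - move=> r r'; rewrite !mem_filter => /andP[_ rr] /andP[_ r'r] E; apply: inj => //; lia.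
have /perm_size -> : perm_eq events s.
  apply: uniq_perm => // [|x]; first exact: decr_uniq events_decr.
  apply/mem_events/idP => [[r [rn H]]|].
    rewrite mem_cat; apply/orP; case: H => -[h ->]; [left|right]; apply/mapP;
      exists r => //; by rewrite mem_filter h mem_rows.
  rewrite mem_cat => /orP[] /mapP[r]; rewrite mem_filter mem_rows => /andP[h rn] ->;
    [by exists r; split=> //; left|by exists r; split=> //; right].
rewrite size_cat !size_map !size_filter.
have -> : count (fun r => m r <= -1) rows = count (fun r => ~~ (m r <= 0)) rows.
  have /permP -> : perm_eq rows [seq - r | r <- rows].
    apply: uniq_perm => // [|x]; first by rewrite map_inj_uniq //; exact: oppr_inj.
    rewrite mem_rows; apply/idP/mapP => [xn|[r]]; last by rewrite mem_rows => ? ->; lia.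
    by exists (- x); rewrite ?mem_rows ?opprK //; lia.
  rewrite count_map; apply: eq_count => r /=; rewrite mo; lia.
by rewrite count_predC size_rows.
Qed.

End Events.

(** * The words of zeta_B and d_B *)

Section Words.
Variables (n : nat) (m : int -> int).
Hypothesis n2 : (2 <= n)%N.
Hypothesis mo : forall k, m (- k) = - m k.
Hypothesis mb : forall k, (`|k| <= n)%N -> (`|m k| <= 2 * n)%N.
Implicit Types (r s k l x y : int).
Local Notation N := (2 * n%:Z).
Local Notation pos := (row_pos n m).

Definition letter x : bool := (2 %| x)%Z.

(** Restores the letter that [belast] deletes, so that letters and events correspond one to one. *)
Definition extended_path (p : seq bool) : seq bool :=
  rcons (zetaB_path n p) (last true (Splus_right 0 (area_vector n p))).

Lemma read_word_cat (a b : int) (s t : seq int) :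
  read_word a b (s ++ t) = read_word a b s ++ read_word a b t.
Proof. by rewrite /read_word filter_cat map_cat. Qed.

Lemma read_word_opp (a b : int) (s : seq int) :
  read_word (- a) (- b) [seq - x | x <- s] = read_word a b s.
Proof.
rewrite /read_word filter_map -map_comp.
rewrite (eq_filter (a2 := fun x => (x == a) || (x == b))).
  by apply: eq_map => x /=; rewrite eqr_opp.
by move=> x /=; rewrite !eqr_opp.
Qed.

(** Read from n down to -n, the positive rows give the word of [Sminus_left], row 0 gives the
    additional N on level 0, and the negative rows, where m is minus the area, give that of
    [Splus_right]. *)
Lemma level_letters (p : seq bool) (j : nat) : (forall i : nat, m i%:Z = (0 < i)%N%:Z * area n p i) ->
  [seq letter x | x <- level n m j%:Z] =
  Sminus_left j (area_vector n p) ++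
  (if j == 0%N then [:: true] else [::]) ++ Splus_right j (area_vector n p).
Proof.
move=> mE; rewrite /level -map_comp.
have -> : [seq (letter \o event n m j%:Z) r | r <- rows n & (m r == - j%:Z) || (m r == - j%:Z - 1)] =
    read_word (- j%:Z) (- j%:Z - 1) [seq m r | r <- rows n].
  rewrite /read_word filter_map -map_comp.
  rewrite (eq_filter (a2 := preim m (fun x => (x == - j%:Z) || (x == - j%:Z - 1)))) //.
  apply: eq_map => r /=; rewrite /letter /event; case: eqP => _ /=.
    by rewrite subr0 dvdz_mulr.
  by apply/negP => h; lia.
rewrite /rows map_cat map_cons -!map_comp read_word_cat -cat1s read_word_cat.
congr (_ ++ _); [|congr (_ ++ _)].
- rewrite /Sminus_left /area_vector -map_rev; congr read_word.
  by apply/eq_in_map => -[|i]; rewrite mem_rev mem_iota // => _ /=; rewrite mE mul1r.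
- by rewrite /read_word /= odd_fun0 //; case: (j).
rewrite /Splus_right -[RHS]read_word_opp opprD; congr (read_word _ _ _).
rewrite /area_vector -map_comp; apply/eq_in_map => -[|i] //; rewrite ?mem_iota // => _ /=.
by rewrite mo mE mul1r.
Qed.

Lemma extended_path_events (p : seq bool) : (forall i : nat, m i%:Z = (0 < i)%N%:Z * area n p i) ->
  extended_path p = [seq letter x | x <- events n m].
Proof.
move=> mE; rewrite /extended_path /zetaB_path /events /=.
rewrite rev_cons map_rcons flatten_rcons map_cat (level_letters 0 mE) /=.
rewrite !rcons_cat -lastI; congr (_ ++ _); rewrite map_flatten -map_comp; congr flatten.
apply/eq_in_map => j; rewrite mem_rev mem_iota => j1 /=.
by rewrite (level_letters _ mE) (_ : (j == 0%N) = false) //; lia.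
Qed.

(** The rows behind [d_word], without labels: those of positive position, by increasing position. *)
Definition sorted_rows : seq int := flatten [seq
  [seq j%:Z | j <- iota 1 n & m j%:Z == - i%:Z] ++
  [seq - j%:Z | j <- rev (iota 1 n) & m j%:Z == i%:Z + 1]
  | i <- iota 0 (2 * n).+1].

Lemma mem_sorted_rows r : (r \in sorted_rows) = (`|r| <= n)%N && (0 < pos r).
Proof.
apply/flattenP/andP => [[s /mapP[i _ ->]]|[rn r0]].
  rewrite mem_cat => /orP[] /mapP[j]; rewrite mem_filter ?mem_rev mem_iota => /andP[/eqP mj jn] ->.
    by split; [lia|rewrite /row_pos mj; nia].
  by split; [lia|rewrite /row_pos mo mj; nia].
have mr := mb rn; have [r1|[r1|r1]] : r = 0 \/ 0 < r \/ r < 0 by lia.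
- by move: r0; rewrite /row_pos r1 odd_fun0 //; lia.
- have m0 : m r <= 0 by move: r0; rewrite /row_pos; nia.
  pose B i := [seq j%:Z | j <- iota 1 n & m j%:Z == - i%:Z] ++
    [seq - j%:Z | j <- rev (iota 1 n) & m j%:Z == i%:Z + 1].
  exists (B `|m r|%N); first by apply/mapP; exists `|m r|%N; rewrite ?mem_iota //; lia.
  rewrite mem_cat; apply/orP; left; apply/mapP; exists `|r|%N; last by lia.
  by rewrite mem_filter mem_iota gtz0_abs //; lia.
have m0 : m r < 0 by move: r0; rewrite /row_pos; nia.
pose B i := [seq j%:Z | j <- iota 1 n & m j%:Z == - i%:Z] ++
  [seq - j%:Z | j <- rev (iota 1 n) & m j%:Z == i%:Z + 1].
exists (B `|m r|.-1%N); first by apply/mapP; exists (`|m r|.-1)%N; rewrite ?mem_iota //; lia.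
rewrite mem_cat; apply/orP; right; apply/mapP; exists `|r|%N; last by lia.
by rewrite mem_filter mem_rev mem_iota ltz0_abs // mo; lia.
Qed.

Lemma decr_map_in (s : seq nat) (f g : nat -> int) :
  {in s, f =1 g} -> decr (map g s) -> decr (map f s).
Proof. by move=> /eq_in_map ->. Qed.

Lemma sorted_rows_decr : decr [seq - pos r | r <- sorted_rows].
Proof.
rewrite /sorted_rows; elim: (2 * n).+1 => [//|k IH].
rewrite -[k.+1]addn1 iotaD map_cat flatten_cat map_cat; apply: decr_cat => //=.
- rewrite cats0 map_cat -!map_comp; apply: decr_cat.
  + apply: (decr_map_in (g := fun j : nat => - (j%:Z + N * (0 + k)%N%:Z))); last first.
      apply: (homo_sorted (e := ltn)) => [a b|]; first by lia.
      by apply: sorted_filter; [exact: ltn_trans|exact: iota_ltn_sorted].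
    by move=> j; rewrite mem_filter /row_pos /= => /andP[/eqP-> _]; ring.
  + apply: (decr_map_in (g := fun j : nat => - (N * (0 + k)%N%:Z + N - j%:Z))); last first.
      apply: (homo_sorted (e := fun a b => (b < a)%N)) => [a b|]; first by lia.
      apply: sorted_filter; first by move=> a b c /= h1 h2; exact: ltn_trans h2 h1.
      by rewrite rev_sorted; exact: iota_ltn_sorted.
    by move=> j; rewrite mem_filter /row_pos /= mo => /andP[/eqP-> _]; ring.
  move=> x y /mapP[i]; rewrite mem_filter mem_iota => /andP[/eqP mi ?] ->.
  move=> /mapP[j]; rewrite mem_filter mem_rev mem_iota => /andP[/eqP mj ?] ->.
  rewrite /= /row_pos mo mi mj; have [E|E] := eqVneq i j.
    by move: mi mj; rewrite E; lia.
  by lia.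
move=> x y /mapP[r /flattenP[s /mapP[i]]]; rewrite mem_iota => ik -> rs -> /mapP[t].
have key (a : nat) q : q \in [seq j%:Z | j <- iota 1 n & m j%:Z == - a%:Z] ++
    [seq - j%:Z | j <- rev (iota 1 n) & m j%:Z == a%:Z + 1] -> N * a%:Z < pos q < N * a%:Z + N.
  rewrite mem_cat => /orP[] /mapP[j]; rewrite mem_filter ?mem_rev mem_iota => /andP[/eqP mj jn] ->.
    by rewrite /row_pos mj; nia.
  by rewrite /row_pos mo mj; nia.
rewrite cats0 => /key tk ->; have := key _ _ rs; nia.
Qed.

Let posN r : pos (- r) = - pos r. Proof. by rewrite /row_pos mo; ring. Qed.

Lemma size_sorted_rows : size sorted_rows = n.
Proof.
have us : uniq sorted_rows by have := decr_uniq sorted_rows_decr; exact: map_uniq.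
have ur : uniq (rows n) := decr_uniq (rows_decr n2).
have <- : count (fun r => 0 < pos r) (rows n) = size sorted_rows.
  by apply: count_uniq_eq => // x; rewrite mem_sorted_rows (mem_rows n2).
have c0 : count (fun r => pos r == 0) (rows n) = 1%N.
  rewrite -[1%N]/(size [:: 0 : int]); apply: count_uniq_eq => // x.
  rewrite inE (mem_rows n2); apply/idP/idP => [/eqP->|/andP[xn /eqP x0]].
    by rewrite /row_pos odd_fun0 // mulr0 subr0.
  by apply/eqP/(@row_pos_inj n m n2) => //; rewrite x0 /row_pos odd_fun0 // mulr0 subr0.
have cN : count (fun r => pos r < 0) (rows n) = count (fun r => 0 < pos r) (rows n).
  have /permP -> : perm_eq (rows n) [seq - r | r <- rows n].
    apply: uniq_perm => // [|x]; first by rewrite map_inj_uniq //; exact: oppr_inj.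
    rewrite (mem_rows n2); apply/idP/mapP => [xn|[r]]; last by rewrite (mem_rows n2) => ? ->; lia.
    by exists (- x); rewrite ?(mem_rows n2) ?opprK //; lia.
  by rewrite count_map; apply: eq_count => r /=; rewrite posN; lia.
have := size_rows n2; rewrite -(count_predC (fun r => 0 < pos r)).
have -> : count (predC (fun r => 0 < pos r)) (rows n) =
    (count (fun r => (pos r < 0)%R) (rows n) + count (fun r => (pos r == 0)%R) (rows n))%N.
  rewrite -count_predUI addnC; have -> : count (predI (fun r => pos r < 0) (fun r => pos r == 0)) (rows n) = 0%N.
    by rewrite (eq_count (a2 := pred0)) ?count_pred0 // => r /=; lia.
  by rewrite add0n; apply: eq_count => r /=; lia.
by rewrite c0 cN; lia.
Qed.

Definition sort_row : int -> int := sperm_of_word sorted_rows.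

Lemma sort_row_opp k : sort_row (- k) = - sort_row k.
Proof. by rewrite /sort_row /sperm_of_word sgzN abszN mulNr. Qed.

Lemma sort_row_gt0 k : 0 < k -> (`|k| <= n)%N ->
  sort_row k = nth 0 sorted_rows `|k|.-1 /\ sort_row k \in sorted_rows.
Proof.
move=> k0 kn; have E : sort_row k = nth 0 sorted_rows `|k|.-1.
  by rewrite /sort_row /sperm_of_word gtr0_sgz // mul1r.
by split=> //; rewrite E mem_nth // size_sorted_rows; lia.
Qed.

Lemma sort_row_mono k l : (`|k| <= n)%N -> (`|l| <= n)%N -> l < k ->
  pos (sort_row l) < pos (sort_row k).
Proof.
have gt0 i : 0 < i -> (`|i| <= n)%N -> 0 < pos (sort_row i).
  by move=> i0 iN; have [_] := sort_row_gt0 i0 iN; rewrite mem_sorted_rows => /andP[].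
have Np i : sort_row i = - sort_row (- i) by rewrite -sort_row_opp opprK.
have z0 : pos (sort_row 0) = 0 by rewrite /sort_row /sperm_of_word mul0r /row_pos odd_fun0 // mulr0 subr0.
have inc i j : 0 < i -> (`|j| <= n)%N -> i < j -> pos (sort_row i) < pos (sort_row j).
  move=> i0 jn ij; have [||-> _] := @sort_row_gt0 i; try lia.
  have [||-> _] := @sort_row_gt0 j; try lia.
  have := decr_nth_lt sorted_rows_decr (q := `|i|.-1) (r := `|j|.-1).
  rewrite size_map size_sorted_rows => H; have : - pos (nth 0 sorted_rows `|j|.-1) < - pos (nth 0 sorted_rows `|i|.-1).
    by move: H; rewrite !(nth_map 0) ?size_sorted_rows; [apply; lia|lia|lia].
  by rewrite ltrN2.
move=> kn ln lk; have [l0|[l0|l0]] : 0 < l \/ l = 0 \/ l < 0 by lia.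
- exact: inc.
- by rewrite l0 z0; apply: gt0 => //; lia.
have h1 : 0 < pos (sort_row (- l)) by apply: gt0; lia.
rewrite [sort_row l]Np posN; have [k0|[k0|k0]] : 0 < k \/ k = 0 \/ k < 0 by lia.
- by have := gt0 _ k0 kn; lia.
- by rewrite k0 z0; lia.
by rewrite [sort_row k]Np posN ltrN2; apply: inc; lia.
Qed.

Lemma sort_row_sperm : signed_perm n sort_row.
Proof.
have us : uniq sorted_rows by have := decr_uniq sorted_rows_decr; exact: map_uniq.
have po r : (`|r| <= n)%N -> r != 0 -> pos r != 0.
  move=> rn r0; apply/eqP => p0; move/eqP: r0; apply; apply: (@row_pos_inj n m n2) => //.
  by rewrite p0 /row_pos odd_fun0 // mulr0 subr0.
pose h r := sgz (pos r) * (index (sgz (pos r) * r) sorted_rows).+1%:Z.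
have P1 k : 0 < k -> (`|k| <= n)%N -> (0 < `|sort_row k| <= n)%N /\ h (sort_row k) = k.
  move=> k0 kn; have [E M] := sort_row_gt0 k0 kn.
  have := M; rewrite mem_sorted_rows => /andP[h1 h2]; split.
    have : sort_row k != 0 by apply/eqP => s0; move: h2; rewrite s0 /row_pos odd_fun0 //; lia.
    by lia.
  by rewrite /h gtr0_sgz // !mul1r E index_uniq ?size_sorted_rows //; lia.
have hN r : h (- r) = - h r by rewrite /h posN sgzN mulrNN mulNr.
have P2 r : 0 < pos r -> (`|r| <= n)%N -> (0 < `|h r| <= n)%N /\ sort_row (h r) = r.
  move=> r0 rn; have rs : r \in sorted_rows by rewrite mem_sorted_rows rn.
  have hE : h r = (index r sorted_rows).+1%:Z by rewrite /h gtr0_sgz // !mul1r.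
  have lt : (index r sorted_rows < n)%N by rewrite -size_sorted_rows index_mem.
  split; first by rewrite hE; lia.
  have [|| -> _] := @sort_row_gt0 (h r); rewrite ?hE; try lia.
  by rewrite /= nth_index.
apply: (signed_perm_intro (h := h)) => [|k kn|r rn]; first exact: sort_row_opp.
  have [k0|k0] : 0 < k \/ 0 < - k by lia.
    by apply: P1 => //; lia.
  have [||h1 h2] := P1 (- k) => //; first lia.
  move: h1 h2; rewrite sort_row_opp hN abszN => h1 h2; split=> //; exact: oppr_inj.
have := po r; have [r0|[r0|r0]] : 0 < pos r \/ 0 < pos (- r) \/ pos r = 0 by rewrite posN; lia.
- by move=> _; apply: P2 => //; lia.
- move=> _; have [||h1 h2] := P2 (- r) => //; first lia.
  move: h1 h2; rewrite hN sort_row_opp abszN => h1 h2; split=> //; exact: oppr_inj.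
by rewrite r0 eqxx => H; have : false by [apply: H; lia|].
Qed.

Lemma d_B_sort_row (p : seq bool) (v : int -> int) k :
  (forall i : nat, m i%:Z = (0 < i)%N%:Z * area n p i) -> (forall k, v (- k) = - v k) -> (`|k| <= n)%N ->
  let g q := if (`|q|%N == n) && (2 %| area n p n.-1 + area n p n)%Z then - v q else v q in
  d_B n p v k = g (sort_row k).
Proof.
move=> mE vo kn g; have gN q : g (- q) = - g q by rewrite /g abszN vo; case: ifP; rewrite ?opprK.
have -> : d_B n p v = sperm_of_word [seq g r | r <- sorted_rows].
  rewrite /d_B /d_word; congr sperm_of_word; rewrite /sorted_rows !map_flatten -!map_comp; congr flatten.
  apply/eq_in_map => i _ /=; rewrite !map_cat -!map_comp; congr (_ ++ _).
    rewrite (@eq_in_filter _ (fun j : nat => m j%:Z == - i%:Z) (fun j => area n p j == - i%:Z)).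
      by apply: eq_map => j /=.
    by move=> j; rewrite mem_iota mE; case: j => //= j _; rewrite mul1r.
  rewrite (@eq_in_filter _ (fun j : nat => m j%:Z == i%:Z + 1) (fun j => area n p j == i%:Z + 1)).
    by apply: eq_map => j /=; rewrite gN /g /=; case: ifP; rewrite ?opprK.
  by move=> j; rewrite mem_rev mem_iota mE; case: j => //= j _; rewrite mul1r.
rewrite /sperm_of_word /sort_row /sperm_of_word; have [k0|[k0|->]] : 0 < k \/ k < 0 \/ k = 0 by lia.
- by rewrite gtr0_sgz // !mul1r (nth_map 0) // size_sorted_rows; lia.
- by rewrite ltr0_sgz // !mulN1r gN (nth_map 0) // size_sorted_rows; lia.
by rewrite !mul0r odd_fun0.
Qed.

End Words.

(** * Valleys of the word and rows at distance 2n + 1 *)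

Section Valleys.
Variables (n : nat) (m : int -> int).
Hypothesis n2 : (2 <= n)%N.
Hypothesis mo : forall k, m (- k) = - m k.
Hypothesis mb : forall k, (`|k| <= n)%N -> (`|m k| <= 2 * n)%N.
Implicit Types (r s k l x y : int).
Local Notation N := (2 * n%:Z).
Local Notation pos := (row_pos n m).
Local Notation ev := (events n m).
Local Notation D := (sort_row n m).

Let posN r : pos (- r) = - pos r. Proof. by rewrite /row_pos mo; ring. Qed.

Let sz : size ev = (2 * n).+1 := size_events n2 mo mb.
Let evP := mem_events n2 mb.
Let ev_decr := events_decr n2 mo.
Let DP := sort_row_sperm n2 mo mb.
Let mono := sort_row_mono n2 mo mb.

Definition word : seq bool := [seq letter x | x <- take (2 * n) ev].

Lemma size_word : size word = (2 * n)%N.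
Proof. by rewrite size_map size_take sz ltnSn. Qed.

Lemma take_word (q : nat) : (q < (2 * n).+1)%N ->
  take q word = [seq letter x | x <- ev & nth 0 ev q < x].
Proof.
move=> qn; by rewrite /word -map_take take_takel // decr_take // sz.
Qed.

Lemma nth_word (q : nat) : (q < 2 * n)%N -> nth true word q = letter (nth 0 ev q).
Proof. by move=> qn; rewrite (nth_map 0) ?size_take ?sz ?ltnSn // nth_take. Qed.

Lemma nE_word (q : nat) : (q < (2 * n).+1)%N ->
  nE (take q word) = count (fun x => ~~ letter x && (nth 0 ev q < x)) ev.
Proof.
move=> qn; rewrite take_word // /nE count_map count_filter.
by apply: eq_count => x /=; case: (letter x).
Qed.

Lemma nN_word (q : nat) : (q < (2 * n).+1)%N ->
  nN (take q word) = count (fun x => letter x && (nth 0 ev q < x)) ev.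
Proof.
move=> qn; rewrite take_word // /nN count_map count_filter.
by apply: eq_count => x /=; case: (letter x).
Qed.

Lemma letter_even x : letter (2 * x). Proof. by rewrite /letter dvdz_mulr. Qed.

Lemma letter_odd x : letter (2 * x - 1) = false.
Proof. by apply/negP; rewrite /letter; lia. Qed.

Lemma even_event x : x \in ev -> letter x ->
  exists r, [/\ (`|r| <= n)%N, m r <= 0 & x = 2 * pos r].
Proof.
move=> /evP[r [rn [[m0 ->] _|[m1 ->]]]]; first by exists r.
by rewrite letter_odd.
Qed.

Lemma odd_event x : x \in ev -> letter x = false ->
  exists r, [/\ (`|r| <= n)%N, m r <= -1 & x = 2 * (pos r - N) - 1].
Proof.
move=> /evP[r [rn [[m0 ->]|[m1 ->] _]]]; last by exists r.
by rewrite letter_even.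
Qed.

Lemma evenI r : (`|r| <= n)%N -> m r <= 0 -> 2 * pos r \in ev.
Proof. by move=> rn m0; apply/evP; exists r; split=> //; left. Qed.

Lemma oddI r : (`|r| <= n)%N -> m r <= -1 -> 2 * (pos r - N) - 1 \in ev.
Proof. by move=> rn m0; apply/evP; exists r; split=> //; right. Qed.

Lemma event_min x : x \in ev -> - N - 1 <= x.
Proof. by move=> /evP[r [rn [[m0 ->]|[m0 ->]]]]; rewrite /row_pos; nia. Qed.

Lemma row_m_le0 r : (`|r| <= n)%N -> - n%:Z < pos r -> m r <= 0.
Proof. by rewrite /row_pos => rn h; nia. Qed.

Lemma row_m_lt0 r : (`|r| <= n)%N -> n%:Z < pos r -> m r <= -1.
Proof. by rewrite /row_pos => rn h; nia. Qed.

(* Row r contributes its E-event 4n + 1 below its N-event. *)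
Lemma word_ballot : ballot_path (2 * n) word.
Proof.
split=> [|q]; first exact: size_word.
wlog qn : q / (q <= 2 * n)%N.
  move=> H; have [|qn] := leqP q (2 * n); first exact: H.
  by have := H (2 * n)%N (leqnn _); rewrite !take_oversize ?size_word // ltnW.
rewrite nE_word ?nN_word ?ltnS // -!size_filter.
rewrite -(size_map (fun x => x + (2 * N + 1))); apply: uniq_leq_size.
  rewrite map_inj_uniq ?filter_uniq ?decr_uniq //.
  by move=> x y; exact: addIr.
move=> x /mapP[y]; rewrite mem_filter => /andP[/andP[yo yq] yev] ->.
have [r [rn m1 yE]] := odd_event yev (negbTE yo).
rewrite mem_filter; have -> : y + (2 * N + 1) = 2 * pos r by rewrite yE; ring.
rewrite letter_even /= evenI ?andbT //; last by lia.
by apply: lt_le_trans yq _; rewrite yE; lia.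
Qed.

Lemma count_above k : (`|k| <= n)%N ->
  (count (fun r => pos (D k) < pos r) (rows n))%:Z = n%:Z - k.
Proof.
move=> kn; pose t := [seq D (n%:Z - i%:Z) | i <- iota 0 `|n%:Z - k|].
have -> : count (fun r => pos (D k) < pos r) (rows n) = size t.
  apply: count_uniq_eq => [||x]; first exact: decr_uniq (rows_decr n2).
    rewrite map_inj_in_uniq ?iota_uniq // => i j; rewrite !mem_iota => ? ? E.
    have := sperm_inj DP _ _ E; lia.
  have [h hP hK] := sperm_inverse DP.
  rewrite (mem_rows n2); apply/mapP/andP => [[i]|[xn kx]].
    rewrite mem_iota => iN ->; split; first by apply: (sperm_bound DP); lia.
    by apply: mono; lia.
  have hn := sperm_bound hP xn; have [_ Dh] := hK x xn.
  have lt : k < h x.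
    rewrite ltNge le_eqVlt; apply/negP => /orP[/eqP E|E].
      by move: kx; rewrite -Dh E ltxx.
    by have := mono kn hn E; rewrite Dh; lia.
  exists `|n%:Z - h x|%N; first by rewrite mem_iota; lia.
  by rewrite -[LHS]Dh; congr (D _); lia.
by rewrite size_map size_iota; lia.
Qed.

(** The bound on the position ensures that every row above r has m < 0 and hence an E-event. *)
Lemma count_odd_events r : (`|r| <= n)%N -> n%:Z <= pos r ->
  count (fun x => ~~ letter x && (2 * (pos r - N) - 1 < x)) ev =
  count (fun s => pos r < pos s) (rows n).
Proof.
move=> rn rpos; rewrite -[RHS]size_filter -[RHS](size_map (fun s => 2 * (pos s - N) - 1)).
apply: count_uniq_eq.
- exact: decr_uniq.
- rewrite map_inj_in_uniq ?filter_uniq ?(decr_uniq (rows_decr n2)) // => s t.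
  rewrite !mem_filter !(mem_rows n2) => /andP[_ sn] /andP[_ tn] E.
  by apply: (row_pos_inj n2) => //; lia.
move=> x; apply/mapP/and3P => [[s]|[xev xo xr]].
  rewrite mem_filter (mem_rows n2) => /andP[rs sn] ->; rewrite letter_odd; split=> //.
    by apply: oddI => //; apply: row_m_lt0 => //; lia.
  by lia.
have [s [sn m1 xE]] := odd_event xev (negbTE xo); exists s => //.
by rewrite mem_filter (mem_rows n2) sn; move: xr; rewrite xE; lia.
Qed.

Lemma count_even_events r : - n%:Z <= pos r ->
  count (fun x => letter x && (2 * pos r + 1 < x)) ev =
  count (fun s => pos r < pos s) (rows n).
Proof.
move=> rpos; rewrite -[RHS]size_filter -[RHS](size_map (fun s => 2 * pos s)).
apply: count_uniq_eq.
- exact: decr_uniq.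
- rewrite map_inj_in_uniq ?filter_uniq ?(decr_uniq (rows_decr n2)) // => s t.
  rewrite !mem_filter !(mem_rows n2) => /andP[_ sn] /andP[_ tn] E.
  by apply: (row_pos_inj n2) => //; lia.
move=> x; apply/mapP/and3P => [[s]|[xev xo xr]].
  rewrite mem_filter (mem_rows n2) => /andP[rs sn] ->; rewrite letter_even; split=> //.
    by apply: evenI => //; apply: row_m_le0 => //; lia.
  by lia.
have [s [sn m1 xE]] := even_event xev xo; exists s => //.
by rewrite mem_filter (mem_rows n2) sn; move: xr; rewrite xE; lia.
Qed.

Hypothesis small : forall r r', (`|r| <= n)%N -> (`|r'| <= n)%N ->
  adj_rows n r r' -> pos r' <= pos r + N + 1.

(** Since no event lies between the two, [gap_tight] applies: its first condition excludes N-events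
    in the gap, its second excludes E-events. *)
Lemma adjacent_events a b (q : nat) : (q.+1 < (2 * n).+1)%N ->
  (`|a| <= n)%N -> (`|b| <= n)%N -> m a <= -1 -> m b <= 0 ->
  nth 0 ev q = 2 * (pos a - N) - 1 -> nth 0 ev q.+1 = 2 * pos b ->
  pos a = pos b + N + 1.
Proof.
move=> qn an bn ma mb0 aE bE; have qs : (q.+1 < size ev)%N by rewrite sz.
have lt : nth 0 ev q.+1 < nth 0 ev q by apply: decr_nth_lt.
have gap x : x \in ev -> nth 0 ev q <= x \/ x <= nth 0 ev q.+1 by exact: decr_gap.
rewrite {}aE {}bE in lt gap; have pb : - n%:Z <= pos b by rewrite /row_pos; nia.
apply: (gap_tight n2) => // [|r rn br|r rn br]; first by lia.
  have := gap _ (evenI rn (row_m_le0 rn _)); lia.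
have := gap _ (oddI rn (row_m_lt0 rn _)); lia.
Qed.

(* If the last two events are both E's, then the row of the last one is -n. *)
Lemma final_events a c : (`|a| <= n)%N -> (`|c| <= n)%N -> m a <= -1 -> m c <= -1 ->
  nth 0 ev (2 * n).-1 = 2 * (pos a - N) - 1 -> nth 0 ev (2 * n) = 2 * (pos c - N) - 1 ->
  pos n%:Z = - n%:Z /\ pos a = pos n%:Z + N + 1.
Proof.
move=> an cn ma mc aE cE; have qs : ((2 * n).-1.+1 < size ev)%N by rewrite sz; lia.
have q1 : (2 * n).-1.+1 = (2 * n)%N by lia.
have lt : nth 0 ev (2 * n) < nth 0 ev (2 * n).-1 by rewrite -{1}q1; apply: decr_nth_lt.
have gap x : x \in ev -> nth 0 ev (2 * n).-1 <= x \/ x <= nth 0 ev (2 * n).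
  by rewrite -{2}q1; exact: decr_gap.
have min x : x \in ev -> nth 0 ev (2 * n) <= x.
  move=> xev; have [//|] := lerP (nth 0 ev (2 * n)) x; rewrite -(nth_index 0 xev).
  move: (xev); rewrite -index_mem sz ltnS leq_eqVlt => /orP[/eqP->|xs h]; first by rewrite ltxx.
  by have := decr_nth_lt ev_decr xs; rewrite sz ltnSn => /(_ isT) /(lt_trans h); rewrite ltxx.
rewrite {}aE {}cE in lt gap min.
have m0 : m 0 = 0 by exact: odd_fun0.
(* Row 0 has its N-event at 0, which is even and so lies before the last two events. Both of these
   are therefore negative and on level 0. *)
have h0 : 2 * (pos a - N) - 1 <= 0.
  have : (0 : int) \in ev by have := @evenI 0; rewrite /row_pos m0 mulr0 subr0 mulr0; apply.
  move=> /[dup] /gap + /min; lia.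
have mcE : m c = -1 by move: lt h0; rewrite /row_pos; nia.
have maE : m a = -1 by move: lt h0; rewrite /row_pos; nia.
have aE : pos a - N = a by rewrite /row_pos maE; ring.
have cE : pos c - N = c by rewrite /row_pos mcE; ring.
rewrite aE cE in lt gap min h0.
have low r : (`|r| <= n)%N -> r < a -> r != c -> m r != 0 /\ m r != -1.
  move=> rn ra rc; split; apply/eqP => mr.
    have := gap _ (@evenI r rn _); have := min _ (@evenI r rn _); rewrite /row_pos mr; lia.
  have := gap _ (@oddI r rn _); have := min _ (@oddI r rn _); rewrite /row_pos mr; lia.
have step r : (`|r| <= n)%N -> (`|(r + 1)%R| <= n)%N -> m r <= m (r + 1) + 1.
  by move=> rn r1n; have := small rn r1n (or_introl erefl); rewrite /row_pos; nia.
have cNn : c = - n%:Z.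
  have [//|cN] := eqVneq c (- n%:Z).
  (* Below c the function m avoids 0 and -1, and going down one row it grows by at most 1. So it
     stays at most -2 as far as -n, contradicting the bound at the affine wall. *)
  have down (i : nat) : - n%:Z <= c - 1 - i%:Z -> m (c - 1 - i%:Z) <= -2.
    elim: i => [|i IH] h.
      have h1 : (`|(c - 1 - 0%:Z)%R| <= n)%N by lia.
      have := @step (c - 1 - 0%:Z) h1; have -> : c - 1 - 0%:Z + 1 = c by lia.
      have [||] := low _ h1; lia.
    have h1 : (`|(c - 1 - i.+1%:Z)%R| <= n)%N by lia.
    have := @step (c - 1 - i.+1%:Z) h1; have -> : c - 1 - i.+1%:Z + 1 = c - 1 - i%:Z by lia.
    have [||] := low _ h1; lia.
  have e1 : m (- n%:Z) <= -2.
    have := down `|(c - 1 + n%:Z)%R|%N.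
    have -> : c - 1 - `|(c - 1 + n%:Z)%R|%N%:Z = - n%:Z by lia.
    by move=> h; apply: h; lia.
  have e2 : m (- (n%:Z - 1)) <= -1.
    have [ce|ce] := eqVneq c (- (n%:Z - 1)); first by rewrite -ce mcE.
    have := down `|(c - 1 + (n%:Z - 1))%R|%N.
    have -> : c - 1 - `|(c - 1 + (n%:Z - 1))%R|%N%:Z = - (n%:Z - 1) by lia.
    by move=> /(_ _)h; have : m (- (n%:Z - 1)) <= -2 by [apply: h; lia|]; lia.
  have h : pos (- n%:Z) <= pos (n%:Z - 1) + N + 1 by apply: small; [lia|lia|right; lia].
  by move: h e1 e2; rewrite /row_pos !mo; nia.
have mn : m n%:Z = 1 by move: mcE; rewrite cNn mo; lia.
have nE' : pos n%:Z = - n%:Z by rewrite /row_pos mn; lia.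
split=> //; have paE : pos a = a + N by lia.
apply: (gap_tight n2) => // [|r rn br|r rn br]; first by lia.
  have h1 : 2 * pos r \in ev by apply: evenI => //; apply: row_m_le0 => //; lia.
  by have := gap _ h1; lia.
have h1 : 2 * (pos r - N) - 1 \in ev by apply: oddI => //; apply: row_m_lt0 => //; lia.
by have := gap _ h1; lia.
Qed.

Lemma valley_positions (i j : nat) : valley word i j -> exists k l,
  [/\ (`|k| <= n)%N /\ (`|l| <= n)%N, l < k, k != - l, i%:Z = n%:Z + 1 - k /\ j%:Z = n%:Z + 1 - l
    & pos (D k) = pos (D l) + N + 1].
Proof.
move=> /valleyP[q [qs q0 q1 iE jE]]; rewrite size_word in qs.
rewrite nth_word // in q0; have qev : nth 0 ev q \in ev by rewrite mem_nth // sz; lia.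
have [a [an ma aE]] := odd_event qev q0.
have [b [bn bpos ab]] : exists b, [/\ (`|b| <= n)%N, - n%:Z <= pos b & pos a = pos b + N + 1].
  have q1ev : nth 0 ev q.+1 \in ev by rewrite mem_nth // sz; lia.
  have [lq|lq] := boolP (letter (nth 0 ev q.+1)).
    have [b [bn mb0 bE]] := even_event q1ev lq; exists b; split=> //.
      by rewrite /row_pos; nia.
    by apply: adjacent_events aE bE => //; lia.
  (* The following event is an E although [valleyP] sees an N there, so that N is the default after
     the end of the word. *)
  have qE : q.+1 = (2 * n)%N.
    apply/eqP; rewrite eqn_leq qs leqNgt; apply/negP => h.
    by move: q1; rewrite nth_word // (negbTE lq).
  have [c [cn mc cE]] := odd_event q1ev (negbTE lq).
  have qE' : q = (2 * n).-1 by lia.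
  rewrite qE in cE; rewrite qE' in aE.
  have [nE' ab] := final_events an cn ma mc aE cE.
  by exists n%:Z; split=> //; rewrite nE'.
have [h hP hK] := sperm_inverse DP.
have [_ Da] := hK a an; have [_ Db] := hK b bn.
have kn := sperm_bound hP an; have ln := sperm_bound hP bn.
exists (h a), (h b); split=> //; rewrite ?Da ?Db //.
- rewrite ltNge le_eqVlt; apply/negP => /orP[/eqP E|E].
    by move: ab; rewrite -Da E Db; lia.
  by have := mono ln kn E; rewrite Da Db; lia.
- apply/eqP => E; have : a = - b by rewrite -Da E (sperm_opp DP) Db.
  by move=> abE; move: ab; rewrite abE posN; lia.
split.
  rewrite iE nE_word; last by lia.
  rewrite aE count_odd_events //; last by lia.
  by have := count_above kn; rewrite Da; lia.
rewrite jE nN_word; last by lia.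
rewrite aE (_ : 2 * (pos a - N) - 1 = 2 * pos b + 1); last by rewrite ab; ring.
by rewrite count_even_events //; have := count_above ln; rewrite Db; lia.
Qed.

(** Of the two pairs (k, l) and (-l, -k) of a root, the one with k + l > 0 occurs as a valley: its
    lower row has position at least -n, the range in which the events count all rows above. *)
Lemma position_valley k l (i j : nat) : (`|k| <= n)%N -> (`|l| <= n)%N -> 0 < k + l ->
  pos (D k) = pos (D l) + N + 1 -> i%:Z = n%:Z + 1 - k -> j%:Z = n%:Z + 1 - l ->
  valley word i j.
Proof.
move=> kn ln kl E iE jE; pose a := D k; pose b := D l.
have an : (`|a| <= n)%N := sperm_bound DP kn; have bn : (`|b| <= n)%N := sperm_bound DP ln.
have bpos : - n%:Z <= pos b.
  have : pos (D (- l)) < pos (D k) by apply: mono; lia.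
  by rewrite (sperm_opp DP) posN E /b; lia.
have apos : n%:Z < pos a by rewrite /a E -/b; lia.
have aev : 2 * pos b + 1 \in ev.
  have := oddI an (row_m_lt0 an apos); rewrite /a E -/b.
  by rewrite (_ : 2 * _ - 1 = 2 * pos b + 1) //; ring.
pose q := index (2 * pos b + 1) ev; have qE : nth 0 ev q = 2 * pos b + 1 by exact: nth_index.
have qs : (q < size ev)%N by rewrite index_mem.
have [q1 q1E] : (q < 2 * n)%N /\ nth true word q.+1 = true.
  have nextP x : x \in ev -> x < nth 0 ev q -> (q.+1 < size ev)%N /\ x <= nth 0 ev q.+1.
    move=> xev xq; have q1 : (q.+1 < size ev)%N.
      have := decr_index_lt ev_decr xev aev; rewrite -qE xq qE => /(_ isT) h.
      by apply: leq_ltn_trans h _; rewrite index_mem.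
    by split=> //; have [] := decr_gap ev_decr q1 xev; rewrite // leNgt xq.
  have [b0|b1] : m b <= 0 \/ 1 <= m b by lia.
    have [|q1 h] := nextP _ (evenI bn b0); first by rewrite qE; lia.
    have lt := decr_nth_lt ev_decr (ltnSn q) q1.
    split; first by move: q1; rewrite sz.
    have [h2|h2] := ltnP q.+1 (2 * n).
      by rewrite nth_word // (_ : nth 0 ev q.+1 = 2 * pos b) ?letter_even //; lia.
    by rewrite nth_default // size_word.
  (* Row b has no N-event. Then b = n, and the next event is the E of row -n, the lowest of all and
     the one omitted from [word]; the valley is the final E. *)
  have [bE mn] : b = n%:Z /\ m b = 1 by move: bpos; rewrite /row_pos; nia.
  have pb : pos b = - n%:Z by rewrite /row_pos mn bE; lia.
  have mN : m (- n%:Z) = -1 by rewrite mo -bE mn.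
  have lastev : - N - 1 \in ev.
    have pn : pos n%:Z = - n%:Z by rewrite -{1}bE.
    have := @oddI (- n%:Z); rewrite mN posN pn => h.
    by rewrite (_ : - N - 1 = 2 * (- - n%:Z - N) - 1); [apply: h; lia|lia].
  have [|q1 h] := nextP _ lastev; first by rewrite qE pb; lia.
  have lt := decr_nth_lt ev_decr (ltnSn q) q1.
  have q1ev : nth 0 ev q.+1 \in ev by exact: mem_nth.
  have e' : nth 0 ev q.+1 = - N - 1.
    have [lq|lq] := boolP (letter (nth 0 ev q.+1)).
      have [r [rn r0 rE]] := even_event q1ev lq.
      have rb : r = b by apply: (row_pos_inj n2) => //; move: lt h; rewrite qE pb rE; lia.
      by move: r0; rewrite rb mn.
    have [r [rn r0 rE]] := odd_event q1ev (negbTE lq).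
    by move: lt h; rewrite qE pb rE; lia.
  split; first by move: q1; rewrite sz.
  rewrite nth_default // size_word leqNgt; apply/negP => q2.
  have q2' : (q.+2 < size ev)%N by rewrite sz.
  have := decr_nth_lt ev_decr (ltnSn q.+1) q2'; rewrite e' => h'.
  by have := le_lt_trans (event_min (mem_nth 0 q2')) h'; rewrite ltxx.
apply/valleyP; exists q; split=> //; first by rewrite size_word.
- by rewrite nth_word // qE (_ : 2 * pos b + 1 = 2 * (pos b + 1) - 1) ?letter_odd //; ring.
- rewrite nE_word; last by lia.
  rewrite qE (_ : 2 * pos b + 1 = 2 * (pos a - N) - 1); last by rewrite /a E -/b; ring.
  by rewrite count_odd_events //; [have := count_above kn; rewrite -/a; lia|lia].
rewrite nN_word; last by lia.
by rewrite qE count_even_events //; have := count_above ln; rewrite -/b; lia.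
Qed.

End Valleys.

(** * The rows of a labelled lattice path *)

Definition easts_list (p : seq bool) : seq nat :=
  [seq nE (take k p) | k <- iota 0 (size p) & nth false p k == true].

Lemma easts_list_cons b p : easts_list (b :: p) =
  (if b then [:: 0%N] else [::]) ++ [seq (~~ b + x)%N | x <- easts_list p].
Proof.
rewrite /easts_list /= -[1%N]addn0 iotaDl filter_map -!map_comp.
have E : [seq nE (take k (b :: p)) | k <- [seq (1 + i)%N | i <- iota 0 (size p) & nth false p i == true]] =
    [seq ([eta addn (~~ b)] \o (fun k => nE (take k p))) i | i <- iota 0 (size p) & nth false p i == true].
  by rewrite -map_comp; apply: eq_map => k /=; rewrite /nE /=; case: (b).
by case: b E => /= <-.
Qed.

Lemma easts_list_spec p :
  [/\ size (easts_list p) = nN p, forall i, (nth 0 (easts_list p) i <= nE p)%N,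
      (0 < size (easts_list p))%N -> nth 0%N (easts_list p) 0 = 0%N -> exists q, p = true :: q
    & forall i, (i.+1 < size (easts_list p))%N ->
        (nth 0 (easts_list p) i <= nth 0 (easts_list p) i.+1)%N /\
        (nth 0 (easts_list p) i = nth 0 (easts_list p) i.+1 -> rise p i.+1)].
Proof.
elim: p => [|b p [IH1 IH2 IH3 IH4]]; first by split=> // i; rewrite nth_nil.
have rise_cons i : rise p i -> rise (b :: p) (b + i).
  move=> [p1 [p2 [-> ->]]]; exists (b :: p1), p2; split=> //.
  by rewrite /nN /=; case: b.
have nthm (c : nat) i : (i < size (easts_list p))%N ->
    nth 0%N [seq (c + x)%N | x <- easts_list p] i = (c + nth 0 (easts_list p) i)%N.
  by move=> ?; rewrite (nth_map 0%N).
rewrite easts_list_cons; case: b rise_cons => rise_cons /=.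
  rewrite map_id_in //; split=> [|[|i]|_ _|[|i]] //=.
  - by rewrite IH1.
  - by exists p.
  - by move=> s0; split=> // /esym /(IH3 s0)[q ->]; exists [::], q.
  - rewrite ltnS => /IH4[h1 h2]; split=> // /h2/rise_cons.
    by [].
rewrite size_map; split.
- by rewrite IH1.
- move=> i; have [h|h] := ltnP i (size (easts_list p)); last first.
    by rewrite nth_default // size_map.
  by rewrite nthm // /nE /= leq_add2l IH2.
- by move=> s0; rewrite nthm.
- move=> i si; rewrite !nthm //; last by lia.
  have [h1 h2] := IH4 _ si; rewrite leq_add2l; split=> // /addnI/h2/rise_cons.
  by [].
Qed.

Section PathRows.
Variables (n : nat) (p : seq bool) (v : int -> int).
Hypothesis n2 : (2 <= n)%N.
Hypothesis pv : Vert n (p, v).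
Implicit Types (k r : int).
Local Notation N := (2 * n%:Z).

Definition area_row k : int := sgz k * area n p `|k|.

Definition area_label k : int :=
  if (`|k|%N == n) && (2 %| area n p n.-1 + area n p n)%Z then - v k else v k.

Let vP : signed_perm n v. Proof. by case: pv. Qed.

Lemma easts_le i : (easts p i <= n)%N.
Proof.
have [_ H _ _] := easts_list_spec p.
by case: pv => -[/= nEp _] _ _ _; have := H i.-1; rewrite nEp.
Qed.

Lemma easts_step i : (0 < i < n)%N -> (easts p i <= easts p i.+1)%N /\
  (easts p i = easts p i.+1 -> v i%:Z < v i.+1%:Z).
Proof.
case: i => // i iN; have [h1 _ _ H] := easts_list_spec p.
case: pv => -[/= nEp nNp] _ R _; have [|h2 h3] := H i; first by rewrite h1 nNp.
by split=> // E; apply: R; apply: h3.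
Qed.

Lemma easts_start : easts p 1 = 0%N -> 0 < v 1.
Proof.
have [h1 _ H _] := easts_list_spec p.
case: pv => -[/= nEp nNp] _ _ R E; have [|q pE] := H _ E; first by rewrite h1 nNp; lia.
exact: R pE.
Qed.

Lemma area_row_opp k : area_row (- k) = - area_row k.
Proof. by rewrite /area_row sgzN abszN mulNr. Qed.

Lemma area_row_nat (i : nat) : area_row i%:Z = (0 < i)%N%:Z * area n p i.
Proof. by rewrite /area_row; case: i => [|i]; rewrite ?mul0r // gtr0_sgz. Qed.

Lemma area_label_opp k : area_label (- k) = - area_label k.
Proof. by rewrite /area_label abszN (sperm_opp vP); case: ifP. Qed.

Lemma area_label_sperm : signed_perm n area_label.
Proof.
have [h hP hK] := sperm_inverse vP.
pose flip k : int := if (`|k|%N == n) && (2 %| area n p n.-1 + area n p n)%Z then - k else k.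
have flipP : signed_perm n flip.
  by apply: (signed_perm_intro (h := flip)) => [k|k kn|k kn]; rewrite /flip;
    case: (2 %| _)%Z; rewrite ?andbT ?andbF //; do ![case: ifP => /= ?]; lia.
have [_ bij] := sperm_comp vP flipP.
split; first exact: area_label_opp.
suff -> : area_label = v \o flip by [].
by apply/funext => k; rewrite /area_label /flip /=; case: ifP; rewrite ?(sperm_opp vP).
Qed.

Let A : int := 2 * (easts p n)%:Z - (easts p n.-1)%:Z.
Let even_sum : bool := ~~ odd (\sum_(1 <= k < n.-1) easts p k).

Lemma area_lt (i : nat) : (i < n)%N -> area n p i = (easts p i)%:Z - i%:Z.
Proof. by move=> iN; rewrite /area /lambda iN. Qed.

Lemma area_last : area n p n =
  if triangular_even n == even_sum then A - n%:Z else n%:Z + 1 - A.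
Proof.
rewrite /area /lambda ltnn -/(triangular_even n) -/even_sum -/A.
by case: (triangular_even n); case: even_sum => //=; rewrite /A; ring.
Qed.

Lemma area_row_bound k : (`|k| <= n)%N -> (`|area_row k| <= 2 * n)%N.
Proof.
have e1 := easts_le n; have e2 := easts_le n.-1.
have [|e3 _] := @easts_step n.-1; first by lia.
rewrite prednK in e3; last by lia.
move=> kn; have [k0|k0] := eqVneq k 0; first by rewrite /area_row k0 mul0r.
have -> : `|area_row k|%N = `|area n p `|k| |%N.
  by rewrite /area_row abszM (_ : `|sgz k|%N = 1%N) ?mul1n //; case: sgzP k0.
have [kN|kN] := ltnP `|k| n.
  by rewrite area_lt //; have := easts_le `|k|; lia.
have -> : `|k|%N = n by lia.
by rewrite area_last /A; case: ifP => _; lia.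
Qed.

(** Consecutive values pi_i <= pi_{i+1} make m drop by at most 1, with equality at a rise, where v
    increases. The last two rows meet this at the wall (n - 1, n) if m(n - 1) + m(n) is odd, and at
    the affine wall if it is even; the sign change of the label at n turns the rise condition into
    the one needed there. *)
Lemma area_row_small_floors : small_floors n area_label area_row.
Proof.
have e1 := easts_le n; have e2 := easts_le n.-1.
have [|e3 e4] := @easts_step n.-1; first by lia.
rewrite prednK in e3 e4; last by lia.
have En : (n%:Z - 1) = n.-1%:Z by lia.
have aP : area n p n.-1 = (easts p n.-1)%:Z - n%:Z + 1 by rewrite area_lt; lia.
have aN : area n p n = A - n%:Z /\ ~~ (2 %| area n p n.-1 + area n p n)%Z \/
          area n p n = n%:Z + 1 - A /\ (2 %| area n p n.-1 + area n p n)%Z.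
  by rewrite area_last; case: ifP => _; [left|right]; split=> //; rewrite aP /A; lia.
have gP i : (i < n)%N -> area_label i%:Z = v i%:Z.
  by move=> iN; rewrite /area_label (_ : (`|i%:Z|%N == n) = false) //; lia.
have gN : area_label n%:Z = if (2 %| area n p n.-1 + area n p n)%Z then - v n%:Z else v n%:Z.
  by rewrite /area_label eqxx.
have n1 : n.-1%:Z + 1 = n%:Z by lia.
have mP i : (0 < i)%N -> area_row i%:Z = area n p i by move=> i0; rewrite area_row_nat i0 mul1r.
apply: small_floors_half => //; [exact: area_row_opp|exact: area_label_opp| | |].
- move=> r rn; have [i rE] : exists i : nat, r = i%:Z by exists `|r|%N; lia.
  have iN : (i < n)%N by lia.
  rewrite {r rn}rE; have [i0|i0] := posnP i.
    rewrite i0 (_ : 0%:Z + 1 = 1%:Z) // (mP 1%N) // (area_row_nat 0) mul0r (@area_lt 1) // (gP 0%N) ?(gP 1%N); try lia.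
    split; first by lia.
    by move=> E; rewrite (sperm0 vP); apply: easts_start; lia.
  have -> : i%:Z + 1 = i.+1%:Z by lia.
  rewrite !mP //; have [iN'|iN'] := ltnP i.+1 n.
    have [|h1 h2] := @easts_step i; first by lia.
    by rewrite !area_lt // !gP //; split; [lia|move=> E; apply: h2; lia].
  have iE : i = n.-1 by lia.
  have iE' : i.+1 = n by lia.
  rewrite iE' iE gP ?aP; last by lia.
  by rewrite gN; move: aN; rewrite aP /A => -[[-> /negbTE->]|[-> ->]]; split; lia.
- rewrite En !mP; [|lia|lia]; rewrite aP.
  by move: aN; rewrite aP /A => -[[-> _]|[-> _]]; lia.
rewrite En !mP; [|lia|lia]; rewrite aP gP; last by lia.
rewrite gN; move: aN; rewrite aP /A => -[[-> /negbTE->]|[-> ->]] E; first by lia.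
by have := e4; rewrite subr_lt0; apply; lia.
Qed.

(** The two candidates A - n and n + 1 - A for the last entry add up to 1, so they have opposite
    parities. The case distinctions in [lambda] and [area] select the one that makes the total
    even. *)
Lemma area_row_even : (2 %| coord_sum n area_row)%Z.
Proof.
have sum2 (F : nat -> int) : \sum_(i < n) F i.+1 = \sum_(i < n.-2) F i.+1 + F n.-1 + F n.
  by have [i nE] : exists i, n = i.+2 by [exists n.-2; lia]; rewrite nE !big_ord_recr.
pose S := (\sum_(1 <= k < n.-1) easts p k)%N.
have SE : \sum_(i < n.-2) area n p i.+1 + \sum_(i < n.-2) i.+1%:Z = S%:Z.
  rewrite -big_split /= /S (_ : n.-1 = n.-2.+1); last by lia.
  rewrite big_add1 big_mkord (big_morph Posz PoszD (erefl : 0%:Z = 0)).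
  apply: eq_bigr => i _; rewrite area_lt ?subrK //; have := ltn_ord i; lia.
have := triangular_evenE n2; rewrite (sum2 Posz) => TE.
have -> : coord_sum n area_row = \sum_(i < n) area n p i.+1.
  by apply: eq_bigr => i _; rewrite area_row_nat mul1r.
rewrite sum2; move: SE TE area_last; rewrite [area n p n.-1]area_lt; last by lia.
move: (\sum_(i < n.-2) area n p i.+1) (\sum_(i < n.-2) i.+1%:Z) => X T SE TE.
have ES : even_sum = (2 %| S%:Z)%Z by rewrite /even_sum -dvdn2.
by rewrite -TE ES /A -SE => ->; case: ifP; lia.
Qed.

End PathRows.

(** * The zeta map on labelled paths *)

Section Roots.
Variables (R : realType) (n : nat).
Hypothesis n2 : (2 <= n)%N.
Local Notation V := 'rV[R]_n.
Local Notation e := (evec R n).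
Implicit Types (k l t b : int).

Lemma valley_rootE (i j : nat) : (i <= n.+1)%N ->
  valley_root R n i j = e (n%:Z + 1 - i%:Z) - e (n%:Z + 1 - j%:Z).
Proof.
move=> iN; have subE (a : nat) : (a <= n.+1)%N -> (n.+1 - a)%N%:Z = n%:Z + 1 - a%:Z by lia.
rewrite /valley_root -subE //; case: ltngtP => jN.
- by rewrite -(subE j) // ltnW.
- have -> : n%:Z + 1 - j%:Z = - (j - n.+1)%N%:Z by lia.
  by rewrite evecN opprK.
have -> : n%:Z + 1 - j%:Z = 0 by lia.
by rewrite evec0 subr0.
Qed.

Lemma ballot_valley (b : seq bool) (i j : nat) : ballot_path (2 * n) b -> valley b i j ->
  [/\ (0 < i < j)%N, (i <= n)%N & (i + j <= (2 * n).+1)%N].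
Proof.
move=> [sb B] /valleyP[q [qs q0 q1 iE jE]].
have := B q.+1; rewrite (take_nth true) // q0 -cats1 /nE /nN !count_cat /= !addn0 addn1 -iE => ij.
have := count_predC id (take q b); rewrite size_take qs => c.
have cE : count id (take q b) = nN (take q b) by apply: eq_count => -[].
have cE' : count (predC id) (take q b) = nE (take q b) by apply: eq_count => -[].
have jE' : nN (take q b) = j.-1 by rewrite jE.
rewrite -/(nN _) in ij; rewrite cE cE' in c; rewrite jE' in ij c; split; lia.
Qed.

Lemma valleys_comparable (b : seq bool) (i j i' j' : nat) : valley b i j -> valley b i' j' ->
  [\/ i = i' /\ j = j', (i < i')%N /\ (j < j')%N | (i' < i)%N /\ (j' < j)%N].
Proof.
have W (q r : nat) : (r < size b)%N -> (q < r)%N -> nth true b q = false -> nth true b q.+1 = true ->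
    nth true b r = false -> (nE (take q b) < nE (take r b))%N /\ (nN (take q b) < nN (take r b))%N.
  move=> rs qr q0 q1 r0; have qr2 : (q.+2 <= r)%N.
    by rewrite ltn_neqAle qr andbT; apply/eqP => E; move: r0; rewrite -E q1.
  have -> : take r b = take q b ++ [:: false, true & drop q.+2 (take r b)].
    rewrite -{1}(cat_take_drop q.+2 (take r b)) take_takel //.
    by rewrite (take_nth true) ?(take_nth true (n := q)) ?q0 ?q1 ?cat_rcons //; lia.
  by rewrite /nE /nN !count_cat /=; lia.
move=> /valleyP[q [qs q0 q1 -> ->]] /valleyP[r [rs r0 r1 -> ->]].
have [qr|rq|->] := ltngtP q r; last by apply: Or31.
  by have [h1 h2] := W _ _ rs qr q0 q1 r0; apply: Or32.
by have [h1 h2] := W _ _ qs rq r0 r1 q0; apply: Or33.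
Qed.

Lemma valley_posroot (b : seq bool) a : ballot_path (2 * n) b -> @valley_roots R n b a ->
  exists k l (i j : nat), [/\ valley b i j, i%:Z = n%:Z + 1 - k /\ j%:Z = n%:Z + 1 - l,
    `|l| < k, k <= n%:Z & a = e k - e l].
Proof.
move=> B [i [j [v ->]]]; have [h1 h2 h3] := ballot_valley B v.
exists (n%:Z + 1 - i%:Z), (n%:Z + 1 - j%:Z), i, j; split=> //; try lia.
by rewrite valley_rootE //; lia.
Qed.

(** The pairing with the fundamental coweight e_t + ... + e_n. It is nonnegative on positive roots,
    so it is monotone for the root order. *)
Definition upper_sum t (x : V) : R := \sum_(i < n | t <= i.+1%:Z) co x i.+1%:Z.

Definition step t k : int := (t <= k)%R%:Z - (k <= - t)%R%:Z.

Lemma step_values t k : 0 < t ->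
  [/\ t <= k -> step t k = 1, k <= - t -> step t k = -1, - t < k < t -> step t k = 0
    & -1 <= step t k <= 1].
Proof. by move=> t0; rewrite /step; case: (lerP t k); case: (lerP k (- t)); split; lia. Qed.

Lemma upper_sum_evec t k : 0 < t -> t <= n%:Z -> (`|k| <= n)%N -> upper_sum t (e k) = (step t k)%:~R.
Proof.
move=> t0 tn; have pos q : 0 < q -> (`|q| <= n)%N -> upper_sum t (e q) = (step t q)%:~R.
  move=> q0 qn; have [i iE] := ord_of q0 qn; rewrite iE.
  rewrite /upper_sum (eq_bigr (fun j : 'I_n => (j == i)%:R)) => [|j _]; last first.
    rewrite co_evec_delta //; [|by rewrite -iE|by have := ltn_ord j; lia].
    have -> : delta i.+1%:Z j.+1%:Z = (j == i)%:Z by rewrite /delta -val_eqE /=; lia.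
    by rewrite -pmulrn.
  rewrite /step (_ : (i.+1%:Z <= - t) = false) ?subr0 -?pmulrn; last by lia.
  case: (boolP (t <= i.+1%:Z)) => ti.
    by rewrite (bigD1 i) //= eqxx big1 ?addr0 // => j /andP[_ /negbTE->].
  by rewrite big1 // => j tj; case: eqP => // ji; move: tj; rewrite ji (negbTE ti).
have [k0|[k0|->]] : 0 < k \/ 0 < - k \/ k = 0 by lia.
- exact: pos.
- move=> kn; have := pos _ k0; rewrite evecN abszN => /(_ kn).
  have -> : upper_sum t (- e k) = - upper_sum t (e k).
    by rewrite /upper_sum -sumrN; apply: eq_bigr => i _; rewrite coN.
  by move=> /(canRL (@opprK _)) ->; rewrite -rmorphN; congr (_%:~R); rewrite /step; lia.
move=> _; have [_ _ s0 _] := step_values 0 t0; rewrite s0 ?t0 ?andbT; last by lia.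
by rewrite /upper_sum big1 // => i _; rewrite evec0 /co dot0l.
Qed.

Lemma upper_sum_le t (a a' : V) : 0 < t -> t <= n%:Z -> root_le (typeB R n) a a' ->
  upper_sum t a <= upper_sum t a'.
Proof.
move=> t0 tn [s sP E]; have sB x y : upper_sum t (x - y) = upper_sum t x - upper_sum t y.
  by rewrite /upper_sum -sumrB; apply: eq_bigr => i _; rewrite coD coN.
have z0 : upper_sum t 0 = 0 by rewrite -[X in upper_sum _ X](subrr 0) sB subrr.
rewrite -subr_ge0 -sB E; elim: s sP {E} => [|g s IH] sP; first by rewrite big_nil z0.
have -> : \sum_(x <- g :: s) x = g - (0 - \sum_(x <- s) x) by rewrite big_cons sub0r opprK.
rewrite sB sB z0 sub0r opprK addr_ge0 //; last first.
  by apply: IH => x xs; apply: sP; rewrite inE xs orbT.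
have /posrootP[k [l [kn ln lk kl ->]]] := sP g (mem_head _ _).
rewrite sB !upper_sum_evec // -rmorphB ler0z /step.
by case: (lerP t k); case: (lerP k (- t)); case: (lerP t l); case: (lerP l (- t)); lia.
Qed.

(** Along a path both indices of a valley increase together, so two different valleys shift both
    ends of the root in the same direction. A suitable upper sum then contradicts [root_le]. *)
Lemma antichain_valley_roots (b : seq bool) : ballot_path (2 * n) b ->
  antichain (typeB R n) (@valley_roots R n b).
Proof.
move=> B; split=> [a /(valley_posroot B)[k [l [i [j [v [iE jE] lk kn ->]]]]]|].
  by apply/posrootP; exists k, l; split=> //; lia.
move=> a a' /(valley_posroot B)[k [l [i [j [v [iE jE] lk kn ->]]]]].
move=> /(valley_posroot B)[k' [l' [i' [j' [v' [iE' jE'] lk' kn' ->]]]]] le.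
have ineq t : 0 < t -> t <= n%:Z -> step t k - step t l <= step t k' - step t l'.
  move=> t0 tn; have := upper_sum_le t0 tn le.
  have sB x y : upper_sum t (x - y) = upper_sum t x - upper_sum t y.
    by rewrite /upper_sum -sumrB; apply: eq_bigr => q _; rewrite coD coN.
  by rewrite !sB !upper_sum_evec ?(ler_int, =^~ rmorphB) //; lia.
(* The threshold t = k refutes k' < k; for k < k' it yields l' < k. *)
have k0 : 0 < k by lia.
have h1 := ineq k k0 kn; have [kk _ _ _] := step_values k k0; have [_ _ kl _] := step_values l k0.
have [kk' _ kk0 _] := step_values k' k0; have [kl' _ kl0 _] := step_values l' k0.
have [[ii jj]|[ii jj]|[ii jj]] := valleys_comparable v v'; last 2 first.
- by exfalso; lia.
- exfalso; have lk2 : l' < k by lia.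
  (* For l < l' the contradiction comes from the threshold l' if it is positive, and from -l
     otherwise. *)
  have [l0|l0] : 0 < l' \/ 0 < - l by lia.
    have h2 := ineq l' l0; have [a1 _ _ _] := step_values k l0; have [_ _ _ a2] := step_values l l0.
    have [a3 _ _ _] := step_values k' l0; have [a4 _ _ _] := step_values l' l0.
    have : step l' l <= 0 by have [_ a5 a6 _] := step_values l l0; lia.
    by lia.
  have h2 := ineq _ l0; have [a1 _ _ _] := step_values k l0; have [_ a2 _ _] := step_values l l0.
  have [_ _ _ a3] := step_values k' l0; have [a4 _ a5 _] := step_values l' l0.
  by lia.
have -> : k = k' by lia.
by have -> : l = l' by lia.
Qed.

End Roots.

(** * Commutativity of the square *)

Section Commutation.
Variables (R : realType) (n : nat) (p : seq bool) (v : int -> int).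
Hypothesis n2 : (2 <= n)%N.
Hypothesis pv : Vert n (p, v).
Local Notation V := 'rV[R]_n.
Local Notation Phi := (typeB R n).
Local Notation e := (evec R n).
Local Notation m := (area_row n p).
Local Notation g := (area_label n p v).
Local Notation pos := (row_pos n m).
Local Notation D := (sort_row n m).
Implicit Types (k l r : int).

Let vP : signed_perm n v. Proof. by case: pv. Qed.
Let mo := area_row_opp n p.
Let mb := area_row_bound n2 pv.
Let SF := area_row_small_floors n2 pv.
Let gP := area_label_sperm n2 pv.
Let DP := sort_row_sperm n2 mo mb.
Let mono := sort_row_mono n2 mo mb.
Let small r r' rn rn' rr := (SF (r := r) (r' := r') rn rn' rr).1.

Lemma zetaB_path_word : zetaB_path n p = word n m.
Proof.
have E := extended_path_events n2 mo (area_row_nat n p).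
have sE := congr1 size E; rewrite size_rcons size_map (size_events n2 mo mb) in sE.
case: sE => sE; rewrite /word map_take -E /extended_path -cats1 take_size_cat //.
Qed.

Lemma d_B_label k : (`|k| <= n)%N -> d_B n p v k = g (D k).
Proof. by move=> kn; rewrite (d_B_sort_row n2 mo mb (area_row_nat n p)) //; case: vP. Qed.

Lemma d_B_sperm : signed_perm n (d_B n p v).
Proof.
have cP := sperm_comp gP DP; have [h hP hK] := sperm_inverse cP.
apply: (signed_perm_intro (h := h)) => [k|k kn|k kn].
- by rewrite /d_B /sperm_of_word sgzN abszN mulNr.
- have kn' : (`|k| <= n)%N by lia.
  rewrite d_B_label //; have := sperm_bound cP kn'; have [k0 _] := hK k kn'.
  have : k != 0 by lia.
  by move=> /(sperm_neq0 cP kn') /= ? ?; split=> //; lia.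
have kn' : (`|k| <= n)%N by lia.
have hn := sperm_bound hP kn'; have [_ gk] := hK k kn'.
rewrite d_B_label //; split=> //.
have k0 : k != 0 by lia.
by have := sperm_neq0 hP kn' k0; lia.
Qed.

Lemma d_B_act : sperm_act (g \o D) = sperm_act (d_B n p v) :> (V -> V).
Proof.
apply: sperm_act_inj => //; [exact: sperm_comp|exact: d_B_sperm|].
by move=> k kn; rewrite d_B_label.
Qed.

Lemma valley_rootsE a : @valley_roots R n (word n m) a <-> exists k l,
  [/\ (`|k| <= n)%N, (`|l| <= n)%N, l < k, k != - l &
    a = e k - e l /\ pos (D k) = pos (D l) + 2 * n%:Z + 1].
Proof.
split=> [[i [j [vij ->]]]|[k [l [kn ln lk kl [-> E]]]]].
  have [k [l [[kn ln] lk kl [iE jE] E]]] := valley_positions n2 mo mb small vij.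
  have [h1 h2 h3] := ballot_valley n2 (word_ballot n2 mo mb) vij.
  exists k, l; split=> //; split=> //; rewrite valley_rootE //; last by lia.
  by congr (e _ - e _); lia.
wlog kl0 : k l kn ln lk kl E / 0 < k + l.
  move=> W; have [?|kl0] := ltrP 0 (k + l); first exact: W.
  have -> : e k - e l = e (- l) - e (- k) by rewrite !evecN opprK addrC.
  apply: W; rewrite ?abszN ?opprK //; try lia.
  have posN r : pos (- r) = - pos r by rewrite /row_pos mo; ring.
  by rewrite !(sperm_opp DP) !posN E; ring.
have [i iE] : exists i : nat, i%:Z = n%:Z + 1 - k by exists `|(n%:Z + 1 - k)%R|%N; lia.
have [j jE] : exists j : nat, j%:Z = n%:Z + 1 - l by exists `|(n%:Z + 1 - l)%R|%N; lia.
exists i, j; split; first exact: (position_valley n2 mo mb kn ln kl0).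
by rewrite valley_rootE //; [congr (e _ - e _); lia|lia].
Qed.

Lemma zetaB_diag : Diag n (zetaB n (p, v)).
Proof.
split=> /=.
- by rewrite zetaB_path_word; exact: word_ballot.
- exact: d_B_sperm.
move=> i j; rewrite zetaB_path_word => vij.
have [k [l [[kn ln] lk kl [iE jE] E]]] := valley_positions n2 mo mb small vij.
have -> : n%:Z + 1 - i%:Z = k by lia.
have -> : n%:Z + 1 - j%:Z = l by lia.
rewrite !d_B_label //.
have Dk := sperm_bound DP kn; have Dl := sperm_bound DP ln.
have adj : adj_rows n (D l) (D k).
  by apply: (@pos_adjacent n m n2 _ _ 1) => //; rewrite E; ring.
by have [_ H] := SF Dl Dk adj; apply: H.
Qed.

(** The sign of u at n combines that of [area_label] with the one by which w_f acts on the last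
    coordinate: in the odd case [area] reflects lambda_n, which changes the parity that governs the
    sign. *)
Lemma u_labelE k : u_label n p v k = g (wf_g n k).
Proof.
have wk : (`|wf_g n k|%N == n) = (`|k|%N == n).
  by rewrite /wf_g; case: triangular_even => //; case: ifP; rewrite ?abszN.
rewrite /u_label /area_label wk; case: eqP => //= kn; last first.
  by rewrite /wf_g; case: triangular_even => //; case: eqP.
have n1 : (n.-1 < n)%N by lia.
rewrite expN1r -signr_odd.
have -> : (2 %| area n p n.-1 + area n p n)%Z =
    if triangular_even n then odd `|lambda n p n.-1 + lambda n p n|
    else ~~ odd `|lambda n p n.-1 + lambda n p n|.
  rewrite /area n1 ltnn -/(triangular_even n); move: (lambda n p n.-1) (lambda n p n) => x y.
  by case: triangular_even; lia.
rewrite /wf_g kn eqxx; case: (triangular_even n); case: odd => /=;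
  by rewrite ?(sperm_opp vP) ?expr0 ?expr1 ?mulN1r ?mul1r ?opprK.
Qed.

Lemma u_label_sperm : signed_perm n (u_label n p v).
Proof.
have -> : u_label n p v = g \o wf_g n by apply/funext => k; exact: u_labelE.
by apply: sperm_comp => //; exact: wf_g_sperm.
Qed.

(** The vector lambda is the image of the area vector under w_f: i is added to entry i, and in the
    odd case the last entry is reflected to n + 1 minus itself. *)
Lemma area_lambda (i : nat) : (0 < i <= n)%N ->
  m (wf_g n i%:Z) - wf_m n (wf_g n i%:Z) = lambda n p i.
Proof.
move=> /andP[i0 iN]; rewrite /wf_g /wf_m; have iz : sgz i%:Z = 1 by rewrite gtr0_sgz.
case: (boolP (triangular_even n)) => [tri|tri]; rewrite ?absz_nat /=.
  rewrite area_row_nat i0 mul1r opprK /area.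
  have [iN'|iN'] := ltnP i n; first by rewrite subrK.
  have -> : i = n by lia.
  by move: tri; rewrite /triangular_even => ->; rewrite subrK.
have [-> |ne] := eqVneq i n; last first.
  rewrite ?absz_nat (negbTE ne) area_row_nat i0 mul1r opprK /area.
  have -> : (i < n)%N by lia.
  by rewrite subrK.
rewrite abszN absz_nat eqxx mo area_row_nat sgzN /area ltnn -/(triangular_even n) (negbTE tri).
by rewrite gtr0_sgz; lia.
Qed.

Lemma anderson_psi (f : V -> V) : isaff g m f ->
  sperm_act (u_label n p v) (lambda_vec R n p) = - f (w_f_inv0 Phi).
Proof.
move=> fP; have [_ _ _ H] := fP; have uP := u_label_sperm.
have [h hP hK] := sperm_inverse uP; have wP := wf_g_sperm n2.
have Pos k : 0 < k -> (`|k| <= n)%N ->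
    co (sperm_act (u_label n p v) (lambda_vec R n p)) (u_label n p v k) =
    co (- f (w_f_inv0 Phi)) (u_label n p v k).
  move=> k0 kn; rewrite co_sperm_act //; have [i iE] := ord_of k0 kn.
  rewrite u_labelE coN H; last exact: sperm_bound.
  rewrite co_w_f_inv0 //; last exact: sperm_bound.
  rewrite -rmorphB -rmorphN opprB iE area_lambda; last by have := ltn_ord i; lia.
  by rewrite co_ord mxE.
apply: co_inj => k _ kn; have [_ uk] := hK k kn; have hn := sperm_bound hP kn.
rewrite -uk; have [h0|[h0|->]] : 0 < h k \/ 0 < - h k \/ h k = 0 by lia.
- exact: Pos.
- have := Pos _ h0; rewrite abszN => /(_ hn).
  by rewrite (sperm_opp uP) !co_opp => /oppr_inj.
by rewrite (sperm0 uP) !co0.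
Qed.

Lemma psi_lattice : coroot_lattice Phi (sperm_act (u_label n p v) (lambda_vec R n p)).
Proof.
have [f fP] := isaff_exists R gP mo (area_row_even p n2).
rewrite (anderson_psi fP); have [_ _ _ H] := fP; have [h hP hK] := sperm_inverse gP.
apply/(coroot_latticeP n2); exists ((fun k => m k - wf_m n k) \o h); split=> [k||k kn] /=.
- by rewrite (sperm_opp hP) mo wf_m_odd; ring.
- have odd_mw k : m (- k) - wf_m n (- k) = - (m k - wf_m n k) by rewrite mo wf_m_odd; ring.
  have := coord_sum_sperm odd_mw hP; have E1 := area_row_even p n2; have E2 := wf_m_even n2.
  have -> : coord_sum n (fun k => m k - wf_m n k) = coord_sum n m - coord_sum n (wf_m n).
    by rewrite /coord_sum -sumrB.
  by lia.
have hn := sperm_bound hP kn; have [_ gk] := hK k kn.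
by rewrite -{1}gk coN H // co_w_f_inv0 // -rmorphB -rmorphN opprB.
Qed.

Lemma zeta_psi : zeta Phi (psi R n (p, v)) = phi R n (zetaB n (p, v)).
Proof.
have [f fP] := isaff_exists R gP mo (area_row_even p n2).
have fmin := small_floors_minimal n2 fP SF.
have -> : psi R n (p, v) = anderson Phi f by rewrite /psi /anderson (anderson_psi fP).
(* Injectivity on the minimal elements makes the partial inverse in [zeta] return f. *)
have inj : {in shi_minimal Phi &, injective (anderson Phi)}.
  move=> f1 f2; rewrite !inE => min1 min2.
  have [g1 [m1 P1]] := affine_weyl_isaff n2 min1.1.
  have [g2 [m2 P2]] := affine_weyl_isaff n2 min2.1.
  exact: anderson_inj P1 (minimal_small_floors n2 P1 min1) P2 (minimal_small_floors n2 P2 min2).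
rewrite /zeta pinvKV ?inE // /theta_inv (chamber_ofE n2 fP DP mono) d_B_act /phi /=.
congr park_class; apply/seteqP; split=> a; rewrite zetaB_path_word.
  by rewrite -d_B_act => /(floor_values n2 fP DP)/valley_rootsE.
by rewrite /= -d_B_act => /valley_rootsE/(floor_values n2 fP DP).
Qed.

End Commutation.

Theorem theorem6p21 (R : realType) (n : nat) (hn : (2 <= n)%N) :
  (* psi : Vert(B_n) -> Q / (2n+1)Q, zeta_B : Vert(B_n) -> Diag(B_n) and
     phi : Diag(B_n) -> Park(Phi) are well defined *)
  [/\ set_fun (Vert n) (lattice_quotient (typeB R n)) (psi R n),
      set_fun (Vert n) (Diag n) (zetaB n),
      set_fun (Diag n) (park (typeB R n)) (phi R n)
    & forall pv, Vert n pv ->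
        (zeta (typeB R n) \o psi R n) pv = (phi R n \o zetaB n) pv].
Proof.
split=> [[p v] pv|[p v] pv|[b w] [B wP _]|[p v] pv].
- by exists (sperm_act (u_label n p v) (lambda_vec R n p)) => //; exact: psi_lattice.
- exact: zetaB_diag.
- exists (sperm_act w, @valley_roots R n b) => //.
  by split; [exact: sperm_weyl|exact: antichain_valley_roots].
exact: zeta_psi.
Qed.
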